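(* Let $k>0$, let $\alpha,\mu,\omega,\gamma\in\mathbb{C}$ with $\operatorname{Re}(\alpha)>0$, $\operatorname{Re}(\mu)>0$, and let $m=[\operatorname{Re}(\mu)/k]+1$. Let $f$ be a function on $(0,\infty)$ for which the $k$-Prabhakar derivative ${}_{k}D_{\alpha,\mu,\omega}^{\gamma}f$ and the Laplace transforms and limits at $0^+$ occurring below exist, and let $F(u)=\mathcal{L}[f](u)$. Then, for $u$ with $\left|\omega k(ku)^{-\alpha/k}\right|<1$, $$\mathcal{L}\big({}_{k}D_{\alpha,\mu,\omega}^{\gamma}f(t)\big)(u)=(ku)^{\frac{\mu}{k}}\Big(1-\omega k(ku)^{-\frac{\alpha}{k}}\Big)^{\frac{\gamma}{k}}F(u)-\sum_{n=0}^{m-1}k(ku)^{n}\Big[{}_{k}D_{\alpha,\mu-(n+1)k,\omega}^{\gamma}f(0^{+})\Big].$$ In particular, when $m=1$, $$\mathcal{L}\big({}_{k}D_{\alpha,\mu,\omega}^{\gamma}f(t)\big)(u)=(ku)^{\frac{\mu}{k}}\Big(1-\omega k(ku)^{-\frac{\alpha}{k}}\Big)^{\frac{\gamma}{k}}F(u)-k\Big[{}_{k}P_{\alpha,k-\mu,\omega}^{-\gamma}f(t)\Big]_{t=0^{+}}.$$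
   Context: The Laplace transform is $\mathcal{L}[f](u)=\int_0^\infty e^{-ut}f(t)\,dt$ (when the integral exists; $\operatorname{Re}u>0$). Complex powers are principal branches; $[\cdot]$ in the definition of $m$ is the integer part. The $k$-gamma function is $\Gamma_k(z)=\int_0^\infty e^{-t^k/k}t^{z-1}\,dt$ for $\operatorname{Re}z>0$, and the $k$-Pochhammer symbol is $(\gamma)_{n,k}=\gamma(\gamma+k)\cdots(\gamma+(n-1)k)$, $(\gamma)_{0,k}=1$. The $k$-Mittag-Leffler function is $E_{k,\alpha,\mu}^{\gamma}(z)=\sum_{n=0}^\infty \frac{(\gamma)_{n,k}}{\Gamma_k(\alpha n+\mu)}\frac{z^n}{n!}$. The $k$-Prabhakar integral (for $\operatorname{Re}\alpha,\operatorname{Re}\mu>0$) is $$\big({}_{k}P_{\alpha,\mu,\omega}^{\gamma}f\big)(x)=\int_0^x\frac{(x-t)^{\frac{\mu}{k}-1}}{k}E_{k,\alpha,\mu}^{\gamma}\big[\omega(x-t)^{\frac{\alpha}{k}}\big]f(t)\,dt ,$$ for $f$ integrable on bounded intervals $[0,b]$. The $k$-Prabhakar derivative of order $\mu$, with $m=[\operatorname{Re}(\mu)/k]+1$, is $${}_{k}D_{\alpha,\mu,\omega}^{\gamma}f(t)=\Big(\frac{d}{dt}\Big)^{m}k^{m}\,{}_{k}P_{\alpha,mk-\mu,\omega}^{-\gamma}f(t).$$ For $0\le n\le m-1$, the same formula with $\mu-(n+1)k$ and $m-n-1$ in place of $\mu$ and $m$ is used: ${}_{k}D_{\alpha,\mu-(n+1)k,\omega}^{\gamma}f=k^{m-n-1}\big(\frac{d}{dt}\big)^{m-n-1}{}_{k}P_{\alpha,mk-\mu,\omega}^{-\gamma}f$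 (so for $n=m-1$ it is ${}_{k}P_{\alpha,mk-\mu,\omega}^{-\gamma}f$). A value at $0^+$ is the limit as $t\to0^+$. *)

(* Defs.v *)
From mathcomp Require Import all_boot all_order all_algebra.
From mathcomp Require Import all_classical all_reals all_analysis.

Set Implicit Arguments.
Unset Strict Implicit.
Unset Printing Implicit Defensive.

Import Order.TTheory GRing.Theory Num.Theory.
Import numFieldNormedType.Exports.
From mathcomp Require Import complex.

Local Open Scope classical_set_scope.
Local Open Scope ring_scope.
Local Open Scope complex_scope.

(* [R[i]] carries no canonical topology; [R[i]^o] is the same type with the
   topology of the modulus, and limits of complex values are taken there. *)

Section ComplexPowers.
Context {R : realType}.

Definition cexp (z : R[i]) : R[i] :=
  (expR (Re z))%:C * (cos (Im z) +i* sin (Im z)).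

(* Principal argument, with values in ]-pi, pi] for [z != 0]. *)
Definition carg (z : R[i]) : R :=
  if 0 <= Im z then acos (Re z / Re `|z|) else - acos (Re z / Re `|z|).

Definition clog (z : R[i]) : R[i] := ln (Re `|z|) +i* carg z.

Definition cpow (z w : R[i]) : R[i] :=
  if z == 0 then (w == 0)%:R else cexp (w * clog z).

End ComplexPowers.

Section ComplexCalculus.
Context {R : realType}.
Implicit Types (D : set R) (g : R -> R[i]).

Definition cintegrable D g : Prop :=
  lebesgue_measure.-integrable D (EFin \o (fun t => Re (g t))) /\
  lebesgue_measure.-integrable D (EFin \o (fun t => Im (g t))).

Definition cintegral D g : R[i] :=
  (\int[lebesgue_measure]_(t in D) Re (g t)) +i*
  (\int[lebesgue_measure]_(t in D) Im (g t)).

Definition cderivable g (t : R) : Prop :=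
  derivable (fun s => Re (g s)) t 1 /\ derivable (fun s => Im (g s)) t 1.

Definition cderive g (t : R) : R[i] :=
  derive1 (fun s => Re (g s)) t +i* derive1 (fun s => Im (g s)) t.

Definition cderiven n g : R -> R[i] := iter n cderive g.

Definition has_lim0p g : Prop := cvg ((g t : R[i]^o) @[t --> 0^'+]).

Definition lim0p g : R[i] := lim ((g t : R[i]^o) @[t --> 0^'+]).

Definition laplace_exists g (u : R[i]) : Prop :=
  cintegrable `]0, +oo[ (fun t => cexp (- (u * t%:C)) * g t).

Definition laplace g (u : R[i]) : R[i] :=
  cintegral `]0, +oo[ (fun t => cexp (- (u * t%:C)) * g t).

End ComplexCalculus.

Section KPrabhakar.
Context {R : realType}.
Variable k : R.
Implicit Types (alpha mu nu omega gamma z : R[i]) (f : R -> R[i]).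

Definition kGamma z : R[i] :=
  cintegral `]0, +oo[
    (fun t => (expR (- (t `^ k / k)))%:C * cpow t%:C (z - 1)).

Definition kpoch gamma n : R[i] := \prod_(i < n) (gamma + i%:R * k%:C).

Definition kML alpha mu gamma z : R[i] :=
  limn (series (fun n =>
    kpoch gamma n / kGamma (alpha * n%:R + mu) * (z ^+ n / n`!%:R))
      : nat -> R[i]^o).

Definition kP_integrand alpha mu omega gamma f (x t : R) : R[i] :=
  cpow (x - t)%:C (mu / k%:C - 1) / k%:C *
  kML alpha mu gamma (omega * cpow (x - t)%:C (alpha / k%:C)) * f t.

Definition kP alpha mu omega gamma f (x : R) : R[i] :=
  cintegral `]0, x[ (kP_integrand alpha mu omega gamma f x).

Definition kP_exists alpha mu omega gamma f : Prop :=
  forall x : R, 0 < x ->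
    cintegrable `]0, x[ (kP_integrand alpha mu omega gamma f x).

Definition korder mu : nat := (Num.truncn (Re mu / k)).+1.

(* The defining formula of the derivative with [j] classical derivatives.
   The number [j] is kept separate from [nu] because the formula is also used
   for [nu = mu - (n+1)k] and [j = korder mu - n - 1], where [Re nu] may be
   negative. *)
Definition kDn (j : nat) alpha nu omega gamma f (t : R) : R[i] :=
  (k ^+ j)%:C * cderiven j (kP alpha (j%:R * k%:C - nu) omega (- gamma) f) t.

Definition kD alpha mu omega gamma f : R -> R[i] :=
  kDn (korder mu) alpha mu omega gamma f.

(* [kD alpha mu omega gamma f] exists at every point of ]0, +oo[. *)
Definition kD_exists alpha mu omega gamma f : Prop :=
  let g := kP alpha ((korder mu)%:R * k%:C - mu) omega (- gamma) f in
  kP_exists alpha ((korder mu)%:R * k%:C - mu) omega (- gamma) f /\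
  forall j : nat, (j < korder mu)%N ->
    forall t : R, 0 < t -> cderivable (cderiven j g) t.

End KPrabhakar.

(* Main.v *)
Require Import Defs.
From mathcomp Require Import all_boot all_order all_algebra.
From mathcomp Require Import all_classical all_reals all_analysis.
From mathcomp Require Import measurable_realfun ring lra.

Set Implicit Arguments.
Unset Strict Implicit.
Unset Printing Implicit Defensive.

Import Order.TTheory GRing.Theory Num.Theory.
Import numFieldNormedType.Exports.
From mathcomp Require Import complex.

(** Put [a = alpha / k], [b = m - mu / k] with [m] the order of the derivative, and
    let [g] be the integral whose derivatives occur in the formula: the values at
    [0+] belong to the derivatives of [g] of order less than [m], and the
    derivative of [f] is [k ^ m] times the one of order [m].

    The transform of a derivative [h'] is [w * L[h] - h(0+)]: write
    [h = h(0+) + 1 * h'] with a convolution product and use that the transform is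
    multiplicative ([laplace_convolution], [laplace_derivative]).  Only the
    existence of [h'] and the integrability of [exp (- w t) h'] are known, so the
    fundamental theorem of calculus is needed for functions that are merely
    differentiable everywhere ([everywhere_FTC], by approximating the derivative
    from above by lower semicontinuous functions).  Iteration expresses the
    left-hand side through the transform of [g].

    The function [g] is itself a convolution of [f] with a kernel which is a
    series of powers [s ^ (a n + b - 1)] whose coefficients contain the reciprocal
    of a Gamma function.  The transform of a power is a Gamma value times a power
    ([laplace_mono]); the Gamma factors cancel, and summing the remaining
    binomial series ([csum_binomial]) gives the factor
    [(1 - omega k (k u) ^ (- a)) ^ (gamma / k)].  To integrate term by term one
    needs a lower bound for the Gamma function on complex arguments
    ([inv_kGamma_le]); it shows that the kernel is of exponential growth
    ([ml_terms_le]).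

    This computation is valid only where the transform of the kernel converges,
    that is for large [Re u], whereas the condition on [u] only ensures that the
    binomial series converges.  The gap is closed by continuation along the ray
    [t * u], [t >= 1].  The transforms of [f] and [g] exist on the whole ray, and
    for [t > 1] both sides of [L[g] = symbol * L[f]] have power expansions in [t]
    whose radii stay away from zero, so that equality for large [t] implies
    equality for all [t > 1] ([expands_ray_eq0]).  Dominated convergence yields
    [t = 1] ([laplace_symbol]). *)

Local Open Scope classical_set_scope.
Local Open Scope ring_scope.
Local Open Scope complex_scope.

(** * Modulus, exponential and principal powers *)

Section ComplexBasics.
Context {R : realType}.
Implicit Types (z w : R[i]) (s x y : R).

Lemma ReD z w : Re (z + w) = Re z + Re w. Proof. by case: z w => [? ?] [? ?]. Qed.
Lemma ImD z w : Im (z + w) = Im z + Im w. Proof. by case: z w => [? ?] [? ?]. Qed.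
Lemma ReN z : Re (- z) = - Re z. Proof. by case: z. Qed.
Lemma ImN z : Im (- z) = - Im z. Proof. by case: z. Qed.
Lemma ReB z w : Re (z - w) = Re z - Re w. Proof. by rewrite ReD ReN. Qed.
Lemma ImB z w : Im (z - w) = Im z - Im w. Proof. by rewrite ImD ImN. Qed.
Lemma ReM z w : Re (z * w) = Re z * Re w - Im z * Im w.
Proof. by case: z w => [? ?] [? ?]. Qed.
Lemma ImM z w : Im (z * w) = Re z * Im w + Im z * Re w.
Proof. by case: z w => [? ?] [? ?]. Qed.
Lemma ReC x : Re x%:C = x. Proof. by []. Qed.
Lemma ImC x : Im x%:C = 0. Proof. by []. Qed.

Lemma ReI x y : Re (x +i* y) = x. Proof. by []. Qed.
Lemma ImI x y : Im (x +i* y) = y. Proof. by []. Qed.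

Lemma ReMC x z : Re (x%:C * z) = x * Re z.
Proof. by rewrite ReM ReC ImC mul0r subr0. Qed.
Lemma ImMC x z : Im (x%:C * z) = x * Im z.
Proof. by rewrite ImM ReC ImC mul0r addr0. Qed.

Lemma cplxP z w : Re z = Re w -> Im z = Im w -> z = w.
Proof. by case: z w => [? ?] [? ?] /= -> ->. Qed.

Lemma natC n : (n%:R : R[i]) = (n%:R : R)%:C.
Proof. by rewrite rmorph_nat. Qed.

Lemma Re_nat n : Re (n%:R : R[i]) = n%:R. Proof. by rewrite natC. Qed.
Lemma Re_sum I (r : seq I) (P : pred I) (F : I -> R[i]) :
  Re (\sum_(i <- r | P i) F i) = \sum_(i <- r | P i) Re (F i).
Proof. by apply: (big_morph _ ReD). Qed.
Lemma Im_sum I (r : seq I) (P : pred I) (F : I -> R[i]) :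
  Im (\sum_(i <- r | P i) F i) = \sum_(i <- r | P i) Im (F i).
Proof. by apply: (big_morph _ ImD). Qed.

(** The norm of [R[i]] takes values in [R[i]]; this is the modulus in [R]. *)
Definition cabs z : R := Re `|z|.

Lemma normE z : `|z| = (cabs z)%:C.
Proof. by rewrite /cabs normc_def. Qed.

Lemma cabsE z : cabs z = Num.sqrt (Re z ^+ 2 + Im z ^+ 2).
Proof. by rewrite /cabs normc_def. Qed.

Lemma cabs_ge0 z : 0 <= cabs z. Proof. by rewrite cabsE sqrtr_ge0. Qed.

Lemma cabs_sq z : cabs z ^+ 2 = Re z ^+ 2 + Im z ^+ 2.
Proof. by rewrite cabsE sqr_sqrtr // addr_ge0 ?sqr_ge0. Qed.

Lemma cabsM z w : cabs (z * w) = cabs z * cabs w.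
Proof. by apply: (@complexI R); rewrite rmorphM /= -!normE normrM. Qed.

Lemma cabsD z w : cabs (z + w) <= cabs z + cabs w.
Proof. by rewrite -lecR rmorphD /= -!normE ler_normD. Qed.

Lemma cabsN z : cabs (- z) = cabs z.
Proof. by rewrite /cabs normrN. Qed.

Lemma cabsB z w : cabs (z - w) <= cabs z + cabs w.
Proof. by rewrite -(cabsN w) cabsD. Qed.

Lemma cabsC x : cabs x%:C = `|x|.
Proof. by rewrite cabsE /= expr0n addr0 sqrtr_sqr. Qed.

Lemma cabs0 : cabs 0 = 0. Proof. by rewrite (cabsC 0) normr0. Qed.
Lemma cabs1 : cabs 1 = 1. Proof. by rewrite (cabsC 1) normr1. Qed.

Lemma cabs_nat n : cabs n%:R = n%:R.
Proof. by rewrite natC cabsC ger0_norm. Qed.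

Lemma cabs_eq0 z : (cabs z == 0) = (z == 0).
Proof. by rewrite -(inj_eq (@complexI R)) -normE normr_eq0. Qed.

Lemma cabs_gt0 z : (0 < cabs z) = (z != 0).
Proof. by rewrite lt0r cabs_eq0 cabs_ge0 andbT. Qed.

Lemma cabsX z n : cabs (z ^+ n) = cabs z ^+ n.
Proof. by elim: n => [|n ih]; rewrite ?expr0 ?cabs1 // !exprS cabsM ih. Qed.

Lemma cabsV z : cabs z^-1 = (cabs z)^-1.
Proof. by apply: (@complexI R); rewrite fmorphV /= -!normE normfV. Qed.

Lemma cabs_Re z : `|Re z| <= cabs z.
Proof.
rewrite -(@ler_pXn2r _ 2) ?nnegrE ?cabs_ge0 // real_normK ?num_real //.
by rewrite cabs_sq lerDl sqr_ge0.
Qed.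

Lemma cabs_Im z : `|Im z| <= cabs z.
Proof.
rewrite -(@ler_pXn2r _ 2) ?nnegrE ?cabs_ge0 // real_normK ?num_real //.
by rewrite cabs_sq lerDr sqr_ge0.
Qed.

Lemma cabs_le z : cabs z <= `|Re z| + `|Im z|.
Proof.
rewrite -(@ler_pXn2r _ 2) ?nnegrE ?cabs_ge0 ?addr_ge0 // cabs_sq.
rewrite sqrrD !real_normK ?num_real // -addrA lerD2l lerDr mulrn_wge0 // mulr_ge0.
Qed.

Lemma cabs_sum I (r : seq I) (P : pred I) (F : I -> R[i]) :
  cabs (\sum_(i <- r | P i) F i) <= \sum_(i <- r | P i) cabs (F i).
Proof.
elim/big_ind2 : _ => [|z1 x1 z2 x2 h1 h2|i _ //]; first by rewrite cabs0.
by rewrite (le_trans (cabsD _ _)) // lerD.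
Qed.

Lemma Re_gt0_neq0 z : 0 < Re z -> z != 0.
Proof. by apply: contraTN => /eqP ->; rewrite ltxx. Qed.

Lemma cexpD z w : cexp (z + w) = cexp z * cexp w.
Proof.
rewrite /cexp ReD ImD expRD cosD sinD.
by apply: cplxP; rewrite !(ReM, ImM, ReC, ImC, ReI, ImI); ring.
Qed.

Lemma cexp0 : cexp (0 : R[i]) = 1.
Proof. by rewrite /cexp /= expR0 cos0 sin0 mul1r. Qed.

Lemma cexp_neq0 z : cexp z != 0.
Proof.
apply/eqP => h; have := cexpD z (- z); rewrite subrr cexp0 h mul0r => /eqP.
by rewrite oner_eq0.
Qed.

Lemma cexpN z : cexp (- z) = (cexp z)^-1.
Proof.
apply: (mulfI (cexp_neq0 z)); rewrite -cexpD subrr cexp0 mulfV //.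
exact: cexp_neq0.
Qed.

Lemma Re_cexp z : Re (cexp z) = expR (Re z) * cos (Im z).
Proof. by rewrite /cexp ReMC. Qed.
Lemma Im_cexp z : Im (cexp z) = expR (Re z) * sin (Im z).
Proof. by rewrite /cexp ImMC. Qed.

Lemma cexpC x : cexp x%:C = (expR x)%:C.
Proof. by rewrite /cexp /= cos0 sin0 mulr1. Qed.

Lemma cabs_cexp z : cabs (cexp z) = expR (Re z).
Proof.
rewrite /cexp cabsM cabsC ger0_norm ?expR_ge0 // cabsE /=.
by rewrite cos2Dsin2 sqrtr1 mulr1.
Qed.

Lemma cexpX z n : cexp z ^+ n = cexp (n%:R * z).
Proof.
elim: n => [|n ih]; first by rewrite mul0r cexp0.
by rewrite exprS ih -cexpD -natr1 mulrDl mul1r addrC.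
Qed.

Lemma ReI_cabs z : `|Re z / cabs z| <= 1.
Proof.
have [->|z0] := eqVneq z 0; first by rewrite mul0r normr0.
rewrite normrM normfV (ger0_norm (cabs_ge0 _)) ler_pdivrMr ?cabs_gt0 //.
by rewrite mul1r cabs_Re.
Qed.

Lemma cexp_clog z : z != 0 -> cexp (clog z) = z.
Proof.
move=> z0; have a0 : 0 < cabs z by rewrite cabs_gt0.
have := ReI_cabs z; rewrite ler_norml => h.
have cE : cos (carg z) = Re z / cabs z.
  rewrite /carg; case: ifP => _; rewrite ?cosN acosK //; exact: itv_dec.
have hs : Num.sqrt (1 - (Re z / cabs z) ^+ 2) = `|Im z| / cabs z.
  rewrite -[RHS]ger0_norm ?divr_ge0 ?cabs_ge0 // -sqrtr_sqr; congr Num.sqrt.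
  rewrite !exprMn exprVn real_normK ?num_real // cabs_sq; field.
  by rewrite -cabs_sq expf_neq0 // gt_eqF.
have sE : sin (carg z) = Im z / cabs z.
  rewrite /carg; case: (lerP 0 (Im z)) => i0.
    by rewrite sin_acos // hs ger0_norm.
  by rewrite sinN sin_acos // hs ltr0_norm // mulNr opprK.
rewrite /clog; apply: cplxP; rewrite ?Re_cexp ?Im_cexp /= -/(cabs z) lnK ?posrE //.
  by rewrite cE mulrC divfK ?gt_eqF.
by rewrite sE mulrC divfK ?gt_eqF.
Qed.

Lemma clogM s z : 0 < s -> z != 0 -> clog (s%:C * z) = (ln s)%:C + clog z.
Proof.
move=> s0 z0; rewrite /clog -!/(cabs _) cabsM cabsC gtr0_norm //.
apply: cplxP => /=; first by rewrite lnM // posrE // cabs_gt0.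
rewrite add0r /carg -!/(cabs _) cabsM cabsC gtr0_norm // ReMC ImMC pmulr_rge0 //.
by rewrite -mulf_div divff ?gt_eqF // mul1r.
Qed.

Lemma clog1 : clog (1 : R[i]) = 0.
Proof.
rewrite /clog /carg -!/(cabs 1) cabs1 ln1 (ImC 1) lexx (ReC 1) divr1 acos1.
by apply: cplxP.
Qed.

Lemma clogC s : 0 < s -> clog s%:C = (ln s)%:C.
Proof. by move=> s0; rewrite -[s%:C]mulr1 clogM ?oner_neq0 // clog1 addr0. Qed.

Lemma cpowE w z : w != 0 -> cpow w z = cexp (z * clog w).
Proof. by move=> w0; rewrite /cpow (negbTE w0). Qed.

Lemma real_neq0 s : 0 < s -> s%:C != 0 :> R[i].
Proof. by move=> s0; rewrite fmorph_eq0 gt_eqF. Qed.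
#[local] Hint Resolve real_neq0 : core.

Lemma cpowC s z : 0 < s -> cpow s%:C z = cexp (z * (ln s)%:C).
Proof. by move=> s0; rewrite cpowE ?clogC ?real_neq0. Qed.

Lemma cpowD w z1 z2 : w != 0 -> cpow w (z1 + z2) = cpow w z1 * cpow w z2.
Proof. by move=> w0; rewrite !cpowE // mulrDl cexpD. Qed.

Lemma cpowN w z : w != 0 -> cpow w (- z) = (cpow w z)^-1.
Proof. by move=> w0; rewrite !cpowE // mulNr cexpN. Qed.

Lemma cpow_neq0 w z : w != 0 -> cpow w z != 0.
Proof. by move=> w0; rewrite cpowE // cexp_neq0. Qed.

Lemma cpowX w z n : w != 0 -> cpow w z ^+ n = cpow w (n%:R * z).
Proof. by move=> w0; rewrite !cpowE // cexpX mulrA. Qed.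

Lemma cpow0 w : w != 0 -> cpow w 0 = 1.
Proof. by move=> w0; rewrite cpowE // mul0r cexp0. Qed.

Lemma cpow1 w : w != 0 -> cpow w 1 = w.
Proof. by move=> w0; rewrite cpowE // mul1r cexp_clog. Qed.

Lemma cpow_nat w n : w != 0 -> cpow w n%:R = w ^+ n.
Proof. by move=> w0; rewrite -[n%:R]mulr1 -cpowX // cpow1. Qed.

Lemma cpow1b z : cpow 1 z = 1.
Proof. by rewrite cpowE ?oner_neq0 // clog1 mulr0 cexp0. Qed.

Lemma cpowM s w z : 0 < s -> w != 0 ->
  cpow (s%:C * w) z = cpow s%:C z * cpow w z.
Proof.
move=> s0 w0; rewrite !cpowE ?mulf_neq0 ?real_neq0 // clogM // clogC //.
by rewrite mulrDr cexpD.
Qed.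

Lemma cabs_cpow s z : 0 < s -> cabs (cpow s%:C z) = s `^ Re z.
Proof.
move=> s0; rewrite cpowC // cabs_cexp ReM ReC ImC mulr0 subr0.
by rewrite /powR gt_eqF.
Qed.

End ComplexBasics.
#[global] Hint Resolve real_neq0 : core.

(** * Complex-valued functions of a real variable: derivatives *)

Section ComplexDerivative.
Context {R : realType}.
Implicit Types (f g : R -> R[i]) (t : R) (l z : R[i]).

Definition cder f t l := is_derive t 1 (fun s => Re (f s)) (Re l) /\
  is_derive t 1 (fun s => Im (f s)) (Im l).

Lemma cder_eq f t l l' : cder f t l -> l = l' -> cder f t l'.
Proof. by move=> + <-. Qed.

Lemma cder_cst z t : cder (fun=> z) t 0.
Proof. by split; apply: is_derive_cst. Qed.

Lemma cderD f g t l l' : cder f t l -> cder g t l' ->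
  cder (fun s => f s + g s) t (l + l').
Proof.
move=> [rf if_] [rg ig]; split.
  under eq_fun do rewrite ReD.
  by rewrite ReD; exact: (is_deriveD rf rg).
under eq_fun do rewrite ImD.
by rewrite ImD; exact: (is_deriveD if_ ig).
Qed.

Lemma cderN f t l : cder f t l -> cder (fun s => - f s) t (- l).
Proof.
move=> [rf if_]; split.
  under eq_fun do rewrite ReN.
  by rewrite ReN; exact: (is_deriveN rf).
under eq_fun do rewrite ImN.
by rewrite ImN; exact: (is_deriveN if_).
Qed.

Lemma cderM f g t l l' : cder f t l -> cder g t l' ->
  cder (fun s => f s * g s) t (l * g t + f t * l').
Proof.
move=> [rf if_] [rg ig]; split.
  under eq_fun do rewrite ReM.
  have h := is_deriveB (is_deriveM rf rg) (is_deriveM if_ ig).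
  apply: (is_derive_eq h).
  rewrite /GRing.scale /=.
  by rewrite !(ReD, ReM); ring.
under eq_fun do rewrite ImM.
have h := is_deriveD (is_deriveM rf ig) (is_deriveM if_ rg).
  apply: (is_derive_eq h).
rewrite /GRing.scale /=.
by rewrite !(ImD, ImM); ring.
Qed.

Lemma cderZ z g t l : cder g t l -> cder (fun s => z * g s) t (z * l).
Proof.
by move=> dg; apply: cder_eq (cderM (cder_cst z t) dg) _; rewrite mul0r add0r.
Qed.

Lemma cder_real (h : R -> R) t (a : R) : is_derive t 1 h a ->
  cder (fun s => (h s)%:C) t a%:C.
Proof. by move=> dh; split=> //=; apply: is_derive_cst. Qed.

Lemma cder_id t : cder (fun s => s%:C) t 1.
Proof. exact: (cder_real (is_derive_id _ _)). Qed.

Lemma cder_cexp f t l : cder f t l ->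
  cder (fun s => cexp (f s)) t (l * cexp (f t)).
Proof.
move=> [rf if_].
have e := is_derive1_comp (is_derive_expR (Re (f t))) rf.
have c := is_derive1_comp (is_derive_cos (Im (f t))) if_.
have s := is_derive1_comp (is_derive_sin (Im (f t))) if_.
split.
  under eq_fun do rewrite Re_cexp.
  have h := is_deriveM e c.
  apply: (is_derive_eq h).
  rewrite /GRing.scale /=.
  by rewrite ReM Re_cexp Im_cexp; ring.
under eq_fun do rewrite Im_cexp.
have h := is_deriveM e s.
  apply: (is_derive_eq h).
rewrite /GRing.scale /=.
by rewrite ImM Re_cexp Im_cexp; ring.
Qed.

Lemma carg_atan z : 0 < Re z -> carg z = atan (Im z / Re z).
Proof.
move=> x0; have z0 : z != 0 by apply: Re_gt0_neq0.
have cE : Re z / cabs z = cos (atan (Im z / Re z)).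
  rewrite cos_atan.
  have -> : 1 + (Im z / Re z) ^+ 2 = (cabs z / Re z) ^+ 2.
    by rewrite !exprMn cabs_sq exprVn; field; rewrite gt_eqF.
  by rewrite sqrtr_sqr ger0_norm ?divr_ge0 ?cabs_ge0 ?ltW // invf_div.
rewrite /carg -/(cabs z) cE.
have := atan_ltpi2 (Im z / Re z); have := atan_gtNpi2 (Im z / Re z).
have hp : pi / 2 < pi :> R by have := pi_gt0 R; lra.
have := pi_gt0 R; have := @le_atan R => mono.
case: ifPn => i0 p0 h1 h2.
  have h3 : 0 <= atan (Im z / Re z).
    by rewrite -(@atan0 R); apply: mono; rewrite divr_ge0 // ltW.
  by rewrite cosK // in_itv /= h3 /= ltW // (lt_trans h2).
rewrite -ltNge in i0.
have h3 : atan (Im z / Re z) <= 0.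
  by rewrite -(@atan0 R); apply: mono; rewrite ler_pdivrMr // mul0r ltW.
by rewrite cosKN ?opprK // h3 andbT ltW // (lt_trans _ h1) // ltrN2.
Qed.

(** The right half-plane is a domain of the principal logarithm, where the
    argument is an arctangent and hence differentiable. *)
Lemma cder_clog f t l : 0 < Re (f t) -> cder f t l ->
  cder (fun s => clog (f s)) t (l / f t).
Proof.
move=> x0 [rf if_].
have near_pos : \forall s \near t, 0 < Re (f s).
  have : {for t, continuous (fun s => Re (f s))}.
    by apply: differentiable_continuous; apply/derivable1_diffP; case: rf.
  by move=> /cvgr_gt /(_ _ x0).
have q0 : 0 < Re (f t) ^+ 2 + Im (f t) ^+ 2.
  by rewrite ltr_wpDr ?sqr_ge0 // exprn_gt0.
have Vre : (f t)^-1 = ((Re (f t) ^+ 2 + Im (f t) ^+ 2)^-1)%:C * (Re (f t) +i* - Im (f t)).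
  apply: (mulfI (Re_gt0_neq0 x0)); rewrite mulfV ?Re_gt0_neq0 //.
  by apply: cplxP; rewrite !(ReM,ImM,ReC,ImC,ReI,ImI); field; rewrite gt_eqF.
split.
  have h : is_derive t 1 (fun s => 2^-1 * ln (Re (f s) ^+ 2 + Im (f s) ^+ 2))
      (Re (l / f t)).
    have h := @is_derive1_comp _ (@ln R) (fun s => Re (f s) ^+ 2 + Im (f s) ^+ 2)
      t _ _ (is_derive1_ln q0)
      (is_deriveD (is_deriveX 2 rf) (is_deriveX 2 if_)).
    apply: (is_derive_eq (is_deriveZ 2^-1 h)).
    rewrite /GRing.scale /= Vre !(ReM,ImM,ReC,ImC,ReI,ImI); field.
    by rewrite gt_eqF.
  apply: near_eq_is_derive h.
  near=> s; have xs : 0 < Re (f s) by near: s.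
  rewrite -cabs_sq lnXn ?cabs_gt0 ?Re_gt0_neq0 //.
  by rewrite -(mulr_natl (ln _)) mulrA mulVf ?mul1r // pnatr_eq0.
have h : is_derive t 1 (fun s => atan (Im (f s) / Re (f s))) (Im (l / f t)).
  have h := @is_derive1_comp _ (@atan R) (fun s => Im (f s) / Re (f s)) t _ _
    (is_derive1_atan (Im (f t) / Re (f t)))
    (is_deriveM if_ (is_deriveV (lt0r_neq0 x0) rf)).
  apply: (is_derive_eq h).
  rewrite /GRing.scale /= Vre !(ReM,ImM,ReC,ImC,ReI,ImI); field.
  by rewrite !gt_eqF.
apply: near_eq_is_derive h.
near=> s; have xs : 0 < Re (f s) by near: s.
by rewrite -carg_atan.
Unshelve. all: by end_near. Qed.

Lemma cder_cpow f t l z : 0 < Re (f t) -> cder f t l ->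
  cder (fun s => cpow (f s) z) t (z * (l / f t) * cpow (f t) z).
Proof.
move=> x0 df; have := cder_cexp (cderZ z (cder_clog x0 df)).
have near_pos : \forall s \near t, 0 < Re (f s).
  have : {for t, continuous (fun s => Re (f s))}.
    by apply: differentiable_continuous; apply/derivable1_diffP; case: df => [[]].
  by move=> /cvgr_gt /(_ _ x0).
rewrite -cpowE ?Re_gt0_neq0 // => -[h1 h2].
by split; [apply: near_eq_is_derive h1|apply: near_eq_is_derive h2];
  near=> s; rewrite cpowE // Re_gt0_neq0 //; near: s.
Unshelve. all: by end_near. Qed.

Lemma cder_continuous f t l : cder f t l ->
  {for t, continuous (fun s => Re (f s))} /\ {for t, continuous (fun s => Im (f s))}.
Proof.
by move=> [[h1 _] [h2 _]]; split;
  apply: differentiable_continuous; apply/derivable1_diffP.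
Qed.

Lemma cder0_eq f (a b : R) : a <= b ->
  (forall t, a <= t <= b -> cder f t 0) -> f a = f b.
Proof.
move=> ab df.
have aux (h : R -> R) : (forall t, a <= t <= b -> is_derive t 1 h 0) -> h a = h b.
  move=> dh; apply/eqP; rewrite eq_sym -subr_eq0.
  have [] := @MVT_segment _ h (fun=> 0) a b ab.
  - by move=> x; rewrite in_itv /= => /andP[ax xb]; apply: dh; rewrite !ltW.
  - by apply: derivable_within_continuous => x; rewrite in_itv => /dh [].
  - by move=> c _ ->; rewrite mul0r.
by apply: cplxP; [apply: (aux (fun s => Re (f s)))|apply: (aux (fun s => Im (f s)))] => t /df [].
Qed.

End ComplexDerivative.

(** * Complex series, the exponential and the binomial series *)

Section ComplexSeries.
Context {R : realType}.
Implicit Types (a : nat -> R[i]) (u v : nat -> R[i]) (z l c : R[i]).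

(** Convergence is handled in components, so that the limit theorems of [R]
    apply directly. *)
Definition ccvg u l := ((fun n => Re (u n)) @ \oo --> Re l) /\
  ((fun n => Im (u n)) @ \oo --> Im l).

Lemma ccvg_unique u l l' : ccvg u l -> ccvg u l' -> l = l'.
Proof.
by move=> [r1 i1] [r2 i2]; apply: cplxP;
  [apply: cvg_unique r1 r2|apply: cvg_unique i1 i2].
Qed.

Lemma ccvg_eq u v l : u =1 v -> ccvg u l -> ccvg v l.
Proof. by move=> /funext ->. Qed.

Lemma ccvg_cst l : ccvg (fun=> l) l.
Proof. by split; apply: cvg_cst. Qed.

Lemma ccvgD u v l l' : ccvg u l -> ccvg v l' -> ccvg (fun n => u n + v n) (l + l').
Proof.
move=> [r1 i1] [r2 i2]; split.
  by under eq_fun do rewrite ReD; rewrite ReD; exact: cvgD.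
by under eq_fun do rewrite ImD; rewrite ImD; exact: cvgD.
Qed.

Lemma ccvgM u v l l' : ccvg u l -> ccvg v l' -> ccvg (fun n => u n * v n) (l * l').
Proof.
move=> [r1 i1] [r2 i2]; split.
  by under eq_fun do rewrite ReM; rewrite ReM; apply: cvgB; exact: cvgM.
by under eq_fun do rewrite ImM; rewrite ImM; apply: cvgD; exact: cvgM.
Qed.

Lemma ccvgZ z u l : ccvg u l -> ccvg (fun n => z * u n) (z * l).
Proof. by move=> ul; apply: ccvgM => //; exact: ccvg_cst. Qed.

Lemma ccvgN u l : ccvg u l -> ccvg (fun n => - u n) (- l).
Proof.
move=> ul; rewrite -mulN1r; apply: ccvg_eq (ccvgZ (-1) ul) => n.
by rewrite mulN1r.
Qed.

Lemma ccvgB u v l l' : ccvg u l -> ccvg v l' -> ccvg (fun n => u n - v n) (l - l').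
Proof. by move=> ul vl'; apply: ccvgD => //; exact: ccvgN. Qed.

Lemma ccvgS u l : ccvg (fun n => u n.+1) l <-> ccvg u l.
Proof.
have shift (h : nat -> R) (k : R) :
    ((fun n => h n.+1) @ \oo --> k) <-> (h @ \oo --> k).
  by rewrite -(cvg_shiftS h).
by split=> -[/(shift (fun n => Re (u n))) ? /(shift (fun n => Im (u n))) ?].
Qed.

Lemma ccvg_cabs u l : ccvg u l -> (fun n => cabs (u n)) @ \oo --> cabs l.
Proof.
move=> [r1 i1]; under eq_fun do rewrite cabsE; rewrite cabsE.
apply: (@cvg_comp _ _ _ _ Num.sqrt _ (nbhs (Re l ^+ 2 + Im l ^+ 2))).
  by apply: cvgD; apply: cvgM.
exact: sqrt_continuous.
Qed.

Lemma ccvg_le u l (e : R) : ccvg u l -> (\forall n \near \oo, cabs (u n) <= e) ->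
  cabs l <= e.
Proof. by move=> /ccvg_cabs h ?; apply: cvgr_to_le h _. Qed.

Lemma ccvg_squeeze u l (e : nat -> R) : (forall n, cabs (u n - l) <= e n) ->
  e @ \oo --> 0 -> ccvg u l.
Proof.
move=> ue e0; have aux (h : nat -> R) (k : R) : (forall n, `|h n - k| <= e n) ->
    h @ \oo --> k.
  move=> hk; apply/cvgrPdist_le => d d0.
  move/cvgrPdist_le : e0 => /(_ d d0); apply: filterS => n.
  rewrite sub0r normrN distrC => /(le_trans (ler_norm _)).
  exact: le_trans.
by split; apply: aux => n; rewrite -?ReB -?ImB; apply: le_trans (ue n);
  [exact: cabs_Re|exact: cabs_Im].
Qed.

(** Componentwise limits are the limits for the modulus in which [kML] is
    defined. *)
Lemma ccvg_lim u l : ccvg u l -> limn (u : nat -> R[i]^o) = l.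
Proof.
move=> [ur ui]; apply/(@cvg_lim _ (@norm_hausdorff _ R[i]^o)).
apply/(@cvgrPdist_lt _ R[i]^o) => /= e; rewrite ltcE => /andP[/eqP e0 ep].
have e2 : 0 < Re e / 2 by rewrite divr_gt0.
move/cvgrPdist_lt : ur => /(_ _ e2) ur; move/cvgrPdist_lt : ui => /(_ _ e2) ui.
near=> n; rewrite normE ltcE e0 eqxx /=.
apply: le_lt_trans (cabs_le _) _; rewrite ReB ImB [ltRHS]splitr ltrD //.
  by near: n.
by near: n.
Unshelve. all: by end_near. Qed.

Definition csum a l := ccvg (fun n => \sum_(i < n) a i) l.

Lemma csum_unique a l l' : csum a l -> csum a l' -> l = l'.
Proof. exact: ccvg_unique. Qed.

Lemma eq_csum a a' l : a =1 a' -> csum a l -> csum a' l.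
Proof. by move=> /funext ->. Qed.

Lemma csumD a b l l' : csum a l -> csum b l' -> csum (fun n => a n + b n) (l + l').
Proof.
by move=> al bl; apply: ccvg_eq (ccvgD al bl) => n; rewrite big_split.
Qed.

Lemma csumZ z a l : csum a l -> csum (fun n => z * a n) (z * l).
Proof. by move=> al; apply: ccvg_eq (ccvgZ z al) => n; rewrite mulr_sumr. Qed.

Lemma csum_recl a l : csum (fun n => a n.+1) l -> csum a (a 0%N + l).
Proof.
move=> al; apply/ccvgS; apply: ccvg_eq (ccvgD (ccvg_cst (a 0%N)) al) => n.
by rewrite big_ord_recl.
Qed.

Lemma csum_Re a l : csum a l -> (fun n => \sum_(i < n) Re (a i)) @ \oo --> Re l.
Proof. by move=> [h _]; under eq_fun do rewrite -Re_sum. Qed.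

Lemma csum_Im a l : csum a l -> (fun n => \sum_(i < n) Im (a i)) @ \oo --> Im l.
Proof. by move=> [_ h]; under eq_fun do rewrite -Im_sum. Qed.

Lemma real_abs_cvg (x : nat -> R) (M : R) :
  (forall n, \sum_(i < n) `|x i| <= M) -> cvgn (series x).
Proof.
move=> xM; apply: normed_cvg; apply: nondecreasing_is_cvgn.
  by apply: nondecreasing_series => n _ _; exact: normr_ge0.
exists M => _ [n _ <-]; apply: le_trans (xM n).
by rewrite -(big_mkord predT (fun i => `|x i|)).
Qed.

Lemma abs_csum a (M : R) : (forall n, \sum_(i < n) cabs (a i) <= M) ->
  exists l, csum a l.
Proof.
move=> aM.
have /cvg_ex[/= x hx] : cvgn (series (fun n => Re (a n))).
  apply: (@real_abs_cvg _ M) => n; apply: le_trans (aM n).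
  by apply: ler_sum => i _; exact: cabs_Re.
have /cvg_ex[/= y hy] : cvgn (series (fun n => Im (a n))).
  apply: (@real_abs_cvg _ M) => n; apply: le_trans (aM n).
  by apply: ler_sum => i _; exact: cabs_Im.
exists (x +i* y); split.
  under eq_fun do rewrite Re_sum; move: hx; rewrite /series /=.
  by under [X in X @ _ --> _ -> _]eq_fun do rewrite big_mkord.
under eq_fun do rewrite Im_sum; move: hy; rewrite /series /=.
by under [X in X @ _ --> _ -> _]eq_fun do rewrite big_mkord.
Qed.

Lemma csum_tail a l n (T : R) : csum a l ->
  (forall m, \sum_(n <= i < m) cabs (a i) <= T) ->
  cabs (l - \sum_(i < n) a i) <= T.
Proof.
move=> al aT; apply: (ccvg_le (ccvgB al (ccvg_cst _))).
near=> m; have nm : (n <= m)%N by near: m; exact: nbhs_infty_ge.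
rewrite -!(big_mkord predT a) (big_cat_nat _ nm) //= addrAC subrr add0r.
by apply: le_trans (cabs_sum _ _ _) (aT m).
Unshelve. all: by end_near. Qed.

Lemma csum_abs_le a l (T : R) : csum a l ->
  (forall m, \sum_(i < m) cabs (a i) <= T) -> cabs l <= T.
Proof.
move=> al aT; have := @csum_tail a l 0 T al.
rewrite big_ord0 subr0; apply => m; by rewrite big_mkord.
Qed.

End ComplexSeries.

Section PowerSeries.
Context {R : realType}.
Implicit Types (a : nat -> R[i]) (z c : R[i]) (r rho q t : R).

Lemma geom_sum_le q n : 0 <= q -> q < 1 -> \sum_(i < n) q ^+ i <= (1 - q)^-1.
Proof.
move=> q0 q1; have p : 0 < 1 - q by rewrite subr_gt0.
rewrite -[leRHS]mul1r ler_pdivlMr // mulrC.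
rewrite -[1 - q]opprB mulNr -subrX1 opprB lerBlDr lerDl exprn_ge0 //.
Qed.

Lemma linear_geom_le q n : 0 <= q -> q < 1 -> n.+1%:R * q ^+ n <= (1 - q)^-1.
Proof.
move=> q0 q1; apply: le_trans (geom_sum_le n.+1 q0 q1).
rewrite mulr_natl -[X in _ *+ X](card_ord n.+1) -sumr_const.
apply: ler_sum => i _; apply: ler_wiXn2l => //; first exact: ltW.
by rewrite -ltnS.
Qed.

(** This form of the convergence hypothesis passes to the derived series at
    every smaller radius and implies absolute convergence there. *)
Definition bnd a rho := exists M : R, forall n, cabs (a n) * rho ^+ n <= M.

Definition pdiffs a n : R[i] := n.+1%:R * a n.+1.

Lemma bnd_pdiffs a r rho : 0 < r -> r < rho -> bnd a rho -> bnd (pdiffs a) r.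
Proof.
move=> r0 rr [M aM]; have p0 : 0 < rho by exact: lt_trans rr.
have q1 : r / rho < 1 by rewrite ltr_pdivrMr // mul1r.
have q0 : 0 <= r / rho by rewrite divr_ge0 // ltW.
exists ((1 - r / rho)^-1 * (M / rho)) => n.
rewrite /pdiffs cabsM cabs_nat.
have -> : n.+1%:R * cabs (a n.+1) * r ^+ n =
    (n.+1%:R * (r / rho) ^+ n) * (cabs (a n.+1) * rho ^+ n.+1 / rho).
  rewrite exprMn exprVn exprS; field.
  by rewrite expf_neq0 gt_eqF.
apply: ler_pM => //; first by rewrite mulr_ge0 // exprn_ge0.
- by rewrite divr_ge0 ?mulr_ge0 ?cabs_ge0 ?exprn_ge0 // ltW.
- exact: linear_geom_le.
- by rewrite ler_pM2r ?invr_gt0.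
Qed.

Lemma bnd_sum a r rho : 0 <= r -> r < rho -> bnd a rho ->
  exists M : R, forall n, \sum_(i < n) cabs (a i) * r ^+ i <= M.
Proof.
move=> r0 rr [M aM]; have p0 : 0 < rho by exact: le_lt_trans rr.
have q1 : r / rho < 1 by rewrite ltr_pdivrMr // mul1r.
have q0 : 0 <= r / rho by rewrite divr_ge0 // ltW.
have M0 : 0 <= M by apply: le_trans (aM 0%N); rewrite mulr1 cabs_ge0.
exists (M * (1 - r / rho)^-1) => n.
apply: le_trans (ler_wpM2l M0 (geom_sum_le n q0 q1)).
rewrite mulr_sumr; apply: ler_sum => i _.
have -> : cabs (a i) * r ^+ i = cabs (a i) * rho ^+ i * (r / rho) ^+ i.
  by rewrite exprMn exprVn; field; rewrite expf_neq0 // gt_eqF.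
by rewrite ler_wpM2r // exprn_ge0.
Qed.

Lemma bnd_csum a t rho : `|t| < rho -> bnd a rho ->
  exists l, csum (fun n => a n * t%:C ^+ n) l.
Proof.
move=> tr ab; have [M aM] := bnd_sum (normr_ge0 t) tr ab.
apply: (@abs_csum _ _ M) => n; apply: le_trans (aM n).
by apply: ler_sum => i _; rewrite cabsM cabsX cabsC.
Qed.

(** The two components are real power series, which may be differentiated term
    by term. *)
Definition cps a t : R[i] := limn (pseries (fun n => Re (a n)) t) +i*
  limn (pseries (fun n => Im (a n)) t).

Lemma csum_pseries a t l : csum (fun n => a n * t%:C ^+ n) l ->
  pseries (fun n => Re (a n)) t @ \oo --> Re l /\
  pseries (fun n => Im (a n)) t @ \oo --> Im l.
Proof.
move=> al; have pE n : a n * t%:C ^+ n = (t ^+ n)%:C * a n.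
  by rewrite mulrC rmorphXn.
split.
  have -> : pseries (fun n => Re (a n)) t =
      (fun n => \sum_(i < n) Re (a i * t%:C ^+ i)).
    apply/funext => n; rewrite /pseries /series /= big_mkord.
    by apply: eq_bigr => i _; rewrite pE ReMC mulrC.
  exact: (csum_Re al).
have -> : pseries (fun n => Im (a n)) t =
    (fun n => \sum_(i < n) Im (a i * t%:C ^+ i)).
  apply/funext => n; rewrite /pseries /series /= big_mkord.
  by apply: eq_bigr => i _; rewrite pE ImMC mulrC.
exact: (csum_Im al).
Qed.

Lemma cpsE a t l : csum (fun n => a n * t%:C ^+ n) l -> cps a t = l.
Proof.
by move=> /csum_pseries[h1 h2]; apply: cplxP; rewrite /cps ?ReI ?ImI;
  apply: cvg_lim.
Qed.

Lemma cps_csum a t rho : `|t| < rho -> bnd a rho ->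
  csum (fun n => a n * t%:C ^+ n) (cps a t).
Proof. by move=> tr /(bnd_csum tr)[l al]; rewrite (cpsE al). Qed.

Lemma cps0 a rho : 0 < rho -> bnd a rho -> cps a 0 = a 0%N.
Proof.
move=> r0 ab; apply: cpsE; rewrite -[a 0%N]addr0.
have -> : a 0%N + 0 = a 0%N * 0%:C ^+ 0 + 0 by rewrite expr0 mulr1.
apply: csum_recl; apply: ccvg_eq (ccvg_cst _) => n.
by rewrite big1 // => i _; rewrite exprS mul0r mulr0.
Qed.

Lemma cder_cps a t rho : `|t| < rho -> bnd a rho ->
  cder (cps a) t (cps (pdiffs a) t).
Proof.
move=> tr ab.
pose r1 := (`|t| + rho) / 2; pose r2 := (`|t| + r1) / 2; pose K := (`|t| + r2) / 2.
have t0 := normr_ge0 t.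
have h1 : `|t| < r1 by rewrite /r1; lra.
have h1' : r1 < rho by rewrite /r1; lra.
have h2 : `|t| < r2 by rewrite /r2; lra.
have h2' : r2 < r1 by rewrite /r2; lra.
have h3 : `|t| < K by rewrite /K; lra.
have h3' : K < r2 by rewrite /K; lra.
have K0 : 0 < K by exact: le_lt_trans h3.
have KN : `|K| = K by rewrite gtr0_norm.
have b1 : bnd (pdiffs a) r1 by apply: bnd_pdiffs ab => //; exact: le_lt_trans h1.
have b2 : bnd (pdiffs (pdiffs a)) r2 by apply: bnd_pdiffs b1 => //; exact: le_lt_trans h2.
have [h10 h11] : `|K| < rho /\ `|K| < r1 by rewrite KN; split; lra.
have h12 : `|K| < r2 by rewrite KN.
have [c0 d0] := csum_pseries (cps_csum h10 ab).
have [c1 d1] := csum_pseries (cps_csum h11 b1).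
have [c2 d2] := csum_pseries (cps_csum h12 b2).
have dRe b : pseries_diffs (fun n => Re (b n)) = (fun n => Re (pdiffs b n)).
  by apply/funext => n; rewrite /pseries_diffs /pdiffs natC ReMC.
have dIm b : pseries_diffs (fun n => Im (b n)) = (fun n => Im (pdiffs b n)).
  by apply/funext => n; rewrite /pseries_diffs /pdiffs natC ImMC.
rewrite -KN in h3; split.
  rewrite /cps ReI -dRe; apply: pseries_snd_diffs h3.
  - by apply/cvg_ex; exists (Re (cps a K)).
  - by rewrite dRe; apply/cvg_ex; exists (Re (cps (pdiffs a) K)).
  - by rewrite !dRe; apply/cvg_ex; exists (Re (cps (pdiffs (pdiffs a)) K)).
rewrite /cps ImI -dIm; apply: pseries_snd_diffs h3.
- by apply/cvg_ex; exists (Im (cps a K)).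
- by rewrite dIm; apply/cvg_ex; exists (Im (cps (pdiffs a) K)).
- by rewrite !dIm; apply/cvg_ex; exists (Im (cps (pdiffs (pdiffs a)) K)).
Qed.

Lemma exp_partial_le t n : 0 <= t -> \sum_(i < n) t ^+ i / i`!%:R <= expR t.
Proof.
move=> t0; have -> : \sum_(i < n) t ^+ i / i`!%:R = series (exp_coeff t) n.
  rewrite /series /= big_mkord; apply: eq_bigr => i _.
  by rewrite exp_coeffE mulrC.
apply: nondecreasing_cvgn_le; last exact: is_cvg_series_exp_coeff.
by apply: nondecreasing_series => i _ _; rewrite divr_ge0 ?exprn_ge0.
Qed.

(** Along the segment from [0] to [z], the series solves the differential
    equation of the exponential. *)
Lemma csum_cexp z : csum (fun n => z ^+ n / n`!%:R) (cexp z).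
Proof.
pose a n : R[i] := z ^+ n / n`!%:R.
have ab : bnd a 2.
  exists (expR (cabs z * 2)) => n.
  have h : 0 <= cabs z * 2 by rewrite mulr_ge0 ?cabs_ge0.
  apply: le_trans (exp_partial_le n.+1 h).
  rewrite big_ord_recr /= /a cabsM cabsX cabsV cabs_nat exprMn mulrAC lerDr.
  by apply: sumr_ge0 => i _; rewrite divr_ge0 ?exprn_ge0.
have tl t : 0 <= t <= 1 -> `|t| < 2 by move=> /andP[t0 t1]; rewrite ger0_norm //; lra.
have dE t : 0 <= t <= 1 -> cps (pdiffs a) t = z * cps a t.
  move=> t01; apply: cpsE; apply: eq_csum (csumZ z (cps_csum (tl _ t01) ab)) => n.
  rewrite mulrA; congr (_ * _); rewrite /pdiffs /a factS natrM exprS; field.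
  by rewrite nat1r !pnatr_eq0 -lt0n fact_gt0.
have h0 : cps a 0 = 1.
  by rewrite (cps0 _ ab) ?ltr0n // /a expr0 fact0 divr1.
have := @cder0_eq _ (fun t => cps a t * cexp (- (z * t%:C))) 0 1 ler01.
rewrite h0 mulr0 oppr0 cexp0 mul1r mulr1 => h.
have {h}h : 1 = cps a 1 * cexp (- z).
  apply: h => t t01.
  apply: cder_eq (cderM (cder_cps (tl _ t01) ab)
    (cder_cexp (cderN (cderZ z (cder_id t))))) _.
  by rewrite dE //; ring.
have -> : cexp z = cps a 1.
  rewrite -[RHS]mulr1 -(cexp0 (R := R)) -(addNr z) cexpD mulrA -h.
  by rewrite mul1r.
have := cps_csum (tl 1 _) ab; rewrite ler01 lexx => /(_ isT).
by apply: eq_csum => n; rewrite expr1n mulr1.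
Qed.

Definition rising c n : R[i] := \prod_(i < n) (c + i%:R).

Lemma risingS c n : rising c n.+1 = rising c n * (c + n%:R).
Proof. by rewrite /rising big_ord_recr. Qed.

Definition bin_coef c n : R[i] := rising c n / n`!%:R.

Lemma bin_coefS c n : n.+1%:R * bin_coef c n.+1 = (c + n%:R) * bin_coef c n.
Proof.
rewrite /bin_coef risingS factS natrM; field.
by rewrite nat1r !pnatr_eq0 -lt0n fact_gt0.
Qed.

Lemma bounded_eventually_noninc (x : nat -> R) N :
  (forall n, (N <= n)%N -> x n.+1 <= x n) -> exists M, forall n, x n <= M.
Proof.
move=> xN; exists (\big[Order.max/x N]_(i < N) x i) => n.
have [nN|Nn] := ltnP n N.
  exact: (le_bigmax_cond (j := Ordinal nN) _ (fun i : 'I_N => x i)).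
apply: le_trans (bigmax_ge_id _ _ _ _).
by elim: n Nn => [|n ih]; [rewrite leqn0 => /eqP ->|
  rewrite leq_eqVlt => /orP[/eqP -> //|]; rewrite ltnS => Nn;
  exact: le_trans (xN _ Nn) (ih Nn)].
Qed.

(** The ratio of consecutive terms tends to [cabs z * rho < 1], so the terms
    are eventually decreasing. *)
Lemma bnd_bin_coef c z rho : 0 <= rho -> cabs z * rho < 1 ->
  bnd (fun n => bin_coef c n * z ^+ n) rho.
Proof.
move=> r0; set q := cabs z * rho => q1.
have q0 : 0 <= q by rewrite mulr_ge0 ?cabs_ge0.
apply: (@bounded_eventually_noninc _ (Num.truncn (cabs c * q / (1 - q))).+1) => n nN.
have {nN} : cabs c * q / (1 - q) <= n%:R.
  by apply: ltW; apply: lt_le_trans (truncnS_gt _) _; rewrite ler_nat.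
rewrite ler_pdivrMr ?subr_gt0 // => hn.
have -> : cabs (bin_coef c n.+1 * z ^+ n.+1) * rho ^+ n.+1 =
   cabs (n.+1%:R * bin_coef c n.+1) * cabs (z ^+ n) * rho ^+ n * (q / n.+1%:R).
  rewrite !cabsM cabs_nat !cabsX /q !exprS; field; rewrite addrC natr1.
  by rewrite pnatr_eq0.
rewrite bin_coefS (cabsM (c + n%:R)) !(cabsM (bin_coef c n)).
have -> : cabs (c + n%:R) * cabs (bin_coef c n) * cabs (z ^+ n) * rho ^+ n * (q / n.+1%:R)
  = cabs (c + n%:R) * q / n.+1%:R * (cabs (bin_coef c n) * cabs (z ^+ n) * rho ^+ n) by ring.
rewrite ler_piMl ?mulr_ge0 ?cabs_ge0 ?exprn_ge0 //.
rewrite ler_pdivrMr // mul1r.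
have : cabs (c + n%:R) <= cabs c + n%:R by apply: le_trans (cabsD _ _) _; rewrite cabs_nat.
move=> /(ler_wpM2r q0) /le_trans; apply; rewrite -natr1; lra.
Qed.

Lemma Re_one_sub_gt0 z : cabs z < 1 -> 0 < Re (1 - z).
Proof.
move=> z1; rewrite ReB (ReC 1) subr_gt0.
by apply: le_lt_trans z1; apply: le_trans (ler_norm _) (cabs_Re z).
Qed.

(** The binomial series with complex exponent: the sum and
    [(1 - t z) ^ (- c)] satisfy the same first order differential equation
    in [t] on [[0, 1]]. *)
Lemma csum_binomial c z : cabs z < 1 ->
  csum (fun n => bin_coef c n * z ^+ n) (cpow (1 - z) (- c)).
Proof.
move=> z1; have z0 := cabs_ge0 z.
pose a n : R[i] := bin_coef c n * z ^+ n.
pose rho : R := 2 / (1 + cabs z).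
have r1 : 1 < rho by rewrite /rho ltr_pdivlMr; lra.
have ab : bnd a rho.
  apply: bnd_bin_coef; first by lra.
  rewrite /rho mulrA ltr_pdivrMr; lra.
have tl t : 0 <= t <= 1 -> `|t| < rho by move=> /andP[t0 t1]; rewrite ger0_norm //; lra.
have d1 : bnd (pdiffs a) ((1 + rho) / 2) by apply: bnd_pdiffs ab; lra.
have tl' t : 0 <= t <= 1 -> `|t| < (1 + rho) / 2.
  by move=> /andP[t0 t1]; rewrite ger0_norm //; lra.
have dE t : 0 <= t <= 1 ->
    cps (pdiffs a) t = c * z * cps a t + z * t%:C * cps (pdiffs a) t.
  move=> t01; have s1 := cps_csum (tl' _ t01) d1.
  have s2 : csum (fun n => n%:R * a n * t%:C ^+ n) (t%:C * cps (pdiffs a) t).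
    have h := csumZ t%:C s1.
    have -> : t%:C * cps (pdiffs a) t = 0%:R * a 0%N * t%:C ^+ 0 + t%:C * cps (pdiffs a) t.
      by rewrite !mul0r add0r.
    apply: csum_recl; apply: eq_csum h => n.
    by rewrite /pdiffs exprS; ring.
  apply: csum_unique s1 _.
  rewrite -(mulrA z).
  apply: eq_csum (csumD (csumZ (c * z) (cps_csum (tl _ t01) ab)) (csumZ z s2)) => n.
  by rewrite /pdiffs /a (mulrA n.+1%:R) bin_coefS exprS; ring.
have tz t : 0 <= t <= 1 -> 0 < Re (1 - z * t%:C).
  move=> /andP[t0 t1]; apply: Re_one_sub_gt0; rewrite cabsM cabsC ger0_norm //.
  by apply: le_lt_trans z1; rewrite ler_piMr.
have := @cder0_eq _ (fun t => cps a t * cpow (1 - z * t%:C) c) 0 1 ler01.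
have r0 : 0 < rho by lra.
have h0 : cps a 0 = 1.
  by rewrite (cps0 r0 ab) /a /bin_coef /rising big_ord0 expr0 fact0 divr1 mulr1.
rewrite h0 mulr0 subr0 cpow1b !mulr1 => h.
have {h}h : 1 = cps a 1 * cpow (1 - z) c.
  apply: h => t t01.
  have dl : cder (fun s => 1 - z * s%:C) t (0 - z * 1).
    by apply: cderD (cder_cst _ _) (cderN (cderZ z (cder_id t))).
  apply: cder_eq (cderM (cder_cps (tl _ t01) ab) (cder_cpow c (tz _ t01) dl)) _.
  have n0 := Re_gt0_neq0 (tz _ t01).
  have dE' : cps (pdiffs a) t * (1 - z * t%:C) = c * z * cps a t.
    by rewrite mulrBr mulr1 {1}dE //; ring.
  apply: (mulIf n0); rewrite mul0r mulrDl mulrAC dE'; field.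
  exact: n0.
have n0 : 1 - z != 0 by apply: Re_gt0_neq0; exact: Re_one_sub_gt0.
have -> : cpow (1 - z) (- c) = cps a 1.
  rewrite cpowN //; apply: (mulIf (cpow_neq0 c n0)).
  by rewrite -h mulVf // cpow_neq0.
have := cps_csum (tl 1 _) ab; rewrite ler01 lexx => /(_ isT).
by apply: eq_csum => n; rewrite expr1n mulr1.
Qed.

End PowerSeries.

(** * Power expansions with explicit remainder and continuation along a ray *)

Section Expansions.
Context {R : realType}.
Implicit Types (G H : R -> R[i]) (a b : nat -> R[i]) (t r h M N : R) (c : R[i]).

(** Analyticity at [t] in a finitary form: all Taylor remainders are bounded
    geometrically.  No infinite sum occurs, so that products and integrals of
    expansions are handled by finite algebra. *)
Definition expands G t r M a := forall n h, `|h| <= r ->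
  cabs (G (t + h) - \sum_(i < n) a i * h%:C ^+ i) <= M * (`|h| / r) ^+ n.

Lemma expands_ge0 G t r M a : 0 < r -> expands G t r M a -> 0 <= M.
Proof.
move=> r0 /(_ 0%N 0); rewrite normr0 ltW // => /(_ isT).
rewrite expr0 mulr1; apply: le_trans; exact: cabs_ge0.
Qed.

Lemma expands_coef G t r M a i : 0 < r -> expands G t r M a ->
  cabs (a i) * r ^+ i <= 2 * M.
Proof.
move=> r0 ga; have rr : `|r| <= r by rewrite gtr0_norm.
have h1 := ga i r rr; have h2 := ga i.+1 r rr.
rewrite (gtr0_norm r0) divff ?gt_eqF // !expr1n !mulr1 in h1 h2.
have -> : cabs (a i) * r ^+ i = cabs (a i * r%:C ^+ i).
  by rewrite cabsM cabsX cabsC gtr0_norm.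
have -> : a i * r%:C ^+ i = (G (t + r) - \sum_(j < i) a j * r%:C ^+ j) -
    (G (t + r) - \sum_(j < i.+1) a j * r%:C ^+ j).
  by rewrite big_ord_recr /=; ring.
by apply: le_trans (cabsB _ _) _; lra.
Qed.

Lemma expandsB G H t r M N a b : expands G t r M a -> expands H t r N b ->
  expands (fun s => G s - H s) t r (M + N) (fun n => a n - b n).
Proof.
move=> ga hb n h hr; under eq_bigr do rewrite mulrBl.
rewrite sumrB (_ : _ - _ = (G (t + h) - \sum_(i < n) a i * h%:C ^+ i) -
  (H (t + h) - \sum_(i < n) b i * h%:C ^+ i)); last by ring.
by apply: le_trans (cabsB _ _) _; rewrite mulrDl lerD // ?ga // hb.
Qed.

Definition cauchy_prod a b n : R[i] := \sum_(i < n.+1) a i * b (n - i)%N.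

Lemma cauchy_prod_sum a b (x : R[i]) n :
  \sum_(i < n) a i * x ^+ i * (\sum_(j < n - i) b j * x ^+ j) =
  \sum_(m < n) cauchy_prod a b m * x ^+ m.
Proof.
elim: n => [|n ih]; first by rewrite !big_ord0.
rewrite [RHS]big_ord_recr /= -ih /cauchy_prod mulr_suml.
transitivity (\sum_(i < n.+1) (a i * x ^+ i * (\sum_(j < n - i) b j * x ^+ j) +
    a i * b (n - i)%N * x ^+ n)).
  apply: eq_bigr => i _; have le_in : (i <= n)%N by rewrite -ltnS.
  rewrite subSn // big_ord_recr /= mulrDr; congr (_ + _).
  have -> : x ^+ n = x ^+ i * x ^+ (n - i) by rewrite -exprD subnKC.
  ring.
rewrite big_split /=; congr (_ + _).
by rewrite big_ord_recr /= subnn big_ord0 mulr0 addr0.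
Qed.

(** The remainder of a product is a sum of [n + 1] remainders of size
    [(|h| / r) ^ n]; halving the radius absorbs the factor [n + 1]. *)
Lemma expandsM G H t r M N a b : 0 < r ->
  expands G t r M a -> expands H t r N b ->
  expands (fun s => G s * H s) t (r / 2) (2 * (M * N)) (cauchy_prod a b).
Proof.
move=> r0 ga hb n h hr2.
have hr : `|h| <= r by apply: le_trans hr2 _; lra.
have M0 := expands_ge0 r0 ga; have N0 := expands_ge0 r0 hb.
set x := `|h| / r; have x0 : 0 <= x by rewrite divr_ge0 // ltW.
rewrite -cauchy_prod_sum.
have -> : G (t + h) * H (t + h) -
    \sum_(i < n) a i * h%:C ^+ i * (\sum_(j < n - i) b j * h%:C ^+ j) =
  (G (t + h) - \sum_(i < n) a i * h%:C ^+ i) * H (t + h) +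
  \sum_(i < n) a i * h%:C ^+ i * (H (t + h) - \sum_(j < n - i) b j * h%:C ^+ j).
  under [X in _ = _ + X]eq_bigr do rewrite mulrBr.
  rewrite sumrB -mulr_suml; ring.
apply: le_trans (cabsD _ _) _.
have l1 : cabs ((G (t + h) - \sum_(i < n) a i * h%:C ^+ i) * H (t + h)) <=
    M * N * x ^+ n.
  rewrite cabsM mulrAC ler_pM ?cabs_ge0 //; first exact: ga.
  by have := hb 0%N h hr; rewrite big_ord0 subr0 expr0 mulr1.
have l2 : cabs (\sum_(i < n) a i * h%:C ^+ i *
    (H (t + h) - \sum_(j < n - i) b j * h%:C ^+ j)) <= n%:R * (2 * (M * N) * x ^+ n).
  apply: le_trans (cabs_sum _ _ _) _.
  rewrite mulr_natl -[X in _ *+ X]card_ord -sumr_const; apply: ler_sum => i _.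
  have -> : 2 * (M * N) * x ^+ n = (2 * M * x ^+ i) * (N * x ^+ (n - i)).
    have -> : x ^+ n = x ^+ i * x ^+ (n - i) by rewrite -exprD subnKC // ltnW.
    ring.
  rewrite cabsM ler_pM ?cabs_ge0 //; last exact: hb.
  rewrite cabsM cabsX cabsC.
  have -> : cabs (a i) * `|h| ^+ i = cabs (a i) * r ^+ i * x ^+ i.
    by rewrite /x exprMn exprVn; field; rewrite expf_neq0 // gt_eqF.
  by rewrite ler_wpM2r ?exprn_ge0 //; exact: expands_coef ga.
apply: le_trans (lerD l1 l2) _.
have -> : `|h| / (r / 2) = 2 * x by rewrite /x; field; rewrite gt_eqF.
have n2 : 1 + 2 * n%:R <= 2 * 2 ^+ n :> R.
  have : (n.+1%:R : R) <= 2 ^+ n by rewrite -natrX ler_nat ltn_expl.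
  rewrite -natr1; lra.
have MN0 : 0 <= M * N * x ^+ n by rewrite !mulr_ge0 // exprn_ge0.
have -> : (2 * x) ^+ n = 2 ^+ n * x ^+ n by rewrite exprMn.
rewrite (_ : M * N * x ^+ n + n%:R * (2 * (M * N) * x ^+ n) =
  M * N * x ^+ n * (1 + 2 * n%:R)); last by ring.
rewrite (_ : 2 * (M * N) * (2 ^+ n * x ^+ n) = M * N * x ^+ n * (2 * 2 ^+ n)); last by ring.
exact: ler_wpM2l.
Qed.

(** The tail of the series after [n] terms carries the factor [(|h| / r) ^ n],
    and what remains is bounded by the sum at radius [r]. *)
Lemma expands_csum G t r M a : 0 < r ->
  (forall h, `|h| <= r -> csum (fun n => a n * h%:C ^+ n) (G (t + h))) ->
  (forall n, \sum_(i < n) cabs (a i) * r ^+ i <= M) ->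
  expands G t r M a.
Proof.
move=> r0 aG aM n h hr; apply: csum_tail (aG h hr) _ => m.
have x0 : 0 <= `|h| / r by rewrite divr_ge0 // ltW.
have x1 : `|h| / r <= 1 by rewrite ler_pdivrMr // mul1r.
have M0 : 0 <= M by have := aM 0%N; rewrite big_ord0.
have [mn|nm] := leqP m n; first by rewrite big_geq // mulr_ge0 // exprn_ge0.
apply: (@le_trans _ _ ((\sum_(i < m) cabs (a i) * r ^+ i) * (`|h| / r) ^+ n)); last first.
  by rewrite ler_wpM2r // exprn_ge0.
rewrite -(big_mkord predT (fun i => cabs (a i) * r ^+ i)).
rewrite [X in _ <= X * _](big_cat_nat _ (ltnW nm)) //= mulrDl ler_wpDl //.
  by rewrite mulr_ge0 ?exprn_ge0 // sumr_ge0 // => i _; rewrite mulr_ge0 ?cabs_ge0 // exprn_ge0 // ltW //.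
rewrite mulr_suml; apply: ler_sum_nat => i /andP[ni _].
rewrite cabsM cabsX cabsC.
have -> : cabs (a i) * `|h| ^+ i = cabs (a i) * r ^+ i * (`|h| / r) ^+ i.
  by rewrite exprMn exprVn; field; rewrite expf_neq0 // gt_eqF.
rewrite ler_wpM2l ?mulr_ge0 ?cabs_ge0 ?exprn_ge0 ?(ltW r0) //.
by rewrite ler_wiXn2l.
Qed.

(** By [expands_coef] the coefficients of each order are summable over [k]; the
    remainders then add up term by term. *)
Lemma expands_sum (G_ : nat -> R -> R[i]) G t r (M_ : nat -> R) M (a_ : nat -> nat -> R[i]) :
  0 < r ->
  (forall k, expands (G_ k) t r (M_ k) (a_ k)) ->
  (forall n, \sum_(k < n) M_ k <= M) ->
  (forall h, `|h| <= r -> csum (fun k => G_ k (t + h)) (G (t + h))) ->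
  exists a, expands G t r M a.
Proof.
move=> r0 ga MM Gs.
have /choice[a ha] : forall i, exists l, csum (fun k => a_ k i) l.
  move=> i; apply: (@abs_csum _ _ (2 * M / r ^+ i)) => n.
  rewrite ler_pdivlMr ?exprn_gt0 // mulr_suml.
  apply: le_trans (ler_wpM2l _ (MM n)); last by [].
  by rewrite mulr_sumr; apply: ler_sum => k _; exact: expands_coef (ga k).
exists a => n h hr.
have x0 : 0 <= `|h| / r by rewrite divr_ge0 // ltW.
have s : csum (fun k => G_ k (t + h) - \sum_(i < n) a_ k i * h%:C ^+ i)
    (G (t + h) - \sum_(i < n) a i * h%:C ^+ i).
  elim: n => [|n ih].
    by rewrite big_ord0 subr0; apply: eq_csum (Gs h hr) => k; rewrite big_ord0 subr0.
  rewrite big_ord_recr /= opprD addrA -mulNr mulrC.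
  have := csumD ih (csumZ (h%:C ^+ n) (csumZ (-1) (ha n))).
  rewrite mulN1r; apply: eq_csum => k.
  by rewrite big_ord_recr /=; ring.
apply: csum_abs_le s _ => m.
apply: (@le_trans _ _ (\sum_(k < m) M_ k * (`|h| / r) ^+ n)).
  by apply: ler_sum => k _; exact: ga.
by rewrite -mulr_suml ler_wpM2r // exprn_ge0.
Qed.

(** A function that vanishes just to the right of [t] has zero Taylor
    coefficients at [t], hence vanishes on the whole disc of expansion. *)
Lemma expands_eq0 G t r M a d : 0 < r -> 0 < d -> expands G t r M a ->
  (forall h, 0 < h -> h < d -> G (t + h) = 0) ->
  forall h, `|h| < r -> G (t + h) = 0.
Proof.
move=> r0 d0 ga G0; have M0 := expands_ge0 r0 ga.
have a0 i : a i = 0.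
  elim/ltn_ind: i => i ih; apply/eqP; rewrite -cabs_eq0 eq_le cabs_ge0 andbT.
  apply/ler_addgt0Pl => e e0; rewrite addr0.
  pose h := Num.min (Num.min (d / 2) r) (e * r ^+ i.+1 / (M + 1)).
  have M1 : 0 < M + 1 by rewrite ltr_wpDl.
  have h0 : 0 < h by rewrite /h !lt_min !divr_gt0 ?mulr_gt0 ?exprn_gt0 // r0.
  have hd : h < d by rewrite /h !gt_min; apply/orP; left; apply/orP; left; lra.
  have hr : h <= r by rewrite /h !ge_min lexx /= orbT.
  have he : h <= e * r ^+ i.+1 / (M + 1) by rewrite /h ge_min lexx orbT.
  have := ga i.+1 h; rewrite (gtr0_norm h0) => /(_ hr).
  rewrite G0 // sub0r cabsN big_ord_recr /= big1 ?add0r; last first.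
    by move=> j _; rewrite ih ?mul0r.
  rewrite cabsM cabsX cabsC (gtr0_norm h0) exprMn exprVn exprSr.
  have -> : M * (h ^+ i * h / r ^+ i.+1) = (M * h / r ^+ i.+1) * h ^+ i by ring.
  rewrite ler_pM2r ?exprn_gt0 // => /le_trans; apply.
  rewrite ler_pdivrMr ?exprn_gt0 //.
  move: he; rewrite ler_pdivlMr // => he; apply: le_trans he.
  by rewrite mulrDr mulr1 mulrC lerDl ltW.
move=> h hr; apply/eqP; rewrite -cabs_eq0 eq_le cabs_ge0 andbT.
set x := `|h| / r; have x0 : 0 <= x by rewrite divr_ge0 // ltW.
have x1 : x < 1 by rewrite ltr_pdivrMr // mul1r.
have c0 : geometric M x @ \oo --> 0 by apply: cvg_geometric; rewrite ger0_norm.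
apply: (cvgr_to_ge c0); apply: nearW => n.
have := ga n h (ltW hr); rewrite big1 ?subr0 // => i _.
by rewrite a0 mul0r.
Qed.

(** Continuation down a ray: a lower bound on the radii of expansion lets
    zeros propagate by a fixed step. *)
Lemma expands_ray_eq0 G (t1 T rho : R) : 0 < rho ->
  (forall t, t1 <= t -> exists M a, expands G t rho M a) ->
  (forall t, T <= t -> G t = 0) -> forall t, t1 <= t -> G t = 0.
Proof.
move=> r0 Ge GT.
have step (N : nat) t : t1 <= t -> T - N%:R * (rho / 2) <= t -> G t = 0.
  elim: N t => [|N ih] t tt1; first by rewrite mul0r subr0; exact: GT.
  rewrite -natr1 => hN.
  have [M [a Ga]] : exists M a, expands G (t + rho / 2) rho M a by apply: Ge; lra.
  rewrite -[t](addrK (rho / 2)).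
  apply: (expands_eq0 r0 r0 Ga); last by rewrite normrN gtr0_norm; lra.
  by move=> h h0 _; apply: ih; lra.
move=> t tt1; apply: (step (Num.truncn ((T - t) / (rho / 2))).+1) => //.
have := truncnS_gt ((T - t) / (rho / 2)).
by rewrite ltr_pdivrMr ?divr_gt0 // => /ltW; lra.
Qed.

(** The constant is the largest modulus of the exponential on the complex disc
    of radius [r] about [t]. *)
Lemma expands_cexp c t r : 0 < r ->
  exists a, expands (fun s => cexp (- (s%:C * c))) t r (expR (r * cabs c - t * Re c)) a
    /\ forall n, a n = cexp (- (t%:C * c)) * ((- c) ^+ n / n`!%:R).
Proof.
move=> r0; exists (fun n => cexp (- (t%:C * c)) * ((- c) ^+ n / n`!%:R)); split => //.
apply: expands_csum => // [h hr|n].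
  rewrite (_ : cexp (- ((t + h)%:C * c)) = cexp (- (t%:C * c)) * cexp (- c * h%:C)); last first.
    by rewrite -cexpD; congr cexp; rewrite rmorphD /=; ring.
  apply: eq_csum (csumZ _ (csum_cexp _)) => n.
  by rewrite exprMn; ring.
rewrite addrC expRD.
apply: (@le_trans _ _ (expR (- (t * Re c)) * \sum_(i < n) (r * cabs c) ^+ i / i`!%:R)).
  rewrite mulr_sumr le_eqVlt; apply/orP; left; apply/eqP; apply: eq_bigr => i _.
  rewrite cabsM cabs_cexp ReN ReMC cabsM cabsX cabsN cabsV cabs_nat exprMn; ring.
by rewrite ler_wpM2l ?expR_ge0 // exp_partial_le // mulr_ge0 ?cabs_ge0 // ltW.
Qed.

Lemma cabs_bin_coef_le c n : cabs (bin_coef c n) <= Re (bin_coef (cabs c)%:C n).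
Proof.
rewrite /bin_coef cabsM cabsV cabs_nat.
have -> : rising (cabs c)%:C n / n`!%:R = (n`!%:R^-1)%:C * rising (cabs c)%:C n.
  by rewrite mulrC natC fmorphV.
rewrite ReMC mulrC ler_wpM2l ?invr_ge0 // /rising.
have -> : \prod_(i < n) ((cabs c)%:C + i%:R) = (\prod_(i < n) (cabs c + i%:R))%:C.
  by rewrite rmorph_prod; apply: eq_bigr => i _; rewrite natC rmorphD.
rewrite ReC; elim/big_ind2 : _ => [|x1 y1 x2 y2 h1 h2|i _]; first by rewrite cabs1.
  by rewrite cabsM ler_pM ?cabs_ge0.
by apply: le_trans (cabsD _ _) _; rewrite cabs_nat.
Qed.

(** The series is majorised by the binomial series of exponent [- cabs c]. *)
Lemma bin_coef_sum_le c (y : R) n : 0 <= y -> y < 1 ->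
  \sum_(i < n) cabs (bin_coef c i) * y ^+ i <= (1 - y) `^ (- cabs c).
Proof.
move=> y0 y1.
have yC : cabs y%:C < 1 by rewrite cabsC ger0_norm.
have h := csum_Re (csum_binomial (cabs c)%:C yC).
have termE i : Re (bin_coef (cabs c)%:C i * y%:C ^+ i) = Re (bin_coef (cabs c)%:C i) * y ^+ i.
  by rewrite -rmorphXn mulrC ReMC mulrC.
have term0 i : 0 <= Re (bin_coef (cabs c)%:C i) * y ^+ i.
  by rewrite mulr_ge0 ?exprn_ge0 //; apply: le_trans (cabs_bin_coef_le c i); exact: cabs_ge0.
have -> : (1 - y) `^ (- cabs c) = Re (cpow (1 - y%:C) (- (cabs c)%:C)).
  have -> : 1 - y%:C = (1 - y)%:C by rewrite rmorphB.
  rewrite cpowC ?subr_gt0 // -rmorphN -rmorphM cexpC ReC /powR gt_eqF ?subr_gt0 //.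
apply: (@le_trans _ _ (\sum_(i < n) Re (bin_coef (cabs c)%:C i * y%:C ^+ i))).
  apply: ler_sum => i _; rewrite termE ler_wpM2r ?exprn_ge0 //.
  exact: cabs_bin_coef_le.
apply: (cvgr_to_ge h); exists n => // m /= nm.
rewrite -!(big_mkord predT (fun i => Re (bin_coef (cabs c)%:C i * y%:C ^+ i))).
rewrite (big_cat_nat _ nm) //= lerDl sumr_ge0 // => i _.
by rewrite termE.
Qed.

Lemma expands_cpow c t (y : R) : 0 < t -> 0 < y -> y < 1 ->
  exists a, expands (fun s => cpow s%:C c) t (y * t)
    (t `^ Re c * (1 - y) `^ (- cabs c)) a.
Proof.
move=> t0 y0 y1.
exists (fun n => cpow t%:C c * (bin_coef (- c) n * (- t^-1%:C) ^+ n)).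
have yt : 0 < y * t by rewrite mulr_gt0.
apply: expands_csum => // [h hr|n].
  have ht : `|h / t| < 1.
    rewrite normrM normfV (gtr0_norm t0) ltr_pdivrMr // mul1r.
    by apply: le_lt_trans hr _; rewrite gtr_pMl.
  have p1 : 0 < 1 + h / t.
    by move: ht; rewrite ltr_norml => /andP[? _]; lra.
  rewrite (_ : (t + h)%:C = t%:C * (1 + h / t)%:C); last first.
    by rewrite -rmorphM mulrDr mulr1 mulrCA divff ?gt_eqF // mulr1.
  rewrite cpowM ?real_neq0 //.
  have hz : cabs (- (h / t)%:C) < 1 by rewrite cabsN cabsC.
  have := csumZ (cpow t%:C c) (csum_binomial (- c) hz).
  rewrite !opprK (_ : (1 + h / t)%:C = 1 + (h / t)%:C); last by rewrite rmorphD.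
  apply: eq_csum => i; rewrite -!mulrA; congr (_ * (_ * _)).
  have -> : - (h / t)%:C = - t^-1%:C * h%:C by rewrite rmorphM /= mulrC mulNr.
  by rewrite exprMn.
apply: (@le_trans _ _ (t `^ Re c * \sum_(i < n) cabs (bin_coef (- c) i) * y ^+ i)).
  rewrite mulr_sumr le_eqVlt; apply/orP; left; apply/eqP; apply: eq_bigr => i _.
  rewrite !cabsM cabs_cpow // cabsX cabsN cabsC normfV gtr0_norm // exprMn exprVn.
  by field; rewrite expf_neq0 // gt_eqF.
by rewrite ler_wpM2l ?powR_ge0 // -(cabsN c) bin_coef_sum_le // ltW.
Qed.

End Expansions.

(** * Measurability and integration of complex-valued functions *)

Section ComplexMeasurable.
Context d {T : measurableType d} {R : realType}.
Implicit Types (D : set T) (g h : T -> R[i]).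

Definition cmeas D g := measurable_fun D (fun t => Re (g t)) /\
  measurable_fun D (fun t => Im (g t)).

Lemma cmeas_cst D z : cmeas D (fun=> z).
Proof. by split; exact: measurable_cst. Qed.

Lemma cmeas_real D (f : T -> R) : measurable_fun D f -> cmeas D (fun t => (f t)%:C).
Proof. by move=> mf; split => //=; exact: measurable_cst. Qed.

Lemma cmeasD D g h : cmeas D g -> cmeas D h -> cmeas D (fun t => g t + h t).
Proof.
move=> [g1 g2] [h1 h2]; split.
  by under eq_fun do rewrite ReD; exact: measurable_funD.
by under eq_fun do rewrite ImD; exact: measurable_funD.
Qed.

Lemma cmeasM D g h : cmeas D g -> cmeas D h -> cmeas D (fun t => g t * h t).
Proof.
move=> [g1 g2] [h1 h2]; split.
  by under eq_fun do rewrite ReM; apply: measurable_funB; exact: measurable_funM.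
by under eq_fun do rewrite ImM; apply: measurable_funD; exact: measurable_funM.
Qed.

Lemma cmeasZ z D g : cmeas D g -> cmeas D (fun t => z * g t).
Proof. by apply: cmeasM; exact: cmeas_cst. Qed.

Lemma cmeasN D g : cmeas D g -> cmeas D (fun t => - g t).
Proof. by move=> mg; under eq_fun do rewrite -mulN1r; exact: cmeasZ. Qed.

Lemma cmeas_sum D n (g : nat -> T -> R[i]) : (forall i, cmeas D (g i)) ->
  cmeas D (fun t => \sum_(i < n) g i t).
Proof.
move=> mg; elim: n => [|n ih].
  by under eq_fun do rewrite big_ord0; exact: cmeas_cst.
by under eq_fun do rewrite big_ord_recr /=; exact: cmeasD.
Qed.

Lemma cmeas_cexp D g : cmeas D g -> cmeas D (fun t => cexp (g t)).
Proof.
move=> [g1 g2].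
have e : measurable_fun D (fun t => expR (Re (g t))).
  exact: (measurableT_comp (@measurable_expR R)).
have c : measurable_fun D (fun t => cos (Im (g t))).
  exact: (measurableT_comp (continuous_measurable_fun (@continuous_cos R))).
have s : measurable_fun D (fun t => sin (Im (g t))).
  exact: (measurableT_comp (continuous_measurable_fun (@continuous_sin R))).
split.
  by under eq_fun do rewrite Re_cexp; exact: measurable_funM.
by under eq_fun do rewrite Im_cexp; exact: measurable_funM.
Qed.

Lemma eq_cmeas D g h : (forall t, D t -> g t = h t) -> cmeas D g -> cmeas D h.
Proof.
by move=> gh [g1 g2]; split; [apply: eq_measurable_fun g1|apply: eq_measurable_fun g2];
  move=> t; rewrite inE => /gh ->.
Qed.

Lemma cmeas_cpow D (f : T -> R) z : measurable_fun D f -> (forall t, D t -> 0 < f t) ->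
  cmeas D (fun t => cpow (f t)%:C z).
Proof.
move=> mf f0; apply: (@eq_cmeas _ (fun t => cexp (z * (ln (f t))%:C))) => [t /f0 ?|].
  by rewrite cpowC.
apply: cmeas_cexp; apply: cmeasZ; apply: cmeas_real.
exact: (measurableT_comp (@measurable_ln R)).
Qed.

Lemma measurable_cabs D g : cmeas D g -> measurable_fun D (fun t => cabs (g t)).
Proof.
move=> [g1 g2]; under eq_fun do rewrite cabsE.
apply: (measurableT_comp (continuous_measurable_fun (@sqrt_continuous R))).
by apply: measurable_funD; apply: measurable_funX.
Qed.

Lemma cmeas_lim D (g_ : nat -> T -> R[i]) g : (forall n, cmeas D (g_ n)) ->
  (forall t, D t -> ccvg (g_ ^~ t) (g t)) -> cmeas D g.
Proof.
move=> mg gg; split.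
  by apply: (@measurable_fun_cvg _ _ _ D (fun n t => Re (g_ n t))) => [n|t /gg []//];
    case: (mg n).
by apply: (@measurable_fun_cvg _ _ _ D (fun n t => Im (g_ n t))) => [n|t /gg []//];
  case: (mg n).
Qed.

End ComplexMeasurable.

Section ComplexIntegral.
Context {R : realType}.
Implicit Types (g h : R -> R[i]) (z : R[i]).
Local Notation mu := (@lebesgue_measure R).
Variable D : set (measurableTypeR R).
Hypothesis mD : measurable D.

Lemma cintegrable_cmeas g : cintegrable D g -> cmeas D g.
Proof.
by move=> [g1 g2]; split; apply/measurable_EFinP; exact: (measurable_int mu).
Qed.

Lemma real_dom (f h : R -> R) : measurable_fun D f ->
  mu.-integrable D (EFin \o h) -> (forall t, D t -> `|f t| <= h t) ->
  mu.-integrable D (EFin \o f).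
Proof.
move=> mf ih fh; apply: (@le_integrable _ _ _ mu D mD _ (EFin \o h)) => //.
  exact/measurable_EFinP.
move=> t Dt; rewrite /= lee_fin; apply: le_trans (fh t Dt) (ler_norm _).
Qed.

Lemma cintegrable_dom g (h : R -> R) : cmeas D g ->
  mu.-integrable D (EFin \o h) -> (forall t, D t -> cabs (g t) <= h t) ->
  cintegrable D g.
Proof.
move=> [g1 g2] ih gh; split; apply: real_dom ih _ => // t Dt;
  apply: le_trans (gh t Dt); [exact: cabs_Re|exact: cabs_Im].
Qed.

Lemma cintegrable_abs g : cintegrable D g ->
  mu.-integrable D (EFin \o (fun t => cabs (g t))).
Proof.
move=> ig; have [g1 g2] := ig.
apply: (@real_dom _ (fun t => `|Re (g t)| + `|Im (g t)|)).
- exact: measurable_cabs (cintegrable_cmeas ig).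
- have := integrableD mD (integrable_norm g1) (integrable_norm g2).
  by apply: eq_integrable => // t _; rewrite /= EFinD.
- by move=> t _; rewrite ger0_norm ?cabs_ge0 // cabs_le.
Qed.

Lemma eq_cintegrable g h : (forall t, D t -> g t = h t) -> cintegrable D g ->
  cintegrable D h.
Proof.
by move=> gh [g1 g2]; split; [apply: eq_integrable g1|apply: eq_integrable g2];
  rewrite // => t; rewrite inE /= => /gh ->.
Qed.

Lemma eq_cintegral g h : (forall t, D t -> g t = h t) ->
  cintegral D g = cintegral D h.
Proof.
by move=> gh; rewrite /cintegral; congr (_ +i* _); apply: eq_Rintegral => t;
  rewrite inE => /gh ->.
Qed.

Lemma cintegrableD g h : cintegrable D g -> cintegrable D h ->
  cintegrable D (fun t => g t + h t).
Proof.
move=> [g1 g2] [h1 h2]; split.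
  have := integrableD mD g1 h1; apply: eq_integrable => // t _.
  by rewrite /= ReD EFinD.
have := integrableD mD g2 h2; apply: eq_integrable => // t _.
by rewrite /= ImD EFinD.
Qed.

Lemma rintegrableZ (x : R) (f : R -> R) : mu.-integrable D (EFin \o f) ->
  mu.-integrable D (EFin \o (fun t => x * f t)).
Proof.
by move=> /(integrableZl mD x); apply: eq_integrable => // t _; rewrite /= EFinM.
Qed.

Lemma rintegrableD (e f : R -> R) : mu.-integrable D (EFin \o e) ->
  mu.-integrable D (EFin \o f) ->
  mu.-integrable D (EFin \o (fun t => e t + f t)).
Proof.
by move=> ie /(integrableD mD ie); apply: eq_integrable => // t _; rewrite /= EFinD.
Qed.

Lemma rintegrableB (e f : R -> R) : mu.-integrable D (EFin \o e) ->
  mu.-integrable D (EFin \o f) ->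
  mu.-integrable D (EFin \o (fun t => e t - f t)).
Proof.
by move=> ie /(integrableB mD ie); apply: eq_integrable => // t _; rewrite /= EFinD.
Qed.

Lemma cintegrableZ z g : cintegrable D g -> cintegrable D (fun t => z * g t).
Proof.
move=> [g1 g2]; split.
  have := rintegrableB (rintegrableZ (Re z) g1) (rintegrableZ (Im z) g2).
  by apply: eq_integrable => // t _; rewrite /= ReM.
have := rintegrableD (rintegrableZ (Re z) g2) (rintegrableZ (Im z) g1).
by apply: eq_integrable => // t _; rewrite /= ImM.
Qed.

Lemma cintegrableN g : cintegrable D g -> cintegrable D (fun t => - g t).
Proof.
by move=> /(cintegrableZ (-1)); apply: eq_cintegrable => t _; rewrite mulN1r.
Qed.

Lemma cintegrableB g h : cintegrable D g -> cintegrable D h ->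
  cintegrable D (fun t => g t - h t).
Proof. by move=> ig ih; apply: cintegrableD => //; exact: cintegrableN. Qed.

Lemma cintegralD g h : cintegrable D g -> cintegrable D h ->
  cintegral D (fun t => g t + h t) = cintegral D g + cintegral D h.
Proof.
move=> [g1 g2] [h1 h2]; apply: cplxP; rewrite ?ReD ?ImD /cintegral !(ReI, ImI).
  by under eq_Rintegral do rewrite ReD; rewrite RintegralD.
by under eq_Rintegral do rewrite ImD; rewrite RintegralD.
Qed.

Lemma cintegralZ z g : cintegrable D g ->
  cintegral D (fun t => z * g t) = z * cintegral D g.
Proof.
move=> [g1 g2]; apply: cplxP; rewrite ?ReM ?ImM /cintegral !(ReI, ImI).
  under eq_Rintegral do rewrite ReM.
  by rewrite RintegralB ?rintegrableZ // !RintegralZl.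
under eq_Rintegral do rewrite ImM.
by rewrite RintegralD ?rintegrableZ // !RintegralZl.
Qed.

Lemma cintegralB g h : cintegrable D g -> cintegrable D h ->
  cintegral D (fun t => g t - h t) = cintegral D g - cintegral D h.
Proof.
move=> ig ih; rewrite cintegralD //; last exact: cintegrableN.
rewrite -[in RHS]mulN1r -cintegralZ //; congr (_ + _).
by apply: eq_cintegral => t _; rewrite mulN1r.
Qed.

Lemma cintegral_cst0 : cintegral D (fun=> 0) = 0.
Proof.
by apply: cplxP; rewrite /cintegral ?ReI ?ImI /=; rewrite /Rintegral integral0.
Qed.

Lemma cintegrable0 : cintegrable D (fun=> 0).
Proof. by split; exact: integrable0. Qed.

Lemma cintegrable_sum n (g : nat -> R -> R[i]) : (forall i, cintegrable D (g i)) ->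
  cintegrable D (fun t => \sum_(i < n) g i t).
Proof.
move=> ig; elim: n => [|n ih].
  by under eq_fun do rewrite big_ord0; exact: cintegrable0.
by under eq_fun do rewrite big_ord_recr /=; exact: cintegrableD.
Qed.

Lemma cintegral_sum n (g : nat -> R -> R[i]) : (forall i, cintegrable D (g i)) ->
  cintegral D (fun t => \sum_(i < n) g i t) = \sum_(i < n) cintegral D (g i).
Proof.
move=> ig; elim: n => [|n ih].
  rewrite big_ord0 -[RHS]cintegral_cst0.
  by apply: eq_cintegral => t _; rewrite big_ord0.
rewrite big_ord_recr /= -ih -cintegralD //; last exact: cintegrable_sum.
by apply: eq_cintegral => t _; rewrite big_ord_recr.
Qed.

(** The triangle inequality: rotate the integral onto the positive axis. *)
Lemma cabs_cintegral g : cintegrable D g ->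
  cabs (cintegral D g) <= \int[mu]_(t in D) cabs (g t).
Proof.
move=> ig; set I := cintegral D g.
have [I0|I0] := eqVneq (cabs I) 0.
  by rewrite I0; apply: Rintegral_ge0 => t _; exact: cabs_ge0.
have Ip : 0 < cabs I by rewrite lt0r I0 cabs_ge0.
pose J : R[i] := Re I +i* - Im I.
have JI : J * I = (cabs I ^+ 2)%:C.
  by rewrite cabs_sq; apply: cplxP; rewrite !(ReM,ImM,ReI,ImI,ReC,ImC); ring.
have JA : cabs J = cabs I by rewrite !cabsE ReI ImI sqrrN.
rewrite -(ler_pM2l Ip) -expr2 -RintegralZl //; last exact: cintegrable_abs.
have <- : Re (cintegral D (fun t => J * g t)) = cabs I ^+ 2.
  by rewrite cintegralZ // -/I JI.
rewrite /cintegral ReI; apply: le_Rintegral => //.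
- by case: (cintegrableZ J ig).
- by apply: rintegrableZ; exact: cintegrable_abs.
- move=> t _; apply: le_trans (ler_norm _) _; apply: le_trans (cabs_Re _) _.
  by rewrite cabsM JA.
Qed.

Lemma real_dominated (f_ : nat -> R -> R) (f h : R -> R) :
  (forall n, measurable_fun D (f_ n)) ->
  (forall t, D t -> f_ ^~ t @ \oo --> f t) ->
  mu.-integrable D (EFin \o h) ->
  (forall n t, D t -> `|f_ n t| <= h t) ->
  (fun n => \int[mu]_(t in D) f_ n t) @ \oo --> \int[mu]_(t in D) f t.
Proof.
move=> mf ff ih fh.
have mff : measurable_fun D f.
  by apply: (@measurable_fun_cvg _ _ _ D f_) => // t Dt; exact: ff.
have [| | | | |] := @dominated_convergence _ _ _ mu D mD (fun n => EFin \o f_ n)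
  (EFin \o f) (EFin \o h).
- by move=> n; exact/measurable_EFinP.
- exact/measurable_EFinP.
- by apply: aeW => t Dt; apply: cvg_EFin; [exact: nearW|exact: ff].
- exact: ih.
- by apply: aeW => t n Dt; rewrite /= lee_fin fh.
move=> intf _ cf; apply: fine_cvg.
by rewrite /Rintegral fineK //; exact: integrable_fin_num.
Qed.

Lemma cdominated (g_ : nat -> R -> R[i]) g (h : R -> R) :
  (forall n, cmeas D (g_ n)) ->
  (forall t, D t -> ccvg (g_ ^~ t) (g t)) ->
  mu.-integrable D (EFin \o h) ->
  (forall n t, D t -> cabs (g_ n t) <= h t) ->
  ccvg (fun n => cintegral D (g_ n)) (cintegral D g).
Proof.
move=> mg gg ih gh; split.
  apply: (real_dominated (h := h)) => // [n|t /gg []//|n t Dt]; first by case: (mg n).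
  exact: le_trans (cabs_Re _) (gh n t Dt).
apply: (real_dominated (h := h)) => // [n|t /gg []//|n t Dt]; first by case: (mg n).
exact: le_trans (cabs_Im _) (gh n t Dt).
Qed.

Lemma cintegrable_lim (g_ : nat -> R -> R[i]) g (h : R -> R) :
  (forall n, cmeas D (g_ n)) ->
  (forall t, D t -> ccvg (g_ ^~ t) (g t)) ->
  mu.-integrable D (EFin \o h) ->
  (forall n t, D t -> cabs (g_ n t) <= h t) -> cintegrable D g.
Proof.
move=> mg gg ih gh; apply: cintegrable_dom ih _; first exact: cmeas_lim gg.
move=> t Dt; apply: ccvg_le (gg t Dt) _; apply: nearW => n; exact: gh.
Qed.

(** Dominated convergence for the partial sums: this is what computes the
    transform of a series from the transforms of its terms. *)
Lemma csum_integral (g_ : nat -> R -> R[i]) g (h : R -> R) :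
  (forall n, cmeas D (g_ n)) ->
  (forall t, D t -> csum (g_ ^~ t) (g t)) ->
  mu.-integrable D (EFin \o h) ->
  (forall n t, D t -> \sum_(i < n) cabs (g_ i t) <= h t) ->
  cintegrable D g /\ csum (fun n => cintegral D (g_ n)) (cintegral D g).
Proof.
move=> mg gg ih gh.
have mS n : cmeas D (fun t => \sum_(i < n) g_ i t) by exact: cmeas_sum.
have dS n t : D t -> cabs (\sum_(i < n) g_ i t) <= h t.
  by move=> Dt; apply: le_trans (cabs_sum _ _ _) (gh n t Dt).
have ig i : cintegrable D (g_ i).
  apply: cintegrable_dom ih _ => // t Dt; apply: le_trans (gh i.+1 t Dt).
  by rewrite big_ord_recr /= lerDr sumr_ge0 // => j _; exact: cabs_ge0.
split; first exact: (cintegrable_lim (g_ := fun n t => \sum_(i < n) g_ i t) (h := h)).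
have := cdominated (g_ := fun n t => \sum_(i < n) g_ i t) (g := g) mS gg ih dS.
by apply: ccvg_eq => n; rewrite cintegral_sum.
Qed.

End ComplexIntegral.

(** * The fundamental theorem of calculus for everywhere differentiable
    functions with integrable derivative *)

Section FundamentalTheorem.
Context {R : realType}.
Local Notation mu := (@lebesgue_measure R).
Local Notation RT := (measurableTypeR R).

(** Continuous induction: the supremum of the points up to which the inequality
    holds can be reached from the left and, if less than [b], passed to the
    right. *)
Lemma growth_le (Phi : R -> R) (x b : R) : x <= b ->
  (forall t, x <= t -> t < b -> exists2 d, 0 < d &
    forall s, t < s -> s < t + d -> Phi t <= Phi s) ->
  (forall s, x < s -> s <= b -> forall e, 0 < e -> exists2 d, 0 < d &
    forall t, s - d < t -> t < s -> Phi t <= Phi s + e) ->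
  Phi x <= Phi b.
Proof.
move=> xb right left; pose S := [set t | x <= t <= b /\ Phi x <= Phi t].
have Sx : S x by split => //; rewrite lexx.
have Sb : ubound S b by move=> t [/andP[]].
have hS : has_sup S by split; [exists x|exists b].
have xs : x <= sup S by apply: sup_upper_bound.
have sb : sup S <= b by apply: ge_sup => //; exists x.
have Ss : Phi x <= Phi (sup S).
  have [->//|xs'] := eqVneq x (sup S).
  have {}xs' : x < sup S by rewrite lt_neqAle xs' xs.
  apply/ler_addgt0Pr => e e0; have [d d0 hd] := left _ xs' sb e e0.
  have [t St st] := sup_adherent d0 hS.
  have ts : t <= sup S by apply: sup_upper_bound.
  case: St => _ /le_trans; apply; have [->|ts'] := eqVneq t (sup S).
    by rewrite lerDl ltW.
  by apply: hd => //; rewrite lt_neqAle ts' ts.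
have [sb'|sb'] := eqVneq (sup S) b; first by rewrite -sb'.
have {}sb' : sup S < b by rewrite lt_neqAle sb' sb.
have [d d0 hd] := right _ xs sb'.
pose t := Num.min (sup S + d / 2) ((sup S + b) / 2).
have st : sup S < t by rewrite /t lt_min; apply/andP; split; lra.
have td : t < sup S + d by rewrite /t gt_min; apply/orP; left; lra.
have tb : t <= b by rewrite /t ge_min; apply/orP; right; lra.
suff : t <= sup S by rewrite leNgt st.
apply: sup_upper_bound => //; split; first by rewrite tb (le_trans xs) // ltW.
by apply: le_trans Ss _; exact: hd.
Qed.

Let len (U : set RT) (a x : R) := fine (mu (U `&` `]a, x[)).

Lemma mu_fin (U : set RT) (a x : R) : measurable U -> mu (U `&` `]a, x[) \is a fin_num.
Proof.
move=> mU; apply/fin_numPlt/andP; split.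
  by apply: (@lt_le_trans _ _ 0%E); [exact: ltNy0|exact: measure_ge0].
apply: (@le_lt_trans _ _ (mu `]a, x[)).
  by apply: le_measure; rewrite ?inE //; exact: measurableI.
by rewrite lebesgue_measure_itv; case: ifP => _; rewrite ?ltry // -EFinD ltry.
Qed.

Lemma len_mono U (a x t : R) : measurable U -> x <= t -> len U a x <= len U a t.
Proof.
move=> mU xt; apply: fine_le; rewrite ?mu_fin //.
apply: le_measure; rewrite ?inE; [exact: measurableI|exact: measurableI|].
by apply: setIS; apply: subset_itvl; rewrite bnd_simp.
Qed.

Lemma len_ge U (a x t : R) : measurable U -> a <= x -> x < t ->
  `]x, t[ `<=` U -> t - x <= len U a t - len U a x.
Proof.
move=> mU ax xt xtU.
rewrite lerBrDl -lee_fin EFinD !fineK ?mu_fin //.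
have -> : (t - x)%:E = mu `]x, t[ by rewrite lebesgue_measure_itv /= lte_fin xt.
rewrite -measureU //; last 2 first.
- exact: measurableI.
- rewrite -subset0 => z [[_ /=]]; rewrite !in_itv /= => /andP[_ zx] /andP[xz _].
  by move: (lt_trans zx xz); rewrite ltxx.
apply: le_measure; rewrite ?inE.
- by apply: measurableU => //; exact: measurableI.
- exact: measurableI.
move=> z [[Uz]|xzt].
  by rewrite /= in_itv /= => /andP[az zx]; split => //=; rewrite in_itv /= az (lt_trans zx).
split; first exact: xtU.
by move: xzt; rewrite /= !in_itv /= => /andP[xz ->]; rewrite (le_lt_trans ax).
Qed.

Lemma integrable_cst_fin (D : set RT) (c : R) : measurable D -> (mu D < +oo)%E ->
  mu.-integrable D (EFin \o (fun=> c)).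
Proof.
move=> mD D0; apply/integrableP; split; first exact/measurable_EFinP/measurable_cst.
rewrite (_ : (fun x => _) = cst (`|c|%:E)) // integral_cst //.
by rewrite lte_mul_pinfty // lee_fin.
Qed.

Lemma mu_itv_fin (a b : R) : (mu `]a, b[ < +oo)%E.
Proof.
have : mu ([set: RT] `&` `]a, b[) \is a fin_num by exact: mu_fin.
by rewrite setTI => /fin_numPlt /andP[].
Qed.

Lemma layer_sum_le (e y : R) (N : nat) : 0 < e -> 0 <= y ->
  \sum_(n < N) e * ((n%:R * e <= y)%R)%:R <= y + e.
Proof.
move=> e0 y0; elim: N => [|N ih]; first by rewrite big_ord0 addr_ge0 // ltW.
rewrite big_ord_recr /=; case: (boolP (N%:R * e <= y)) => hN; last by rewrite mulr0 addr0.
rewrite mulr1 lerD2r; apply: le_trans hN.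
apply: (@le_trans _ _ (\sum_(n < N) e)); last by rewrite sumr_const card_ord mulr_natl.
by apply: ler_sum => i _; rewrite ler_piMr ?lern1 ?leq_b1 // ltW.
Qed.

(** The upper half of the theorem, for a nonnegative bound [h] of the
    derivative.  The level sets [h >= n e] are covered by open sets [U n] of
    almost the same measure; the counting function of the [U n], times [e], is a
    lower semicontinuous majorant of [h] whose indefinite integral [I] grows
    faster than [F] to the right of every point. *)
Lemma increment_le_ge0 (a b : R) (F f h : R -> R) : a < b ->
  {within `[a, b], continuous F} ->
  (forall x, a < x -> x < b -> is_derive x 1 F (f x)) ->
  (forall x, a < x -> x < b -> f x <= h x) ->
  (forall x, 0 <= h x) ->
  mu.-integrable `]a, b[ (EFin \o h) ->
  F b - F a <= \int[mu]_(x in `]a, b[) h x.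
Proof.
move=> ab cF dF fh h0 ih.
have [cFab cFa cFb] : [/\ {in `]a, b[, continuous F}, F @ a^'+ --> F a & F @ b^'- --> F b].
  by apply/continuous_within_itvP.
set H := \int[mu]_(x in `]a, b[) h x.
suff key e : 0 < e -> F b - F a <= H + e * (b - a) + e * 2 + e * (b - a).
  apply/ler_addgt0Pr => d d0.
  have q0 : 0 < 2 * (b - a) + 2 by rewrite addr_gt0 // mulr_gt0 // subr_gt0.
  apply: le_trans (key (d / (2 * (b - a) + 2)) _) _; first by rewrite divr_gt0.
  by rewrite le_eqVlt; apply/orP; left; apply/eqP; field; rewrite gt_eqF.
move=> e0.
have mh : measurable_fun (`]a, b[ : set RT) h by apply/measurable_EFinP; exact: (measurable_int mu).
pose A (n : nat) : set RT := `]a, b[ `&` [set x | n%:R * e <= h x].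
have mA n : measurable (A n).
  have := @measurable_fun_ler _ RT R `]a, b[ (cst (n%:R * e)) h (@measurable_cst _ _ RT R _ _) mh.
  by move=> /(_ (measurable_itv _) [set true]); apply.
have finA n : (mu (A n) < +oo)%E.
  apply: le_lt_trans (mu_itv_fin a b).
  by apply: le_measure; rewrite ?inE // => x [].
have /choice[U hU] : forall n, exists U : set R,
    [/\ open U, A n `<=` U & (mu (U `\` A n) < (2^-1 ^+ n)%:E)%E].
  by move=> n; apply: lebesgue_regularity_outer; [exact: mA|exact: finA|rewrite exprn_gt0].
have oU n : open (U n) by case: (hU n).
have AU n : A n `<=` U n by case: (hU n).
have mU n : measurable (U n : set RT) by exact: open_measurable.
have lenU n : len (U n) a b <= fine (mu (A n)) + 2^-1 ^+ n.
  have fA : mu (A n) \is a fin_num by rewrite ge0_fin_numE.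
  rewrite -lee_fin EFinD !fineK ?mu_fin //.
  apply: (@le_trans _ _ (mu (A n `|` (U n `\` A n)))).
    apply: le_measure; rewrite ?inE.
    - exact: measurableI.
    - by apply: measurableU => //; exact: measurableD.
    - by move=> x [Ux _]; case: (pselect (A n x)) => Ax; [left|right].
  apply: (le_trans (measureU2 _ (mA n) (measurableD (mU n) (mA n)))).
  by rewrite leeD2l //; apply: ltW; case: (hU n).
have sumA N : \sum_(n < N) e * fine (mu (A n)) <= H + e * (b - a).
  have iA n : mu.-integrable `]a, b[ (EFin \o (\1_(A n) : R -> R)).
    apply: (@real_dom _ _ (measurable_itv _) _ (fun=> 1)).
    - exact: measurable_indic.
    - exact: integrable_cst_fin (measurable_itv _) (mu_itv_fin a b).
    - by move=> x _; rewrite indicE ger0_norm // lern1 leq_b1.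
  have IA n : \int[mu]_(x in `]a, b[) (\1_(A n) x) = fine (mu (A n)).
    by rewrite /Rintegral integral_indic // setIidl // => x [].
  have isum M : mu.-integrable `]a, b[ (EFin \o (fun x => \sum_(n < M) e * \1_(A n) x)) /\
      \int[mu]_(x in `]a, b[) (\sum_(n < M) e * \1_(A n) x) =
      \sum_(n < M) e * fine (mu (A n)).
    elim: M => [|M [ih1 ih2]].
      have -> : (fun x : R => \sum_(n < 0) e * \1_(A n) x) = (fun=> 0).
        by apply/funext => x; rewrite big_ord0.
      by rewrite big_ord0 /Rintegral integral0; split => //; exact: integrable0.
    have iM := rintegrableZ (measurable_itv `]a, b[) e (iA M).
    have -> : (fun x : R => \sum_(n < M.+1) e * \1_(A n) x) =
        (fun x => \sum_(n < M) e * \1_(A n) x + e * \1_(A M) x).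
      by apply/funext => x; rewrite big_ord_recr.
    split; first exact: rintegrableD.
    by rewrite RintegralD // ih2 big_ord_recr /= RintegralZl // IA.
  have [i1 i2] := isum N.
  have ic := integrable_cst_fin e (measurable_itv `]a, b[) (mu_itv_fin a b).
  have <- : \int[mu]_(x in `]a, b[) (h x + e) = H + e * (b - a).
    rewrite RintegralD // Rintegral_cst //.
    congr (_ + _ * _); transitivity (fine (mu `]a, b[)); first by [].
    by rewrite lebesgue_measure_itv /= lte_fin ab.
  rewrite -i2; apply: le_Rintegral => //; first exact: rintegrableD.
  move=> x xab; apply: le_trans (layer_sum_le N e0 (h0 x)).
  apply: ler_sum => n _; rewrite indicE ler_pM2l //.
  by case: (boolP (x \in A n)) => //; rewrite inE => -[_ /= ->].
have g0 : 0 <= e * 2 by rewrite mulr_ge0 // ltW.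
have S_ub N x : x <= b -> e * \sum_(n < N) len (U n) a x <= H + e * (b - a) + e * 2.
  move=> xb; apply: (@le_trans _ _ (\sum_(n < N) (e * fine (mu (A n)) + e * 2^-1 ^+ n))).
    rewrite mulr_sumr; apply: ler_sum => n _; rewrite -mulrDr ler_pM2l //.
    by apply: le_trans (lenU n); exact: len_mono.
  rewrite big_split /=; apply: lerD (sumA N) _; rewrite -mulr_sumr ler_pM2l //.
  have := @geom_sum_le R 2^-1 N; rewrite invr_ge0 ler0n => /(_ isT).
  have -> : (1 - 2^-1)^-1 = 2 :> R by field.
  by apply; rewrite invf_lt1 // ltr1n.
pose I x := limn (fun N => e * \sum_(n < N) len (U n) a x).
have Icvg x : x <= b -> cvgn (fun N => e * \sum_(n < N) len (U n) a x).
  move=> xb; apply: nondecreasing_is_cvgn.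
    apply/nondecreasing_seqP => N; rewrite big_ord_recr /= ler_pM2l // lerDl.
    by rewrite fine_ge0.
  by exists (H + e * (b - a) + e * 2) => _ [N _ <-]; exact: S_ub.
have Ige0 x : x <= b -> 0 <= I x.
  move=> xb; apply: limr_ge; first exact: Icvg.
  by apply: nearW => N; rewrite mulr_ge0 ?(ltW e0) // sumr_ge0 // => n _; rewrite fine_ge0.
have Iub x : x <= b -> I x <= H + e * (b - a) + e * 2.
  move=> xb; apply: limr_le; first exact: Icvg.
  by apply: nearW => N; exact: S_ub.
have Idiff x t N : x <= t -> t <= b ->
    e * \sum_(n < N) (len (U n) a t - len (U n) a x) <= I t - I x.
  move=> xt tb; have xb := le_trans xt tb.
  have c : (fun M => e * \sum_(n < M) len (U n) a t - e * \sum_(n < M) len (U n) a x)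
      @ \oo --> I t - I x by apply: cvgB; [exact: Icvg|exact: Icvg].
  apply: (cvgr_to_ge c); exists N => // M /= NM.
  rewrite -mulrBr -sumrB ler_pM2l //.
  rewrite -!(big_mkord predT (fun n => len (U n) a t - len (U n) a x)).
  rewrite (big_cat_nat _ NM) //= lerDl sumr_ge0 // => n _.
  by rewrite subr_ge0; exact: len_mono.
pose Phi x := I x + e * x - F x.
have step x0 : a < x0 -> x0 < b -> Phi x0 <= Phi b.
  move=> ax0 x0b; apply: growth_le => [|t x0t tb|s x0s sb d d0]; first exact: ltW.
  - have at_ : a < t by exact: lt_le_trans x0t.
    pose N := (Num.truncn (h t / e)).+1.
    have hN : h t < N%:R * e.
      by rewrite -ltr_pdivrMr //; exact: truncnS_gt.
    have UN n : (n < N)%N -> U n t.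
      move=> nN; apply: AU; split; first by rewrite /= in_itv /= at_.
      rewrite /= -ler_pdivlMr //; apply: (@le_trans _ _ (Num.truncn (h t / e))%:R).
        by rewrite ler_nat -ltnS.
      by rewrite truncn_le // divr_ge0 // ltW.
    have [d1 d10 hd1] : exists2 d, 0 < d & forall n, (n < N)%N -> forall s,
        `|s - t| < d -> U n s.
      elim: N UN {hN} => [|N IH] UN; first by exists 1.
      have [d d0 hd] := IH (fun n nN => UN n (ltnW nN)).
      have := oU N; rewrite openE => /(_ t (UN N (ltnSn N))) [d' /= d'0 hd'].
      exists (Num.min d d'); first by rewrite lt_min d0.
      move=> n; rewrite ltnS leq_eqVlt => /orP[/eqP ->|nN] s; rewrite lt_min => /andP[sd sd'].
        by apply: hd'; rewrite /= distrC.
      exact: hd.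
    have dFt := dF t at_ tb.
    have [d2 d20 hd2] : exists2 d, 0 < d & forall s, t < s -> s < t + d ->
        F s - F t <= (f t + e) * (s - t).
      have [dv dE] := dFt.
      have {dv dE} : (fun r => r^-1 *: ((F \o shift t) (r *: 1) - F t)) @ 0^' --> f t.
        by rewrite -dE.
      move=> /cvgrPdist_lt /(_ _ e0) [d /= d0 hd]; exists d => // s ts std.
      have r0 : 0 < s - t by rewrite subr_gt0.
      have := hd (s - t); rewrite /= sub0r normrN gtr0_norm // ltrBlDl.
      move=> /(_ std) /(_ (lt0r_neq0 r0)).
      rewrite /GRing.scale /= mulr1 subrK distrC => /ltr_distlDr.
      by rewrite mulrC ltr_pdivrMr // => /ltW.
    exists (Num.min (Num.min d1 d2) (b - t)); first by rewrite !lt_min d10 d20 subr_gt0.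
    move=> s ts; rewrite -ltrBlDl !lt_min => /andP[/andP[s1 s2] sb].
    have st0 : 0 < s - t by rewrite subr_gt0.
    have := hd2 s ts; rewrite -ltrBlDl => /(_ s2) h1.
    have sb' : s <= b by rewrite ltrD2r in sb; exact: ltW.
    have h2 := Idiff t s N (ltW ts) sb'.
    have h3 : e * (N%:R * (s - t)) <= e * \sum_(n < N) (len (U n) a s - len (U n) a t).
      rewrite ler_pM2l // mulr_natl -[X in _ *+ X]card_ord -sumr_const.
      apply: ler_sum => n _; apply: (len_ge (mU n) (ltW at_) ts).
      move=> z /=; rewrite in_itv /= => /andP[tz zs]; apply: (hd1 n) => //.
      rewrite gtr0_norm ?subr_gt0 //; apply: lt_trans s1; lra.
    have h4 : f t * (s - t) <= e * (N%:R * (s - t)).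
      rewrite mulrA ler_pM2r // (le_trans (fh t at_ tb)) // mulrC ltW //.
    rewrite /Phi; lra.
  - have as_ : a < s by exact: lt_trans x0s.
    have cFs : F @ s^'- --> F s.
      have [->|sb'] := eqVneq s b; first by [].
      apply: cvg_at_left_filter; apply: cFab.
      by rewrite in_itv /= as_ lt_neqAle sb' sb.
    have d20 : 0 < d / 2 by rewrite divr_gt0.
    move/cvgrPdist_lt : cFs => /(_ _ d20) [d1 /= d10 hd1].
    exists (Num.min d1 (s - x0)); first by rewrite lt_min d10 subr_gt0.
    move=> t; rewrite ltrBlDr -ltrBlDl lt_min => /andP[t1 t2] ts.
    have tx0 : x0 < t by rewrite ltrD2l ltrN2 in t2.
    have := hd1 t; rewrite /= gtr0_norm ?subr_gt0 // => /(_ t1 ts).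
    rewrite ltr_norml => /andP[h1 h2].
    have := Idiff t s 0%N (ltW ts) sb; rewrite big_ord0 mulr0 => h3.
    have h4 : e * t <= e * s by rewrite ler_pM2l // ltW.
    rewrite /Phi; lra.
have Iba x0 : a < x0 -> x0 < b -> F b - F x0 <= H + e * (b - a) + e * 2 + e * (b - a).
  move=> ax0 x0b; have := step x0 ax0 x0b; rewrite /Phi.
  have := Ige0 x0 (ltW x0b); have := Iub b (lexx b).
  have : e * (b - x0) <= e * (b - a) by rewrite ler_pM2l // lerD2l lerN2 ltW.
  rewrite !mulrBr; lra.
have c : (F b - F x) @[x --> a^'+] --> F b - F a by apply: cvgB => //; exact: cvg_cst.
apply: (cvgr_to_le c); near=> x; apply: Iba; near: x.
  exact: nbhs_right_gt.
exact: nbhs_right_lt.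
Unshelve. all: by end_near. Qed.

(** Truncating [f] below at [- N] and adding [N x] to [F] reduces the claim to a
    nonnegative bound; dominated convergence removes the truncation. *)
Lemma increment_le (a b : R) (F f : R -> R) : a < b ->
  {within `[a, b], continuous F} ->
  (forall x, a < x -> x < b -> is_derive x 1 F (f x)) ->
  mu.-integrable `]a, b[ (EFin \o f) ->
  F b - F a <= \int[mu]_(x in `]a, b[) f x.
Proof.
move=> ab cF dF if_.
have mD : measurable (`]a, b[ : set RT) by exact: measurable_itv.
have mf : measurable_fun (`]a, b[ : set RT) f.
  by apply/measurable_EFinP; exact: (measurable_int mu).
pose g (N : nat) x := Num.max (f x) (- N%:R).
have mg N : measurable_fun (`]a, b[ : set RT) (g N).
  by apply: measurable_maxr => //; exact: measurable_cst.
have gf N x : `|g N x| <= `|f x|.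
  rewrite /g; have [h|h] := leP (f x) (- N%:R); last by [].
  rewrite normrN ger0_norm // -(opprK N%:R) -normrN.
  by apply: le_trans (ler_norm _); rewrite lerN2.
have ig N : mu.-integrable `]a, b[ (EFin \o g N).
  apply: (@real_dom _ _ mD _ (fun x => `|f x|)) => //; exact: integrable_norm if_.
have key N : F b - F a <= \int[mu]_(x in `]a, b[) g N x.
  have ic := integrable_cst_fin (N%:R) mD (mu_itv_fin a b).
  have := @increment_le_ge0 a b (fun x => F x + N%:R * x) (fun x => f x + N%:R)
    (fun x => g N x + N%:R) ab.
  have cstE : \int[mu]_(x in `]a, b[) N%:R = N%:R * (b - a).
    rewrite Rintegral_cst //; congr (_ * _).
    transitivity (fine (mu (`]a, b[ : set RT))); first by [].
    by rewrite lebesgue_measure_itv /= lte_fin ab.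
  rewrite RintegralD // cstE.
  have -> : F b + N%:R * b - (F a + N%:R * a) = F b - F a + N%:R * (b - a) by ring.
  rewrite lerD2r; apply.
  - move=> x; apply: continuousD; first exact: cF.
    by apply: continuous_subspaceT => y; apply: cvgM; [exact: cvg_cst|exact: cvg_id].
  - move=> x ax xb; have h := is_deriveD (dF x ax xb) (is_deriveZ N%:R (is_derive_id x 1)).
    by apply: (is_derive_eq h); rewrite /GRing.scale /= mulr1.
  - by move=> x _ _; rewrite lerD2r /g le_max lexx.
  - by move=> x; rewrite -lerBlDr sub0r /g le_max lexx orbT.
  - exact: rintegrableD.
have c : (fun N => \int[mu]_(x in `]a, b[) g N x) @ \oo --> \int[mu]_(x in `]a, b[) f x.
  apply: (@real_dominated _ _ mD g f (fun x => `|f x|)) => //; last exact: integrable_norm if_.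
  move=> x _; apply: cvg_near_cst; exists (Num.truncn `|f x|).+1 => // N /= hN.
  apply/eqP; rewrite /g eq_sym; apply/eqP/esym/max_idPl.
  rewrite lerNl; apply: le_trans (ler_norm _) _; rewrite normrN ltW //.
  by apply: lt_le_trans (truncnS_gt _) _; rewrite ler_nat.
by apply: (cvgr_to_ge c); exact: nearW.
Qed.

Lemma everywhere_FTC (a b : R) (F f : R -> R) : a < b ->
  {within `[a, b], continuous F} ->
  (forall x, a < x -> x < b -> is_derive x 1 F (f x)) ->
  mu.-integrable `]a, b[ (EFin \o f) ->
  \int[mu]_(x in `]a, b[) f x = F b - F a.
Proof.
move=> ab cF dF if_; apply/eqP; rewrite eq_le increment_le // andbT.
have := @increment_le a b (fun x => - F x) (fun x => - f x) ab.
have -> : \int[mu]_(x in `]a, b[) (- f x) = - \int[mu]_(x in `]a, b[) f x.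
  rewrite -mulN1r -RintegralZl //.
  by apply: eq_Rintegral => x _; rewrite mulN1r.
rewrite -opprB lerN2 opprK addrC; apply.
- by move=> x; apply: continuousN; exact: cF.
- by move=> x ax xb; exact: is_deriveN (dF x ax xb).
- have := @rintegrableZ _ _ (measurable_itv `]a, b[) (-1) f if_.
  by apply: eq_integrable => // x _; rewrite /= mulN1r.
Qed.

(** Redefining [g] at [0] by its limit makes both components continuous on the
    closed interval. *)
Lemma complex_FTC0 (b : R) (g g' : R -> R[i]) (l : R[i]) : 0 < b ->
  (forall t : R, 0 < t -> cder g t (g' t)) ->
  Re (g t) @[t --> 0^'+] --> Re l -> Im (g t) @[t --> 0^'+] --> Im l ->
  cintegrable `]0, b[ g' -> cintegral `]0, b[ g' = g b - l.
Proof.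
move=> b0 dg rl il [ir ii].
have aux (F f : R -> R) (v : R) : (forall t : R, 0 < t -> is_derive t 1 F (f t)) ->
    F t @[t --> 0^'+] --> v -> mu.-integrable `]0, b[ (EFin \o f) ->
    \int[mu]_(x in `]0, b[) f x = F b - v.
  move=> dF Fv if_; pose F0 (t : R) := if t <= 0 then v else F t.
  have F0E (t : R) : 0 < t -> F0 t = F t by rewrite /F0 leNgt => ->.
  have nearE (t : R) : 0 < t -> \near t, F t = F0 t.
    move=> t0; have : \forall s \near t, 0 < s by exact: lt_nbhsr.
    by apply: filterS => s /F0E.
  have dF0 (t : R) : 0 < t -> is_derive t 1 F0 (f t).
    by move=> t0; apply: near_eq_is_derive (nearE t t0) (dF t t0).
  have c0 (t : R) : 0 < t -> {for t, continuous F0}.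
    move=> /dF0 [d _]; apply: differentiable_continuous; exact/derivable1_diffP.
  have -> : F b - v = F0 b - F0 0 by rewrite F0E // /F0 lexx.
  apply: everywhere_FTC => // [|t t0 _]; last exact: dF0.
  apply/(continuous_within_itvP _ b0); split.
  - by move=> t; rewrite in_itv /= => /andP[t0 _]; exact: c0.
  - rewrite {2}/F0 lexx; apply: cvg_trans Fv; apply: near_eq_cvg.
    near=> t; rewrite F0E //; near: t; exact: nbhs_right_gt.
  - by apply: cvg_at_left_filter; exact: c0.
apply: cplxP; rewrite /cintegral ?ReI ?ImI ?ReB ?ImB.
  by apply: (aux (fun t => Re (g t)) (fun t => Re (g' t))) => // t /dg [].
by apply: (aux (fun t => Im (g t)) (fun t => Im (g' t))) => // t /dg [].
Unshelve. all: by end_near. Qed.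

End FundamentalTheorem.

(** * Convolution *)

Section Convolution.
Context {R : realType}.
Local Notation mu := (@lebesgue_measure R).
Local Notation RT := (measurableTypeR R).

Lemma measurable_translate (t : R) :
  measurable_fun [set: RT] ((fun x : RT => x - t) : RT -> RT).
Proof.
exact: (@measurable_funB _ RT R setT (fun x => x) (cst t) (@measurable_id _ _ _)
  (@measurable_cst _ _ _ _ _ _)).
Qed.

Lemma lebesgue_translate (t : R) (A : set RT) : measurable A ->
  pushforward mu ((fun x : RT => x - t) : RT -> RT) A = mu A.
Proof.
move=> mA; apply/esym/lebesgue_measure_unique => //=.
  exact: measurable_translate.
move=> mt _ [[a b]] _ <-.
rewrite /pushforward.
have -> : (fun x : RT => x - t) @^-1` `]a, b]%classic = `]a + t, b + t]%classic.
  by apply/seteqP; split => x /=; rewrite !in_itv /= ltrBrDr lerBlDr.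
by rewrite !lebesgue_measure_itv /= !lte_fin ltrD2r -!EFinD; case: ifP => // _;
  congr EFin; ring.
Qed.

Lemma ge0_integral_translate (f : RT -> \bar R) (t : R) : measurable_fun setT f ->
  (forall x, 0 <= f x)%E ->
  (\int[mu]_x f (x - t)%R = \int[mu]_x f x)%E.
Proof.
move=> mf f0; have mt := measurable_translate t.
transitivity (\int[pushforward mu ((fun x : RT => x - t)%R : RT -> RT)]_x f x)%E.
  by rewrite ge0_integral_pushforward // preimage_setT.
by apply: eq_measure_integral => //= A mA _; exact: lebesgue_translate.
Qed.

Lemma integrable_translate (f : R -> R) (t : R) : mu.-integrable setT (EFin \o f) ->
  mu.-integrable setT (EFin \o (fun x => f (x - t))).
Proof.
move=> if_; have mf := measurable_int mu if_; have /integrableP[_ fy] := if_.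
have mft : measurable_fun [set: RT] (fun x : RT => (EFin \o f) (x - t)).
  exact: (measurableT_comp mf (measurable_translate t)).
apply/integrableP; split; first exact: mft.
rewrite (ge0_integral_translate (f := fun x => `|(EFin \o f) x|%E)) //.
exact: measurableT_comp.
Qed.

Lemma Rintegral_translate (f : R -> R) (t : R) : mu.-integrable setT (EFin \o f) ->
  \int[mu]_x f (x - t) = \int[mu]_x f x.
Proof.
move=> if_; rewrite /Rintegral; congr fine.
have mf := measurable_int mu if_; have ift := integrable_translate t if_.
rewrite integralE [RHS]integralE; congr (_ - _)%E.
  rewrite -(ge0_integral_translate t (f := (EFin \o f)^\+%E)) //.
    by apply: eq_integral => x _; rewrite !funeposE.
  exact: measurable_funepos.
rewrite -(ge0_integral_translate t (f := (EFin \o f)^\-%E)) //.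
  by apply: eq_integral => x _; rewrite !funenegE.
exact: measurable_funeneg.
Qed.

(** The inner integrals in Fubini's theorem are finite only almost everywhere;
    [fine] changes them on a null set. *)
Lemma Rintegral_ae_fine (F : RT -> \bar R) : mu.-integrable setT F ->
  mu.-integrable setT (EFin \o (fun x => fine (F x))) /\
  \int[mu]_x fine (F x) = fine (\int[mu]_x F x).
Proof.
move=> iF; have mF := measurable_int mu iF.
have mfF : measurable_fun setT (EFin \o (fun x => fine (F x))).
  apply/measurable_EFinP; exact: (measurableT_comp (@fine_measurable R setT measurableT) mF).
split.
  apply: le_integrable iF => // x _ /=.
  by case: (F x) => [r| |] //=; rewrite ?leey // normr0.
congr fine; apply: ae_eq_integral => //.
have := integrable_ae measurableT iF; apply: filterS => x /= /(_ I) Fx _.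
by rewrite fineK.
Qed.

Lemma Fubini_real (r : RT * RT -> R) :
  (mu \x mu)%E.-integrable setT (EFin \o r) ->
  (forall t, mu.-integrable setT (EFin \o (fun x => r (x, t)))) ->
  mu.-integrable setT (EFin \o (fun x => \int[mu]_t r (x, t))) /\
  \int[mu]_x \int[mu]_t r (x, t) = \int[mu]_t \int[mu]_x r (x, t).
Proof.
move=> ir irt; have [i1 e1] := Rintegral_ae_fine (integrable_fubini_F ir).
split => //; rewrite -/(fubini_F _ _) in e1 *; rewrite e1.
rewrite [in RHS]/Rintegral; congr fine.
rewrite (Fubini ir); apply: eq_integral => t _.
by rewrite /Rintegral fineK //; exact: integrable_fin_num (irt t).
Qed.

Lemma cintegrable_translate (p : R -> R[i]) t : cintegrable setT p ->
  cintegrable setT (fun x => p (x - t)) /\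
  cintegral setT (fun x => p (x - t)) = cintegral setT p.
Proof.
move=> [p1 p2]; split.
  by split; [exact: (integrable_translate t p1)|exact: (integrable_translate t p2)].
by apply: cplxP; rewrite /cintegral ?ReI ?ImI;
  [exact: (Rintegral_translate t p1)|exact: (Rintegral_translate t p2)].
Qed.

(** For the moduli the inner integral over [x] is, by translation invariance, a
    constant times [cabs (q t)]; this makes the integrand integrable on the plane
    and allows the exchange of the integrals. *)
Lemma cconvolution (p q : R -> R[i]) : cintegrable setT p -> cintegrable setT q ->
  let c x := cintegral setT (fun t => p (x - t) * q t) in
  cintegrable setT c /\ cintegral setT c = cintegral setT p * cintegral setT q.
Proof.
move=> ip iq c; have mT : measurable (setT : set RT) by exact: measurableT.
pose K (z : RT * RT) := p (z.1 - z.2) * q z.2.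
have [pm1 pm2] := cintegrable_cmeas ip; have [qm1 qm2] := cintegrable_cmeas iq.
have m12 : measurable_fun [set: RT * RT] ((fun z => z.1 - z.2) : RT * RT -> RT).
  exact: (@measurable_funB _ (RT * RT)%type R setT fst snd measurable_fst measurable_snd).
have mK : cmeas setT K.
  apply: cmeasM; first by split; [exact: (measurableT_comp pm1 m12)|exact: (measurableT_comp pm2 m12)].
  by split; [exact: (measurableT_comp qm1 measurable_snd)|exact: (measurableT_comp qm2 measurable_snd)].
pose A (z : RT * RT) := cabs (p (z.1 - z.2)) * cabs (q z.2).
have ap := cintegrable_abs mT ip; have aq := cintegrable_abs mT iq.
have mA : measurable_fun setT A.
  have := measurable_cabs mK; under eq_fun do rewrite cabsM; exact.
have iA : (mu \x mu)%E.-integrable setT (EFin \o A).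
  apply/(integrable21ltyP mu mu); first exact/measurable_EFinP.
  have Pfin := integrable_fin_num mT ap.
  have inner t : (\int[mu]_x `|(EFin \o A) (x, t)| = (\int[mu]_x (cabs (p x))%:E) * (cabs (q t))%:E)%E.
    rewrite -(ge0_integral_translate t (f := fun x => (cabs (p x))%:E)).
    - rewrite -ge0_integralZr //=.
      + by apply: eq_integral => x _; rewrite /A ger0_norm ?mulr_ge0 ?cabs_ge0.
      + exact: (measurable_int mu (integrable_translate t ap)).
      + by move=> x _; rewrite lee_fin cabs_ge0.
      + by rewrite lee_fin cabs_ge0.
    - exact: (measurable_int mu ap).
    - by move=> x; rewrite lee_fin cabs_ge0.
  under eq_integral do rewrite inner.
  rewrite ge0_integralZl //=; last 3 first.
  - exact: (measurable_int mu aq).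
  - by move=> x _; rewrite lee_fin cabs_ge0.
  - by apply: integral_ge0 => x _; rewrite lee_fin cabs_ge0.
  have Qfin := integrable_fin_num mT aq.
  rewrite -(fineK Pfin) -(fineK Qfin) -EFinM ltry //.
have irK (r : RT * RT -> R) : measurable_fun setT r -> (forall z, `|r z| <= cabs (K z)) ->
    (mu \x mu)%E.-integrable setT (EFin \o r).
  move=> mr rK; apply: le_integrable iA => //; first exact/measurable_EFinP.
  move=> z _; rewrite /= lee_fin; apply: le_trans (rK z) _.
  by rewrite /K cabsM ger0_norm // mulr_ge0 ?cabs_ge0.
have iKt t : cintegrable setT (fun x => K (x, t)).
  have [h _] := cintegrable_translate t ip.
  apply: (eq_cintegrable mT) (cintegrableZ mT (q t) h) => x _.
  by rewrite /K mulrC.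
have eKt t : cintegral setT (fun x => K (x, t)) = cintegral setT p * q t.
  have [h1 h2] := cintegrable_translate t ip.
  rewrite mulrC -h2 -(cintegralZ mT) //; apply: eq_cintegral => x _.
  by rewrite /K mulrC.
have [i1 e1] := Fubini_real (irK _ (proj1 mK) (fun z => cabs_Re (K z))) (fun t => proj1 (iKt t)).
have [i2 e2] := Fubini_real (irK _ (proj2 mK) (fun z => cabs_Im (K z))) (fun t => proj2 (iKt t)).
split; first by split.
rewrite -(cintegralZ mT) //.
transitivity (cintegral setT (fun t => cintegral setT (fun x => K (x, t)))).
  by apply: cplxP.
by apply: eq_cintegral => t _; rewrite eKt.
Qed.

Lemma cintegral_mkcond (D : set RT) (g h : R -> R[i]) : measurable D ->
  (forall x, D x -> h x = g x) -> (forall x, ~ D x -> h x = 0) ->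
  (cintegrable D g <-> cintegrable setT h) /\ cintegral D g = cintegral setT h.
Proof.
move=> mD hg h0.
have eR : (fun x => Re (h x)) = (fun x => Re (g x)) \_ D.
  apply/funext => x; rewrite patchE; case: ifPn => xD.
    by rewrite hg //; exact: set_mem.
  by rewrite h0 // => Dx; move: xD; rewrite mem_set.
have eI : (fun x => Im (h x)) = (fun x => Im (g x)) \_ D.
  apply/funext => x; rewrite patchE; case: ifPn => xD.
    by rewrite hg //; exact: set_mem.
  by rewrite h0 // => Dx; move: xD; rewrite mem_set.
split; last by apply: cplxP; rewrite /cintegral ?ReI ?ImI ?eR ?eI -Rintegral_mkcond.
rewrite /cintegrable eR eI -!restrict_EFin.
by split=> -[h1 h2]; split; apply/(integrable_mkcond _ mD).
Qed.

(** Since the exponential is multiplicative, weighting by [exp (- w x)] and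
    extending by [0] commute with convolution, and [cconvolution] applies. *)
Lemma laplace_convolution (phi f g : R -> R[i]) (w : R[i]) :
  laplace_exists phi w -> laplace_exists f w ->
  (forall x : R, 0 < x -> cintegrable `]0, x[ (fun t => phi (x - t) * f t)) ->
  (forall x : R, 0 < x -> g x = cintegral `]0, x[ (fun t => phi (x - t) * f t)) ->
  laplace_exists g w /\ laplace g w = laplace phi w * laplace f w.
Proof.
move=> iphi if_ ipf gE.
pose ext (h : R -> R[i]) (x : R) : R[i] := if 0 < x then cexp (- (w * x%:C)) * h x else 0.
have mD : measurable (`]0, +oo[ : set RT) by exact: measurable_itv.
have extE h := @cintegral_mkcond `]0, +oo[ (fun t => cexp (- (w * t%:C)) * h t) (ext h) mD.
have ext1 (h : R -> R[i]) (x : RT) : (`]0, +oo[%classic : set RT) x -> ext h x = cexp (- (w * x%:C)) * h x.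
  by rewrite /= in_itv /= andbT /ext => ->.
have ext0 (h : R -> R[i]) (x : RT) : ~ (`]0, +oo[%classic : set RT) x -> ext h x = 0.
  by rewrite /= in_itv /= andbT /ext => /negP/negbTE ->.
have [p1 p2] := extE phi (ext1 phi) (ext0 phi).
have [f1 f2] := extE f (ext1 f) (ext0 f).
have [g1 g2] := extE g (ext1 g) (ext0 g).
have [c1 c2] := cconvolution (p1.1 iphi) (f1.1 if_).
have cE : (fun x => cintegral setT (fun t => ext phi (x - t) * ext f t)) = ext g.
  apply/funext => x; rewrite /ext; case: ifPn => x0; last first.
    rewrite -[RHS](@cintegral_cst0 R setT); apply: eq_cintegral => t _.
    rewrite subr_gt0; case: ifP => tx; rewrite ?mul0r //; case: ifP => t0; rewrite ?mulr0 //.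
    by rewrite (lt_trans t0 tx) in x0.
  rewrite (gE x x0) -(cintegralZ (measurable_itv _)); last exact: ipf.
  apply/esym; apply: (@cintegral_mkcond `]0, x[ _ _ (measurable_itv _) _ _).2 => t.
    rewrite /= in_itv /= => /andP[t0 tx]; rewrite subr_gt0 tx t0.
    have -> : cexp (- (w * x%:C)) = cexp (- (w * (x - t)%:C)) * cexp (- (w * t%:C)).
      by rewrite -cexpD; congr cexp; rewrite rmorphB /=; ring.
    ring.
  rewrite /= in_itv /= subr_gt0; case: (t < x); last by rewrite mul0r.
  by case: (0 < t); rewrite ?mulr0 // => /(_ isT).
rewrite cE in c1 c2.
by split; [exact/g1|rewrite /laplace g2 c2 p2 f2].
Qed.

End Convolution.

(** * Integrals over the half-line *)

Section HalfLine.
Context {R : realType}.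
Local Notation mu := (@lebesgue_measure R).
Local Notation RT := (measurableTypeR R).

Definition pos : set RT := `]0, +oo[%classic.

Lemma measurable_pos : measurable pos. Proof. exact: measurable_itv. Qed.

Lemma posP (x : R) : pos x <-> 0 < x.
Proof. by rewrite /pos /= in_itv /= andbT. Qed.

Lemma measurable_pos_cont (g : R -> R) : (forall s : R, 0 < s -> {for s, continuous g}) ->
  measurable_fun pos g.
Proof.
move=> cg; apply: open_continuous_measurable_fun; first exact: interval_open.
by move=> x; rewrite inE => /posP; exact: cg.
Qed.

(** The intervals are arbitrary because a change of variables maps one
    exhaustion of the half-line to another. *)
Lemma ge0_exhaust (u v : nat -> R) (g : R -> R) :
  measurable_fun pos g -> (forall s : R, 0 < s -> 0 <= g s) ->
  (forall n, 0 < u n) -> (forall n, u n.+1 <= u n) -> (forall n, v n <= v n.+1) ->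
  (forall s : R, 0 < s -> exists n, u n <= s <= v n) ->
  (\int[mu]_(s in `[u n, v n]) (g s)%:E)%E @[n --> \oo] -->
    (\int[mu]_(s in `]0%R, +oo[) (g s)%:E)%E.
Proof.
move=> mg g0 u0 uS vS uv.
have sub n : `[u n, v n]%classic `<=` pos.
  by move=> s /=; rewrite in_itv /= => /andP[us _]; apply/posP; exact: lt_le_trans us.
have -> : (`]0%R, +oo[%classic : set R) = \bigcup_n `[u n, v n]%classic.
  apply/seteqP; split => [s /= |s [n _ /sub]] //.
  rewrite in_itv /= andbT => s0; have [n hn] := uv s s0.
  by exists n => //=; rewrite in_itv.
apply: (@ge0_nondecreasing_set_cvg_integral _ RT R (fun n => `[u n, v n]%classic)) => //.
- apply/nondecreasing_seqP => n; rewrite subsetEset => s /=; rewrite !in_itv /=.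
  by move=> /andP[us sv]; rewrite (le_trans (uS n)) // (le_trans sv).
- by move=> n; apply/measurable_EFinP; apply: measurable_funS mg => //; exact: measurable_pos.
- by move=> n s /sub /posP s0; rewrite lee_fin g0.
Qed.

Lemma std_exhaust (s : R) : 0 < s -> exists n, n.+1%:R^-1 <= s <= n.+1%:R.
Proof.
move=> s0; exists (maxn (Num.truncn s) (Num.truncn s^-1)); apply/andP; split.
  rewrite invf_ple ?posrE //; apply: ltW; apply: lt_le_trans (truncnS_gt _) _.
  by rewrite ler_nat ltnS leq_maxr.
apply: ltW; apply: lt_le_trans (truncnS_gt _) _.
by rewrite ler_nat ltnS leq_maxl.
Qed.

Lemma ge0_integrable_pos (g G : R -> R) (M : R) :
  (forall s : R, 0 < s -> is_derive s 1 G (g s)) ->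
  (forall s : R, 0 < s -> {for s, continuous g}) ->
  (forall s : R, 0 < s -> 0 <= g s) ->
  (forall s : R, 0 < s -> 0 <= G s <= M) ->
  mu.-integrable pos (EFin \o g).
Proof.
move=> dG cg g0 GM.
have mg := measurable_pos_cont cg.
apply/integrableP; split; first exact/measurable_EFinP.
have -> : (\int[mu]_(x in pos) `|(EFin \o g) x| = \int[mu]_(s in `]0%R, +oo[) (g s)%:E)%E.
  by apply: eq_integral => x; rewrite inE => /posP x0; rewrite /= ger0_norm // g0.
have ex := @ge0_exhaust (fun n => n.+1%:R^-1) (fun n => n.+1%:R) g mg g0.
apply: le_lt_trans (ltry M); apply: (cvge_to_le (ex _ _ _ std_exhaust)).
- by move=> n; rewrite invr_gt0.
- by move=> n; rewrite lef_pV2 ?posrE // ler_nat.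
- by move=> n; rewrite ler_nat.
apply: nearW => n.
have n0 : 0 < n.+1%:R^-1 :> R by rewrite invr_gt0.
have [nn|nn] := eqVneq (n.+1%:R^-1 : R) n.+1%:R.
  rewrite nn set_itv1 integral_set1 lee_fin.
  by have /andP[h1 h2] := GM 1 ltr01; exact: le_trans h2.
have lt_n : n.+1%:R^-1 < n.+1%:R :> R.
  by rewrite lt_neqAle nn /= (@le_trans _ _ 1) // ?invf_le1 // ler1n.
have cG (s : R) : 0 < s -> {for s, continuous G}.
  by move=> /dG [d _]; apply: differentiable_continuous; exact/derivable1_diffP.
rewrite (@continuous_FTC2 _ g G) //.
- rewrite -EFinB lee_fin.
  have /andP[_ h1] := GM n.+1%:R (lt_trans n0 lt_n).
  by have /andP[h2 _] := GM _ n0; lra.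
- apply: continuous_in_subspaceT => s; rewrite inE /= in_itv /= => /andP[ns _].
  by apply: cg; exact: lt_le_trans ns.
- split.
  + by move=> s; rewrite in_itv /= => /andP[ns _]; have [] := dG s (lt_trans n0 ns).
  + by apply: cvg_at_right_filter; exact: cG.
  + by apply: cvg_at_left_filter; apply: cG; exact: lt_trans lt_n.
- move=> s; rewrite in_itv /= => /andP[ns _]; rewrite derive1E.
  by have [_ ->] := dG s (lt_trans n0 ns).
Qed.

(** The Gamma density, as a derivative: [s ^ (x - 1) e ^ (- sigma s)] is below a
    multiple of the derivative of [(s / (1 + s)) ^ x]. *)
Lemma integrable_gamma (x sigma : R) : 0 < x -> 0 < sigma ->
  mu.-integrable pos (EFin \o (fun s => s `^ (x - 1) * expR (- (sigma * s)))).
Proof.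
move=> x0 s0; pose a := (x + 1) / sigma.
have a0 : 0 < a by rewrite divr_gt0 // addr_gt0.
pose C := expR (sigma + (x + 1) * (ln a - 1)).
pose G (s : R) : R := expR (x * (ln s - ln (1 + s))).
pose g (s : R) : R := x / (s * (1 + s)) * G s.
have dG (s : R) : 0 < s -> is_derive s 1 G (g s).
  move=> sp; have s1 : 0 < 1 + s by rewrite addr_gt0.
  have d1 : is_derive s 1 (fun y => ln (1 + y)) (1 + s)^-1.
    have := @is_derive1_comp _ (@ln R) (fun y => 1 + y) s _ _ (is_derive1_ln s1)
      (is_deriveD (is_derive_cst (1 : R) s 1) (is_derive_id s 1)).
    by move=> h; apply: (is_derive_eq h); rewrite add0r mulr1.
  have d2 := is_deriveZ x (is_deriveB (is_derive1_ln sp) d1).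
  have d3 := @is_derive1_comp _ (@expR R) (fun y => x * (ln y - ln (1 + y))) s _ _
    (is_derive_expR (x * (ln s - ln (1 + s)))) d2.
  apply: (is_derive_eq d3); rewrite /g /G /GRing.scale /=; field.
  by rewrite !gt_eqF.
have cG (s : R) : 0 < s -> {for s, continuous G}.
  by move=> /dG [d _]; apply: differentiable_continuous; exact/derivable1_diffP.
have ig : mu.-integrable pos (EFin \o g).
  apply: (@ge0_integrable_pos g G 1) => // s sp.
  - have s1 : 0 < 1 + s by rewrite addr_gt0.
    apply: cvgM; last exact: cG.
    apply: cvgM; first exact: cvg_cst.
    apply: cvgV; first by rewrite gt_eqF // mulr_gt0.
    apply: cvgM; first exact: cvg_id.
    by apply: cvgD; [exact: cvg_cst|exact: cvg_id].
  - by rewrite mulr_ge0 ?expR_ge0 // divr_ge0 ?mulr_ge0 // ltW // addr_gt0.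
  - rewrite expR_ge0 -[leRHS]expR0 ler_expR pmulr_rle0 // subr_le0.
    by rewrite /= ler_ln ?posrE ?addr_gt0 // lerDr.
have mf : measurable_fun pos (fun s => s `^ (x - 1) * expR (- (sigma * s))).
  apply: measurable_funTS; apply: measurable_funM; first exact: measurable_powR.
  apply: (measurableT_comp (@measurable_expR R)).
  by apply: measurable_funN; apply: measurable_funM => //; exact: measurable_cst.
apply: (@real_dom _ _ measurable_pos _ (fun s => C / x * g s)) => //.
  exact: rintegrableZ measurable_pos _ _ ig.
move=> s /posP sp; have s1 : 0 < 1 + s by rewrite addr_gt0.
rewrite ger0_norm ?mulr_ge0 ?powR_ge0 ?expR_ge0 //.
have -> : C / x * g s = expR (sigma + (x + 1) * (ln a - 1) + (x - 1) * ln s - (x + 1) * ln (1 + s)).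
  have -> : sigma + (x + 1) * (ln a - 1) + (x - 1) * ln s - (x + 1) * ln (1 + s) =
    (sigma + (x + 1) * (ln a - 1)) + (- ln s - ln (1 + s)) + x * (ln s - ln (1 + s)) by ring.
  rewrite (expRD (sigma + (x + 1) * (ln a - 1) + _)) (expRD (sigma + _)) (expRD (- ln s)).
  rewrite /g /C /G !expRN !lnK ?posrE //; field.
  by rewrite !gt_eqF.
rewrite /powR gt_eqF // -expRD ler_expR.
have : ln ((1 + s) / a) <= (1 + s) / a - 1.
  by have := @le_ln1Dx R ((1 + s) / a - 1); rewrite subrKC; apply; rewrite ltrBrDl subrr divr_gt0.
rewrite lnM ?posrE ?invr_gt0 // lnV ?posrE // => h.
have xs : 0 < x + 1 by rewrite addr_gt0.
have h2 : (x + 1) * (ln (1 + s) - ln a) <= (x + 1) * ((1 + s) / a - 1) by rewrite ler_pM2l.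
have h3 : (x + 1) * ((1 + s) / a - 1) = sigma * (1 + s) - (x + 1).
  by rewrite /a; field; rewrite !gt_eqF.
rewrite h3 in h2; lra.
Qed.

End HalfLine.

(** * Power substitutions on the half-line *)

Section PowerSubstitution.
Context {R : realType}.
Local Notation mu := (@lebesgue_measure R).
Local Notation RT := (measurableTypeR R).
Variables (k c : R).
Hypotheses (k0 : 0 < k) (c0 : 0 < c).

Let T (t : R) : R := c * t `^ k.
Let T' (t : R) : R := c * (k * t `^ (k - 1)).

Lemma T_gt0 (t : R) : 0 < t -> 0 < T t.
Proof. by move=> t0; rewrite mulr_gt0 // powR_gt0. Qed.

Lemma T'_gt0 (t : R) : 0 < t -> 0 < T' t.
Proof. by move=> t0; rewrite !mulr_gt0 // powR_gt0. Qed.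

Lemma dT (t : R) : 0 < t -> is_derive t 1 T (T' t).
Proof. by move=> t0; exact: (is_deriveZ c (is_derive1_powR k t0)). Qed.

Lemma T_cont (t : R) : 0 < t -> {for t, continuous T}.
Proof.
by move=> /dT [d _]; apply: differentiable_continuous; exact/derivable1_diffP.
Qed.

Lemma powR_cont (p t : R) : 0 < t -> {for t, continuous (fun s : R => s `^ p)}.
Proof.
move=> t0; have [d _] := is_derive1_powR p t0.
by apply: differentiable_continuous; exact/derivable1_diffP.
Qed.

Lemma T'_cont (t : R) : 0 < t -> {for t, continuous T'}.
Proof.
move=> t0; apply: cvgM; first exact: cvg_cst.
by apply: cvgM; [exact: cvg_cst|exact: powR_cont].
Qed.

Lemma derive1_T (t : R) : 0 < t -> derive1 T t = T' t.
Proof. by move=> t0; rewrite derive1E; have [_ ->] := dT t0. Qed.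

Lemma derive1_T_cont (t : R) : 0 < t -> {for t, continuous (derive1 T)}.
Proof.
move=> t0; rewrite /prop_for /continuous_at derive1_T //.
apply: cvg_trans (T'_cont t0); apply: near_eq_cvg.
have : \forall s \near t, 0 < s by exact: lt_nbhsr.
by apply: filterS => s s0; rewrite derive1_T.
Qed.

Lemma T_lt (s t : R) : 0 < s -> s < t -> T s < T t.
Proof.
move=> s0 st; rewrite ltr_pM2l // gt0_ltr_powR // nnegrE ltW //.
exact: lt_trans st.
Qed.

Lemma ge0_substitution (G : R -> R) :
  (forall s : R, 0 < s -> {for s, continuous G}) ->
  (forall s : R, 0 < s -> 0 <= G s) ->
  (\int[mu]_(s in `]0%R, +oo[) (G s)%:E = \int[mu]_(t in `]0%R, +oo[) (G (T t) * T' t)%:E)%E.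
Proof.
move=> cG G0.
pose u n : R := n.+1%:R^-1; pose v n : R := n.+1%:R.
have u0 n : 0 < u n by rewrite invr_gt0.
have uS n : u n.+1 <= u n by rewrite lef_pV2 ?posrE // ler_nat.
have vS n : v n <= v n.+1 by rewrite ler_nat.
have uv n : u n <= v n by rewrite (@le_trans _ _ 1) // ?invf_le1 // ler1n.
have cGT (t : R) : 0 < t -> {for t, continuous (fun t => G (T t) * T' t)}.
  move=> t0; apply: cvgM; last exact: T'_cont.
  by apply: continuous_comp; [exact: T_cont|apply: cG; exact: T_gt0].
have e1 := @ge0_exhaust _ u v (fun t => G (T t) * T' t) (measurable_pos_cont cGT)
  (fun t t0 => mulr_ge0 (G0 _ (T_gt0 t0)) (ltW (T'_gt0 t0))) u0 uS vS (@std_exhaust R).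
have Tle (s t : R) : 0 < s -> s <= t -> T s <= T t.
  by move=> s0; rewrite le_eqVlt => /orP[/eqP -> //|st]; rewrite ltW // T_lt.
have cover (s : R) : 0 < s -> exists n, T (u n) <= s <= T (v n).
  move=> s0; have sc : 0 < (s / c) `^ k^-1 by rewrite powR_gt0 // divr_gt0.
  have [n /andP[h1 h2]] := std_exhaust sc; exists n.
  have Ts : T ((s / c) `^ k^-1) = s.
    rewrite /T -powRrM mulVf ?gt_eqF // powRr1 ?divr_ge0 ?ltW //.
    by rewrite mulrC divfK // gt_eqF.
  by rewrite -{1 2}Ts; apply/andP; split; apply: Tle.
have e2 := @ge0_exhaust _ (T \o u) (T \o v) G (measurable_pos_cont cG) G0
  (fun n => T_gt0 (u0 n)) (fun n => Tle _ _ (u0 n.+1) (uS n))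
  (fun n => Tle _ _ (lt_le_trans (u0 n) (uv n)) (vS n)) cover.
apply: cvg_unique e2 _ => //.
suff -> : (fun n => \int[mu]_(s in `[(T \o u) n, (T \o v) n]) (G s)%:E)%E =
  (fun n => \int[mu]_(t in `[u n, v n]) (G (T t) * T' t)%:E)%E by exact: e1.
apply/funext => n /=.
rewrite (integration_by_substitution_increasing (uv n)).
- apply: eq_integral => t; rewrite inE /= in_itv /= => /andP[ut _].
  by rewrite -derive1_T // (lt_le_trans (u0 n)).
- move=> s t; rewrite !in_itv /= => /andP[us _] _ st; apply: T_lt => //.
  exact: lt_le_trans us.
- move=> t; rewrite in_itv /= => /andP[ut _]; apply: derive1_T_cont.
  exact: lt_trans ut.
- by apply/cvg_ex; exists ((derive1 T) (u n)); apply: cvg_at_right_filter; exact: derive1_T_cont.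
- apply/cvg_ex; exists ((derive1 T) (v n)); apply: cvg_at_left_filter; apply: derive1_T_cont.
  exact: lt_le_trans (uv n).
- split.
  + by move=> t; rewrite in_itv /= => /andP[ut _]; have [] := dT (lt_trans (u0 n) ut).
  + by apply: cvg_at_right_filter; exact: T_cont.
  + by apply: cvg_at_left_filter; apply: T_cont; exact: lt_le_trans (uv n).
- apply: continuous_in_subspaceT => s; rewrite inE /= in_itv /= => /andP[us _].
  by apply: cG; apply: lt_le_trans us; exact: T_gt0.
Qed.

(** A dominated function is a difference of the nonnegative functions [G + H]
    and [H]. *)
Lemma dominated_substitution (G H : R -> R) :
  (forall s : R, 0 < s -> {for s, continuous G}) ->
  (forall s : R, 0 < s -> {for s, continuous H}) ->
  (forall s : R, 0 < s -> `|G s| <= H s) ->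
  mu.-integrable pos (EFin \o H) ->
  mu.-integrable pos (EFin \o (fun t => G (T t) * T' t)) /\
  \int[mu]_(s in pos) G s = \int[mu]_(t in pos) (G (T t) * T' t).
Proof.
move=> cG cH GH iH; have mP := @measurable_pos R.
have H0 (s : R) : 0 < s -> 0 <= H s by move=> /GH; exact: le_trans.
have sub (F : R -> R) : (forall s : R, 0 < s -> {for s, continuous F}) ->
    (forall s : R, 0 < s -> 0 <= F s) -> mu.-integrable pos (EFin \o F) ->
    mu.-integrable pos (EFin \o (fun t => F (T t) * T' t)) /\
    \int[mu]_(s in pos) F s = \int[mu]_(t in pos) (F (T t) * T' t).
  move=> cF F0 iF; have e := ge0_substitution cF F0; split; last by rewrite /Rintegral e.
  apply/integrableP; split.
    apply/measurable_EFinP; apply: measurable_pos_cont => t t0.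
    apply: cvgM; last exact: T'_cont.
    by apply: continuous_comp; [exact: T_cont|apply: cF; exact: T_gt0].
  have /integrableP[_] := iF; congr (_ < _)%E.
  transitivity (\int[mu]_(s in `]0%R, +oo[) (F s)%:E)%E.
    by apply: eq_integral => s; rewrite inE => /posP s0; rewrite /= ger0_norm // F0.
  rewrite e; apply: eq_integral => t; rewrite inE => /posP t0.
  by rewrite /= ger0_norm // mulr_ge0 ?F0 ?T_gt0 // ltW // T'_gt0.
have [iH' eH'] := sub H cH H0 iH.
have iG : mu.-integrable pos (EFin \o G).
  by apply: real_dom mP _ _ _ iH _ => [|t /posP /GH //]; exact: measurable_pos_cont.
have GH0 (s : R) : 0 < s -> 0 <= G s + H s.
  by move=> s0; have := GH s s0; rewrite ler_norml => /andP[]; lra.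
have [iS eS] := sub (fun s => G s + H s) (fun s s0 => cvgD (cG s s0) (cH s s0)) GH0
  (rintegrableD mP iG iH).
have GE : (fun t => G (T t) * T' t) =
    (fun t => (G (T t) + H (T t)) * T' t - H (T t) * T' t).
  by apply/funext => t; ring.
rewrite GE; split; first exact: rintegrableB.
rewrite RintegralB // -eS -eH' RintegralD //; ring.
Qed.

End PowerSubstitution.

(** * The Gamma integral *)

Section GammaFunction.
Context {R : realType}.
Local Notation mu := (@lebesgue_measure R).
Local Notation RT := (measurableTypeR R).
Local Notation mP := (@measurable_pos R).
Implicit Types (c z w : R[i]) (g : R -> R[i]).

Lemma cmeas_kernel w : cmeas pos (fun t : RT => cexp (- (w * (t : R)%:C))).
Proof.
by apply: cmeas_cexp; apply: cmeasN; apply: cmeasZ; apply: cmeas_real;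
  exact: measurable_id.
Qed.

Lemma cmeas_mono c : cmeas pos (fun t : RT => cpow (t : R)%:C c).
Proof. by apply: cmeas_cpow => [|t /posP //]; exact: measurable_id. Qed.

Lemma cabs_kernel w (t : R) : cabs (cexp (- (w * t%:C))) = expR (- (Re w * t)).
Proof. by rewrite cabs_cexp ReN mulrC ReMC mulrC. Qed.

Lemma laplace_exists_bound g w (K x rho : R) : cmeas (pos : set RT) g ->
  0 < x -> rho < Re w ->
  (forall s : R, 0 < s -> cabs (g s) <= K * (s `^ (x - 1) * expR (rho * s))) ->
  laplace_exists g w.
Proof.
move=> mg x0 rw gK.
have rw0 : 0 < Re w - rho by rewrite subr_gt0.
apply: (cintegrable_dom mP (h := fun s => K * (s `^ (x - 1) * expR (- ((Re w - rho) * s))))).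
- by apply: cmeasM => //; exact: cmeas_kernel.
- by apply: rintegrableZ mP _ _ _; exact: integrable_gamma.
- move=> s /posP s0; rewrite cabsM cabs_kernel.
  have -> : expR (- ((Re w - rho) * s)) = expR (- (Re w * s)) * expR (rho * s).
    by rewrite -expRD; congr expR; ring.
  have := ler_wpM2l (expR_ge0 (- (Re w * s))) (gK s s0).
  by rewrite (_ : _ * (K * _) = K * (s `^ (x - 1) * (expR (- (Re w * s)) * expR (rho * s)))) //; ring.
Qed.

Lemma laplace_mono_exists c w : 0 < Re c -> 0 < Re w ->
  laplace_exists (fun s => cpow s%:C (c - 1)) w.
Proof.
move=> c0 w0; apply: (@laplace_exists_bound _ _ 1 (Re c) 0) => //.
  exact: cmeas_mono.
by move=> s s0; rewrite cabs_cpow // ReB (ReC 1) mul0r expR0 mulr1 mul1r.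
Qed.

Lemma cder_kernel_mono c w (s : R) : 0 < s -> exists l,
  cder (fun s => cexp (- (w * s%:C)) * cpow s%:C c) s l.
Proof.
move=> s0; eexists; apply: cderM.
  by apply: cder_cexp; apply: cderN; apply: cderZ; exact: cder_id.
by apply: cder_cpow; [exact: s0|exact: cder_id].
Qed.

(** Substituting [s = t ^ k / (k w)] in the Laplace integral of a power. *)
Lemma laplace_mono_kGamma (k w : R) z : 0 < k -> 0 < w -> 0 < Re z ->
  laplace (fun s => cpow s%:C (z / k%:C - 1)) w%:C =
  k%:C * cpow (k * w)%:C (- (z / k%:C)) * kGamma k z.
Proof.
move=> k0 w0 z0; have kw0 : 0 < k * w by rewrite mulr_gt0.
have c0 : 0 < (k * w)^-1 by rewrite invr_gt0.
have xk0 : 0 < Re z / k by rewrite divr_gt0.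
have ReE : Re (z / k%:C) = Re z / k.
  by rewrite mulrC -fmorphV ReMC mulrC.
have kz : (z / k%:C) * k%:C = z by rewrite divfK // real_neq0.
set q := z / k%:C in ReE kz *; set e := q - 1.
pose g (s : R) := cexp (- (w%:C * s%:C)) * cpow s%:C e.
pose H (s : R) := s `^ (Re z / k - 1) * expR (- (w * s)).
have gH (s : R) : 0 < s -> cabs (g s) = H s.
  by move=> s0; rewrite cabsM cabs_kernel cabs_cpow // /e ReB (ReC 1) ReE mulrC.
have cg (s : R) : 0 < s -> {for s, continuous (fun s => Re (g s))} /\
    {for s, continuous (fun s => Im (g s))}.
  by move=> /(cder_kernel_mono e w%:C)[l] /cder_continuous.
have cH (s : R) : 0 < s -> {for s, continuous H}.
  move=> s0; apply: cvgM; first exact: powR_cont.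
  apply: (@continuous_comp _ _ _ (fun s : R => - (w * s)) (@expR R)).
    by apply: cvgN; apply: cvgM; [exact: cvg_cst|exact: cvg_id].
  exact: continuous_expR.
have iH : mu.-integrable pos (EFin \o H) by exact: integrable_gamma.
have gHr (s : R) : 0 < s -> `|Re (g s)| <= H s by move=> /gH <-; exact: cabs_Re.
have gHi (s : R) : 0 < s -> `|Im (g s)| <= H s by move=> /gH <-; exact: cabs_Im.
have [i1 e1] := dominated_substitution k0 c0 (fun s s0 => proj1 (cg s s0)) cH gHr iH.
have [i2 e2] := dominated_substitution k0 c0 (fun s s0 => proj2 (cg s s0)) cH gHi iH.
pose T (t : R) := (k * w)^-1 * t `^ k; pose T' (t : R) := (k * w)^-1 * (k * t `^ (k - 1)).
pose A := k%:C * cpow (k * w)%:C (- q).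
pose gk (t : R) := (expR (- (t `^ k / k)))%:C * cpow t%:C (z - 1).
have A0 : A != 0 by rewrite mulf_neq0 ?real_neq0 // cpow_neq0 // real_neq0.
have key (t : R) : 0 < t -> (T' t)%:C * g (T t) = A * gk t.
  move=> t0; have Tt0 : 0 < T t by rewrite mulr_gt0 // powR_gt0.
  have lnT : ln (T t) = k * ln t - ln (k * w).
    by rewrite /T [LHS]lnM ?posrE ?powR_gt0 // lnV ?posrE // ln_powR addrC.
  have lnkw : (k * w)%:C = cexp (ln (k * w))%:C by rewrite cexpC lnK.
  have powE : (t `^ (k - 1))%:C = cexp ((k - 1) * ln t)%:C.
    by rewrite cexpC /powR gt_eqF.
  have T'E : (T' t)%:C = w^-1%:C * cexp ((k - 1) * ln t)%:C.
    rewrite -powE -rmorphM; congr (_ %:C); rewrite /T'; field.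
    by rewrite !gt_eqF.
  have kE : k%:C = w^-1%:C * cexp (ln (k * w))%:C.
    by rewrite -lnkw -rmorphM; congr (_ %:C); field; rewrite gt_eqF.
  have -> : g (T t) = (expR (- (t `^ k / k)))%:C * cexp (e * (k * ln t - ln (k * w))%:C).
    rewrite /g cpowC // lnT -cexpC; congr (cexp _ * _).
    by rewrite rmorphN -rmorphM; congr (- _ %:C); rewrite /T; field; rewrite !gt_eqF.
  rewrite T'E /A /gk !cpowC // kE.
  rewrite [LHS](_ : _ = w^-1%:C * (expR (- (t `^ k / k)))%:C *
    (cexp ((k - 1) * ln t)%:C * cexp (e * (k * ln t - ln (k * w))%:C))); last by ring.
  rewrite [RHS](_ : _ = w^-1%:C * (expR (- (t `^ k / k)))%:C *
    (cexp (ln (k * w))%:C * cexp (- q * (ln (k * w))%:C) *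
     cexp ((z - 1) * (ln t)%:C))); last by ring.
  congr (_ * _); rewrite -!cexpD; congr cexp.
  rewrite /e !rmorphB /= !rmorphM /= rmorphB /= -[in RHS]kz; ring.
have iTg : cintegrable pos (fun t => (T' t)%:C * g (T t)).
  split.
    apply: eq_integrable mP _ _ _ i1 => t _ /=.
    by rewrite ReMC mulrC.
  apply: eq_integrable mP _ _ _ i2 => t _ /=.
  by rewrite ImMC mulrC.
have igk : cintegrable pos gk.
  apply: (eq_cintegrable mP) (cintegrableZ mP A^-1 iTg) => t /posP t0.
  by rewrite key // mulKf.
rewrite -/A -[kGamma k z]/(cintegral pos gk) -(cintegralZ mP _ igk).
transitivity (cintegral pos (fun t => (T' t)%:C * g (T t))).
  apply: cplxP; rewrite /laplace /cintegral !(ReI, ImI).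
    etransitivity; first exact: e1.
    by apply: eq_Rintegral => t _; rewrite ReMC mulrC.
  etransitivity; first exact: e2.
  by apply: eq_Rintegral => t _; rewrite ImMC mulrC.
by apply: eq_cintegral => t /posP t0; rewrite key.
Qed.

(** The classical Gamma function is the case [k = 1]. *)
Lemma laplace_mono_real c (w : R) : 0 < Re c -> 0 < w ->
  laplace (fun s => cpow s%:C (c - 1)) w%:C = cpow w%:C (- c) * kGamma 1 c.
Proof.
move=> c0 w0; have := laplace_mono_kGamma (ltr01 : 0 < (1 : R)) w0 c0.
by rewrite divr1 mul1r mul1r.
Qed.

Lemma laplace_mono1 c : 0 < Re c ->
  laplace (fun s => cpow s%:C (c - 1)) 1 = kGamma 1 c.
Proof.
by move=> c0; rewrite (laplace_mono_real c0 ltr01) cpow1b mul1r.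
Qed.

Lemma kGammaE (k : R) z : 0 < k -> 0 < Re z ->
  kGamma k z = k^-1%:C * cpow k%:C (z / k%:C) * kGamma 1 (z / k%:C).
Proof.
move=> k0 z0; have zk0 : 0 < Re (z / k%:C).
  by rewrite mulrC -fmorphV ReMC mulr_gt0 // invr_gt0.
have := laplace_mono_kGamma k0 ltr01 z0; rewrite laplace_mono_real //.
rewrite mulr1 cpow1b mul1r cpowN ?real_neq0 // => ->.
rewrite fmorphV; field.
by rewrite cpow_neq0 ?real_neq0.
Qed.

Lemma kGamma1_1 : kGamma 1 (1 : R[i]) = 1.
Proof.
rewrite -laplace_mono1 ?(ReC 1) // subrr.
have i1 : mu.-integrable (`]0, +oo[ : set RT) (EFin \o (fun s : R => expR (- s))).
  have := @integrable_gamma R 1 1 ltr01 ltr01.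
  apply: (eq_integrable mP) => s _ /=; rewrite subrr powRr0 mul1r mul1r //.
transitivity ((\int[mu]_(s in `]0, +oo[) expR (- s))%:C).
  apply: cplxP; rewrite /laplace /cintegral !(ReI, ImI).
    apply: eq_Rintegral => s; rewrite inE => /posP s0.
    by rewrite cpow0 ?real_neq0 // mulr1 mul1r -rmorphN cexpC.
  transitivity (\int[mu]_(s in `]0, +oo[) (0 : R)); last first.
    by rewrite /Rintegral integral0.
  apply: eq_Rintegral => s; rewrite inE => /posP s0.
  by rewrite cpow0 ?real_neq0 // mulr1 mul1r -rmorphN cexpC.
rewrite Rintegral_itv_obnd_cbnd //.
have dexp (s : R) : is_derive s 1 (fun s => - expR (- s)) (expR (- s)).
  have h := is_deriveN (@is_derive1_comp _ (@expR R) -%R s _ _ (is_derive_expR (- s))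
    (is_deriveNid s 1)).
  by apply: (is_derive_eq h); rewrite mulrN1 opprK.
have cexp0 : {for (0 : R), continuous (fun s : R => - expR (- s))}.
  by have [d _] := dexp 0; apply: differentiable_continuous; exact/derivable1_diffP.
have -> : \int[mu]_(s in `[0, +oo[) expR (- s) = 0 - (- expR (- 0)).
  apply: (@Rintegral_ge0_continuous_FTC2y R _ (fun s => - expR (- s))).
  - by move=> s _; exact: expR_ge0.
  - apply: continuous_subspaceT => s; apply: continuous_comp; first exact: continuousN.
    exact: continuous_expR.
  - by rewrite -oppr0; apply: cvgN; exact: cvgr_expR.
  - by move=> s _; have [] := dexp s.
  - by apply: cvg_at_right_filter; exact: cexp0.
  - by move=> s _; rewrite derive1E; have [_ ->] := dexp s.
by rewrite oppr0 expR0 opprK add0r.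
Qed.

End GammaFunction.

(** * The functional equation and the transform of a power *)

Section GammaFunctional.
Context {R : realType}.
Local Notation mu := (@lebesgue_measure R).
Local Notation RT := (measurableTypeR R).
Local Notation mP := (@measurable_pos R).
Implicit Types (c z w : R[i]) (g h : R -> R[i]).

Lemma laplace_exists_locint h w (b : R) : laplace_exists h w ->
  cintegrable `]0, b[ h.
Proof.
move=> ih; have mb : measurable (`]0, b[%classic : set RT) by exact: measurable_itv.
have sub : `]0, b[%classic `<=` (pos : set RT).
  by move=> t /=; rewrite in_itv /= => /andP[t0 _]; exact/posP.
have ih' : cintegrable `]0, b[ (fun t => cexp (- (w * t%:C)) * h t).
  by case: ih => h1 h2; split; [exact: integrableS mP mb sub h1|exact: integrableS mP mb sub h2].
have hE (t : R) : h t = cexp (w * t%:C) * (cexp (- (w * t%:C)) * h t).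
  by rewrite mulrA -cexpD subrr cexp0 mul1r.
apply: (cintegrable_dom mb (h := fun t => expR (`|Re w| * b) * cabs (cexp (- (w * t%:C)) * h t))).
- apply: (eq_cmeas (fun t _ => esym (hE t))); apply: cmeasM; last exact: cintegrable_cmeas ih'.
  by apply: cmeas_cexp; apply: cmeasZ; apply: cmeas_real; exact: measurable_id.
- by apply: rintegrableZ => //; exact: cintegrable_abs.
- move=> t; rewrite /= in_itv /= => /andP[t0 tb]; rewrite {1}hE cabsM.
  rewrite ler_wpM2r ?cabs_ge0 // cabs_cexp ler_expR mulrC ReMC mulrC.
  apply: le_trans (ler_norm _) _; rewrite normrM (gtr0_norm t0).
  by rewrite ler_wpM2l // ltW.
Qed.

Lemma eq_laplace g h w : (forall s : R, 0 < s -> g s = h s) ->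
  laplace g w = laplace h w.
Proof.
by move=> gh; apply: (@eq_cintegral _ pos) => s /posP s0; rewrite gh.
Qed.

Lemma eq_laplace_exists g h w : (forall s : R, 0 < s -> g s = h s) ->
  laplace_exists g w -> laplace_exists h w.
Proof.
by move=> gh; apply: (eq_cintegrable mP) => s /posP s0; rewrite gh.
Qed.

Lemma laplaceZ (v : R[i]) g w : laplace_exists g w ->
  laplace_exists (fun s => v * g s) w /\
  laplace (fun s => v * g s) w = v * laplace g w.
Proof.
move=> ig; split.
  by apply: (eq_cintegrable mP) (cintegrableZ mP v ig) => s _; rewrite mulrCA.
rewrite /laplace -(cintegralZ mP) //; apply: eq_cintegral => s _.
by rewrite mulrCA.
Qed.

Lemma laplaceD g h w : laplace_exists g w -> laplace_exists h w ->
  laplace_exists (fun s => g s + h s) w /\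
  laplace (fun s => g s + h s) w = laplace g w + laplace h w.
Proof.
move=> ig ih; split.
  by apply: (eq_cintegrable mP) (cintegrableD mP ig ih) => s _; rewrite mulrDr.
rewrite /laplace -(cintegralD mP) //; apply: eq_cintegral => s _.
by rewrite mulrDr.
Qed.

Lemma laplace_exists_one w : 0 < Re w -> laplace_exists (fun=> 1) w.
Proof.
move=> w0; apply: (@laplace_exists_bound _ _ _ 1 1 0) => //.
by move=> s s0; rewrite cabs1 subrr powRr0 mul0r expR0 !mulr1.
Qed.

Lemma cpow_cvg0 c : 0 < Re c ->
  Re (cpow t%:C c) @[t --> (0 : R)^'+] --> (0 : R) /\
  Im (cpow t%:C c) @[t --> (0 : R)^'+] --> (0 : R).
Proof.
move=> c0; have h := powR_cvg0 c0.
have aux (f : R -> R) : (forall t, 0 < t -> `|f t| <= t `^ Re c) ->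
    f t @[t --> (0 : R)^'+] --> (0 : R).
  move=> fc; apply/cvgrPdist_le => e e0; move/cvgrPdist_le : h => /(_ e e0) h.
  near=> t; rewrite sub0r normrN.
  have t0 : 0 < t by near: t; exact: nbhs_right_gt.
  apply: le_trans (fc t t0) _; apply: le_trans (ler_norm _) _.
  by rewrite -normrN -sub0r; near: t.
by split; apply: aux => t t0; rewrite -cabs_cpow //; [exact: cabs_Re|exact: cabs_Im].
Unshelve. all: by end_near. Qed.

(** The function [s ^ c / c] is the convolution of [1] and [s ^ (c - 1)]; compare
    the transforms at [1]. *)
Lemma kGamma1S c : 0 < Re c -> kGamma 1 (c + 1) = c * kGamma 1 c.
Proof.
move=> c0; have c1 : c != 0 by exact: Re_gt0_neq0.
have cS0 : 0 < Re (c + 1) by rewrite ReD (ReC 1) addr_gt0.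
have R1 : 0 < Re (1 : R[i]) by rewrite (ReC 1).
have i1 := laplace_exists_one R1.
have im := laplace_mono_exists c0 R1.
pose g (s : R) := c^-1 * cpow s%:C c.
have dg (t : R) : 0 < t -> cder g t (cpow t%:C (c - 1)).
  move=> t0; apply: cder_eq (cderZ c^-1 (cder_cpow c (t0 : 0 < Re t%:C) (cder_id t))) _.
  rewrite cpowD ?real_neq0 // cpowN ?real_neq0 // cpow1 ?real_neq0 //; field.
  by rewrite c1 real_neq0.
have ib (x : R) := laplace_exists_locint x im.
have gE (x : R) : 0 < x -> g x = cintegral `]0, x[ (fun t => 1 * cpow t%:C (c - 1)).
  move=> x0; transitivity (cintegral `]0, x[ (fun t => cpow t%:C (c - 1))); last first.
    by apply: eq_cintegral => t _; rewrite mul1r.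
  rewrite (@complex_FTC0 _ x g _ 0 x0 dg _ _ (ib x)) ?subr0 //.
    have [h1 h2] := cpow_cvg0 c0.
    under eq_fun do rewrite ReM.
    have -> : Re (0 : R[i]) = Re c^-1 * 0 - Im c^-1 * 0 by rewrite !mulr0 subr0.
    by apply: cvgB; apply: cvgM => //; exact: cvg_cst.
  have [h1 h2] := cpow_cvg0 c0.
  under eq_fun do rewrite ImM.
  have -> : Im (0 : R[i]) = Re c^-1 * 0 + Im c^-1 * 0 by rewrite !mulr0 addr0.
  by apply: cvgD; apply: cvgM => //; exact: cvg_cst.
have [ig eg] := laplace_convolution i1 im
  (fun x x0 => eq_cintegrable (measurable_itv _) (fun t _ => esym (mul1r _)) (ib x)) gE.
have -> : kGamma 1 (c + 1) = c * laplace g 1.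
  rewrite -laplace_mono1 // addrK.
  have := (laplaceZ c ig).2; rewrite -[c * laplace g 1]/(c * laplace g 1) => <-.
  by apply: eq_laplace => s s0; rewrite /g mulVKf.
rewrite eg laplace_mono1 //.
have -> : @laplace R (fun=> 1) 1 = 1.
  rewrite -[RHS](@kGamma1_1 R) -laplace_mono1 ?(ReC 1) //; apply: eq_laplace => s s0.
  by rewrite subrr cpow0 ?real_neq0.
by rewrite mul1r.
Qed.

Lemma kGamma1_rising c n : 0 < Re c -> kGamma 1 (c + n%:R) = rising c n * kGamma 1 c.
Proof.
move=> c0; elim: n => [|n ih]; first by rewrite addr0 /rising big_ord0 mul1r.
rewrite -natr1 addrA kGamma1S; last by rewrite ReD Re_nat ltr_wpDr.
by rewrite ih risingS; ring.
Qed.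

(** Any point of the right half-plane is closer to a large real number [w0]
    than [w0] is to the origin; there the integral is expanded in powers of
    [w - w0]. *)
Lemma laplace_mono c w : 0 < Re c -> 0 < Re w ->
  laplace (fun s => cpow s%:C (c - 1)) w = cpow w (- c) * kGamma 1 c.
Proof.
move=> c0 rw0; have w0n : w != 0 by exact: Re_gt0_neq0.
pose w0 : R := cabs w ^+ 2 / Re w.
have w0p : 0 < w0 by rewrite divr_gt0 // exprn_gt0 // cabs_gt0.
pose h := w - w0%:C.
have hw0 : cabs h < w0.
  rewrite -(@ltr_pXn2r _ 2) ?nnegrE ?cabs_ge0 ?(ltW w0p) // cabs_sq.
  rewrite ReB ImB ReC ImC subr0.
  have e : w0 * Re w = Re w ^+ 2 + Im w ^+ 2.
    by rewrite -cabs_sq /w0 divfK // gt_eqF.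
  have : 0 < w0 * Re w by rewrite mulr_gt0.
  rewrite sqrrB -mulr_natr; lra.
pose g_ (n : nat) (s : R) := (- h) ^+ n / n`!%:R *
  (cexp (- (w0%:C * s%:C)) * cpow s%:C (c + n%:R - 1)).
have Rcn n : 0 < Re (c + n%:R) by rewrite ReD Re_nat ltr_wpDr.
have gE n (s : R) : 0 < s -> g_ n s = (- (h * s%:C)) ^+ n / n`!%:R *
    (cexp (- (w0%:C * s%:C)) * cpow s%:C (c - 1)).
  move=> s0; rewrite /g_ addrAC (cpowD (c - 1) n%:R (real_neq0 s0)) (cpow_nat n (real_neq0 s0)).
  by rewrite -(mulNr h s%:C) exprMn; ring.
have [ig sg] : cintegrable pos (fun s => cexp (- (w * s%:C)) * cpow s%:C (c - 1)) /\
    csum (fun n => cintegral pos (g_ n))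
      (cintegral pos (fun s => cexp (- (w * s%:C)) * cpow s%:C (c - 1))).
  apply: (csum_integral mP (h := fun s => s `^ (Re c - 1) * expR (- ((w0 - cabs h) * s)))).
  - move=> n; apply: cmeasZ; apply: cmeasM; first exact: cmeas_kernel.
    exact: cmeas_mono.
  - move=> s /posP s0.
    have -> : cexp (- (w * s%:C)) = cexp (- (h * s%:C)) * cexp (- (w0%:C * s%:C)).
      by rewrite -cexpD; congr cexp; rewrite /h; ring.
    rewrite -mulrA mulrC.
    have := csumZ (cexp (- (w0%:C * s%:C)) * cpow s%:C (c - 1)) (csum_cexp (- (h * s%:C))).
    by apply: eq_csum => n; rewrite gE // mulrC.
  - by apply: integrable_gamma => //; rewrite subr_gt0.
  - move=> n s /posP s0.
    have -> : \sum_(i < n) cabs (g_ i s) = (\sum_(i < n) (cabs h * s) ^+ i / i`!%:R) *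
       (expR (- (w0 * s)) * s `^ (Re c - 1)).
      rewrite mulr_suml; apply: eq_bigr => i _.
      rewrite gE // (cabsM (_ / _)) (cabsM (_ ^+ _)) (cabsM (cexp _)) cabs_kernel.
      rewrite cabs_cpow // cabsX cabsN (cabsM h) cabsC gtr0_norm //.
      by rewrite cabsV cabs_nat ReB (ReC 1) ReC.
    have -> : - ((w0 - cabs h) * s) = cabs h * s - w0 * s by ring.
    rewrite expRD (_ : s `^ (Re c - 1) * _ =
      expR (cabs h * s) * (expR (- (w0 * s)) * s `^ (Re c - 1))); last by ring.
    rewrite ler_wpM2r ?mulr_ge0 ?expR_ge0 ?powR_ge0 //.
    by apply: exp_partial_le; rewrite mulr_ge0 ?cabs_ge0 // ltW.
have tE n : cintegral pos (g_ n) = cpow w0%:C (- c) * kGamma 1 c *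
    (bin_coef c n * (- (h / w0%:C)) ^+ n).
  have ex := laplace_mono_exists (Rcn n) (w0p : 0 < Re w0%:C).
  rewrite /g_ (cintegralZ mP) // -/(laplace (fun s => cpow s%:C (c + n%:R - 1)) w0%:C).
  rewrite laplace_mono_real // (kGamma1_rising n c0) (opprD c n%:R) (cpowD _ _ (real_neq0 w0p)).
  rewrite (cpowN n%:R (real_neq0 w0p)) (cpow_nat n (real_neq0 w0p)) /bin_coef.
  rewrite -(mulNr h) exprMn exprVn; ring.
have hz : cabs (- (h / w0%:C)) < 1.
  rewrite cabsN cabsM cabsV cabsC gtr0_norm // ltr_pdivrMr // mul1r //.
have := csumZ (cpow w0%:C (- c) * kGamma 1 c) (csum_binomial c hz).
move=> /(eq_csum (fun n => esym (tE n))) /(csum_unique sg).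
rewrite /laplace => ->; rewrite mulrAC; congr (_ * _).
have wE : w = w0%:C * (1 - - (h / w0%:C)).
  by rewrite /h; field; rewrite real_neq0.
rewrite [in RHS]wE cpowM //.
by apply: contraNneq w0n => e; rewrite wE e mulr0.
Qed.

Lemma laplace_one w : 0 < Re w -> laplace (fun=> 1) w = w^-1.
Proof.
move=> w0; have w1 : w != 0 by exact: Re_gt0_neq0.
transitivity (laplace (fun s => cpow s%:C (1 - 1)) w).
  by apply: eq_laplace => s s0; rewrite subrr cpow0 ?real_neq0.
by rewrite laplace_mono ?(ReC 1) // kGamma1_1 mulr1 cpowN // cpow1.
Qed.

(** The Laplace transform of a derivative, from [h = l + 1 * h'], where the
    product is a convolution. *)
Lemma laplace_derivative h h' (l w : R[i]) : 0 < Re w ->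
  (forall t : R, 0 < t -> cder h t (h' t)) ->
  Re (h t) @[t --> (0 : R)^'+] --> Re l -> Im (h t) @[t --> (0 : R)^'+] --> Im l ->
  laplace_exists h' w ->
  laplace_exists h w /\ laplace h' w = w * laplace h w - l.
Proof.
move=> w0 dh rl il ih'; have w1 : w != 0 by exact: Re_gt0_neq0.
have i1 := laplace_exists_one w0.
pose g (s : R) := h s - l.
have gE (x : R) : 0 < x -> g x = cintegral `]0, x[ (fun t => 1 * h' t).
  move=> x0; transitivity (cintegral `]0, x[ h'); last first.
    by apply: eq_cintegral => t _; rewrite mul1r.
  by rewrite (complex_FTC0 x0 dh rl il (laplace_exists_locint x ih')).
have [ig eg] := laplace_convolution i1 ih' (fun x x0 => eq_cintegrable (measurable_itv _)
  (fun t _ => esym (mul1r _)) (laplace_exists_locint x ih')) gE.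
have [il1 el1] := laplaceZ l i1.
have [ih eh] := laplaceD ig il1.
have hE (s : R) : 0 < s -> g s + l * 1 = h s by rewrite /g mulr1 subrK.
split; first exact: eq_laplace_exists hE ih.
rewrite -(eq_laplace w hE) eh eg el1 laplace_one //; field.
exact: w1.
Qed.

End GammaFunctional.

(** * Lower bounds for the Gamma function *)

Section GammaBound.
Context {R : realType}.
Local Notation mu := (@lebesgue_measure R).
Local Notation RT := (measurableTypeR R).
Local Notation mP := (@measurable_pos R).
Implicit Types (x y : R) (z : R[i]).

Definition rgamma x : R := \int[mu]_(s in pos) (s `^ (x - 1) * expR (- s)).

Lemma integrable_rgamma x : 0 < x ->
  mu.-integrable pos (EFin \o (fun s => s `^ (x - 1) * expR (- s))).
Proof.
move=> x0; have := integrable_gamma x0 ltr01.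
by apply: (eq_integrable mP) => s _ /=; rewrite mul1r.
Qed.

Lemma cpow_realE (s x : R) : 0 < s -> cpow s%:C x%:C = (s `^ x)%:C.
Proof.
by move=> s0; rewrite cpowC // -rmorphM cexpC /powR gt_eqF.
Qed.

Lemma kGamma_real x : 0 < x -> kGamma 1 x%:C = (rgamma x)%:C.
Proof.
move=> x0; rewrite -laplace_mono1 //.
apply: cplxP; rewrite /laplace /cintegral !(ReI, ImI).
  apply: eq_Rintegral => s; rewrite inE => /posP s0.
  by rewrite -(rmorphB _ x 1) cpow_realE // mul1r -rmorphN cexpC -rmorphM mulrC.
transitivity (\int[mu]_(s in `]0, +oo[) (0 : R)); last first.
  by rewrite /Rintegral integral0.
apply: eq_Rintegral => s; rewrite inE => /posP s0.
by rewrite -(rmorphB _ x 1) cpow_realE // mul1r -rmorphN cexpC -rmorphM.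
Qed.

Lemma rgammaS x : 0 < x -> rgamma (x + 1) = x * rgamma x.
Proof.
move=> x0; have h : (rgamma (x + 1))%:C = (x * rgamma x)%:C.
  have := kGamma1S (x0 : 0 < Re x%:C); rewrite -(rmorphD _ x 1) !kGamma_real ?addr_gt0 // => ->.
  by rewrite -rmorphM.
exact: (complexI h).
Qed.

(** Only the mass of the integrand between [L] and [L + 1] is kept. *)
Lemma rgamma_ge x (L : R) : 0 <= x -> 0 < L ->
  L `^ x * expR (- (L + 1)) <= rgamma (x + 1).
Proof.
move=> x0 L0; have x1 : 0 < x + 1 by rewrite ltr_wpDl.
have ig := integrable_rgamma x1; rewrite addrK in ig.
have mI : measurable (`]L, (L + 1)%R[%classic : set RT) by exact: measurable_itv.
have sI : (`]L, (L + 1)%R[%classic : set RT) `<=` pos.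
  by move=> s; rewrite /= in_itv /= => /andP[Ls _]; apply/posP; exact: lt_trans Ls.
have ii := integrableS mP mI sI ig.
have -> : L `^ x * expR (- (L + 1)) =
    \int[mu]_(s in `]L, (L + 1)%R[) (L `^ x * expR (- (L + 1))).
  have hm : mu (`]L, (L + 1)%R[%classic : set RT) = 1%E.
    rewrite [LHS](lebesgue_measure_itv `]L, (L + 1)%R[) /= lte_fin ltrDl ltr01.
    by rewrite -EFinB addrAC subrr add0r.
  rewrite Rintegral_cst; [by rewrite [X in fine X]hm mulr1|exact: mI].
apply: (@le_trans _ _ (\int[mu]_(s in `]L, (L + 1)%R[) (s `^ x * expR (- s)))).
  apply: le_Rintegral => //; first exact: (integrable_cst_fin _ mI (mu_itv_fin _ _)).
  move=> s; rewrite /= in_itv /= => /andP[Ls sL].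
  rewrite ler_pM ?powR_ge0 ?expR_ge0 //.
    by rewrite ge0_ler_powR ?nnegrE ?(ltW L0) ?(ltW (lt_trans L0 Ls)) ?(ltW Ls).
  by rewrite ler_expR lerN2 ltW.
rewrite /rgamma /Rintegral addrK fine_le ?(integrable_fin_num mP ig) ?(integrable_fin_num mI ii) //.
apply: (ge0_subset_integral mu mI mP _ _ sI); first by case/integrableP: ig.
by move=> s _; rewrite lee_fin mulr_ge0 ?powR_ge0 ?expR_ge0.
Qed.

Lemma rgamma_gt0 x : 0 < x -> 0 < rgamma x.
Proof.
move=> x0; rewrite -(pmulr_rgt0 _ x0) -rgammaS //.
apply: lt_le_trans (rgamma_ge (ltW x0) ltr01).
by rewrite powR1 mul1r expR_gt0.
Qed.

Lemma inv_rgamma_le x (L : R) : 0 < x -> 0 < L ->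
  (rgamma x)^-1 <= x * L `^ (- x) * expR (L + 1).
Proof.
move=> x0 L0; have g0 := rgamma_gt0 x0.
have P0 : 0 < L `^ x * expR (- (L + 1)) by rewrite mulr_gt0 ?powR_gt0 ?expR_gt0.
have := rgamma_ge (ltW x0) L0; rewrite rgammaS // => h.
rewrite powRN -mulrA -[expR (L + 1)]invrK -expRN -invfM.
rewrite -[leLHS]mul1r ler_pdivrMr // mulrAC ler_pdivlMr // mul1r.
exact: h.
Qed.

Lemma sin_abs_le (a : R) : `|sin a| <= `|a|.
Proof.
wlog a0 : a / 0 <= a.
  move=> h; case: (leP 0 a) => [|/ltW]; first exact: h.
  by rewrite -oppr_ge0 => /h; rewrite sinN !normrN.
move: a0; rewrite le_eqVlt => /predU1P[<-|a0]; first by rewrite sin0 !normr0.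
have [|c _] := @MVT R sin cos 0 a a0 (fun x _ => is_derive_sin x).
  by apply: continuous_subspaceT => s; exact: continuous_sin.
rewrite sin0 !subr0 => ->; rewrite normrM ler_piMl ?normr_ge0 //.
by rewrite ler_norml cos_geN1 cos_le1.
Qed.

Lemma cos_ge_quadratic (t : R) : 1 - t ^+ 2 / 2 <= cos t.
Proof.
have -> : t = t / 2 + t / 2 by rewrite -splitr.
rewrite cosD; set a := t / 2.
have h : sin a ^+ 2 <= a ^+ 2.
  rewrite -(real_normK (num_real (sin a))) -(real_normK (num_real a)).
  by rewrite ler_pXn2r ?nnegrE ?normr_ge0 // sin_abs_le.
have := cos2Dsin2 a; move: h; rewrite !expr2; lra.
Qed.

Lemma expR_sub_ge (a : R) : 0 <= a -> 2 * a <= expR a - (expR a)^-1.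
Proof.
move=> a0; pose t : R := 1 + a + a ^+ 2 / 2.
have tE : t <= expR a.
  have := exp_partial_le 3 a0; rewrite !big_ord_recr big_ord0 /=.
  by rewrite fact0 expr0 expr1 add0r !divr1 /t.
have t0 : 0 < t by rewrite /t ltr_wpDr ?divr_ge0 ?sqr_ge0 // ltr_wpDr.
have h : (expR a)^-1 <= t^-1 by rewrite lef_pV2 ?posrE ?expR_gt0.
apply: (@le_trans _ _ (t - t^-1)); last by lra.
rewrite lerBrDr -lerBrDl -[leLHS]mul1r ler_pdivrMr // /t.
have a3 : 0 <= a ^+ 4 by rewrite exprn_ge0.
by move: a3; rewrite !exprS expr0 !mulr1; nra.
Qed.

Lemma ln_sq_le (s : R) : 0 < s -> ln s ^+ 2 <= s - 2 + s^-1.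
Proof.
move=> s0; rewrite -[in leRHS](lnK (s0 : s \is Num.pos)).
move: (ln s) => l; wlog l0 : l / 0 <= l.
  move=> h; case: (leP 0 l) => [|/ltW]; first exact: h.
  by rewrite -oppr_ge0 => /h; rewrite expRN invrK sqrrN; lra.
pose T := expR (l / 2).
have T0 : 0 < T by exact: expR_gt0.
have -> : expR l = T ^+ 2 by rewrite expr2 -expRD -splitr.
have h : l <= T - T^-1.
  by have := @expR_sub_ge (l / 2); rewrite (_ : 2 * (l / 2) = l); [apply; rewrite divr_ge0|field].
have -> : T ^+ 2 - 2 + (T ^+ 2)^-1 = (T - T^-1) ^+ 2.
  by field; rewrite gt_eqF.
by rewrite ler_pXn2r ?nnegrE // (le_trans l0).
Qed.

(** For a large abscissa [x] the mass of [s ^ (x - 1) * exp (- x * s)] sits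
    near [s = 1], where [s ^ (i * y)] is close to [1].  Quantitatively, the bounds
    [cos_ge_quadratic] and [ln_sq_le] reduce the real part of the integral to the
    values of the real Gamma function at [x - 1], [x] and [x + 1]. *)
Lemma kGamma_ge_large x y : 1 < x ->
  rgamma x * (1 - y ^+ 2 / (2 * (x - 1))) <= cabs (kGamma 1 (x +i* y)).
Proof.
move=> x1; have x0 : 0 < x by exact: lt_trans x1.
have x10 : 0 < x - 1 by rewrite subr_gt0.
pose z := x +i* y; have z0 : 0 < Re z by [].
pose J (a : R) := laplace (fun s => cpow s%:C (a%:C - 1)) x%:C.
have JE a : 0 < a -> J a = (x `^ (- a) * rgamma a)%:C.
  by move=> a0; rewrite /J laplace_mono_real // kGamma_real // -rmorphN cpow_realE // -rmorphM.
have Jx a : 0 < a -> laplace_exists (fun s => cpow s%:C (a%:C - 1)) x%:C.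
  by move=> a0; apply: laplace_mono_exists.
have xp : 0 < x + 1 by rewrite addr_gt0.
have [i1 e1] := laplaceZ (-2%:R) (Jx x x0).
have [i12 e12] := laplaceD (Jx _ xp) i1.
have [i2 e2] := laplaceD i12 (Jx _ x10).
have [i4 e4] := laplaceZ (- (y ^+ 2 / 2))%:C i2.
have [i5 e5] := laplaceD (Jx x x0) i4.
have iz := laplace_mono_exists z0 (x0 : 0 < Re x%:C).
have pw : 0 < x `^ (- x) by rewrite powR_gt0.
have gE : rgamma x = (x - 1) * rgamma (x - 1) by rewrite -rgammaS // subrK.
have low : Re (laplace (fun s => cpow s%:C (x%:C - 1) + (- (y ^+ 2 / 2))%:C *
      (cpow s%:C ((x + 1)%:C - 1) + - 2%:R * cpow s%:C (x%:C - 1) +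
       cpow s%:C ((x - 1)%:C - 1))) x%:C) =
    x `^ (- x) * (rgamma x * (1 - y ^+ 2 / (2 * (x - 1)))).
  rewrite e5 e4 e2 e12 e1 -/(J x) -/(J (x + 1)) -/(J (x - 1)) !JE //.
  rewrite (@natC R 2) -!rmorphN -!rmorphM -!rmorphD -!rmorphM -!rmorphD ReC rgammaS // gE.
  have e : forall a, x `^ (- (x + a)) = x `^ (- x) * x `^ (- a).
    by move=> a; rewrite opprD powRD // (gt_eqF x0) implybT.
  rewrite !e opprK !powRN !powRr1 ?(ltW x0) //.
  by field; rewrite !gt_eqF ?powR_gt0.
rewrite -(ler_pM2l pw) -low.
have -> : x `^ (- x) * cabs (kGamma 1 z) = cabs (laplace (fun s => cpow s%:C (z - 1)) x%:C).
  by rewrite laplace_mono_real // cabsM cabs_cpow // ReN.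
apply: le_trans (le_trans (ler_norm _) (cabs_Re _)).
rewrite /laplace /cintegral !ReI; apply: le_Rintegral => //; first exact: i5.1.
  exact: iz.1.
move=> s /posP s0.
have -> : cexp (- (x%:C * s%:C)) = (expR (- (x * s)))%:C.
  by rewrite -rmorphM -rmorphN cexpC.
rewrite 2!(ReMC (expR _)) ler_pM2l ?expR_gt0 //.
have -> : cpow s%:C (z - 1) = cpow s%:C (x%:C - 1) * cexp (0 +i* (y * ln s)).
  rewrite !cpowC // -cexpD; congr cexp; apply: cplxP.
    by rewrite ReD !ReM !ReB !ImB ReC ImC /=; ring.
  by rewrite ImD !ImM !ReB !ImB ReC ImC /=; ring.
have e a : cpow s%:C (a%:C - 1) = (s `^ (a - 1))%:C.
  by rewrite -(rmorphB _ a 1) cpow_realE.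
have -> : Re (cpow s%:C (x%:C - 1) * cexp (0 +i* (y * ln s))) =
    s `^ (x - 1) * cos (y * ln s).
  by rewrite e ReMC Re_cexp ReI ImI expR0 mul1r.
rewrite !e.
rewrite (@natC R 2) -!rmorphN -!rmorphM -!rmorphD -!rmorphM -!rmorphD ReC.
have -> : s `^ (x + 1 - 1) = s `^ (x - 1) * s.
  by rewrite addrAC (@powRD _ s (x - 1) 1) ?(gt_eqF s0) ?implybT // powRr1 // ltW.
have -> : s `^ (x - 1 - 1) = s `^ (x - 1) * s^-1.
  by rewrite (@powRD _ s (x - 1) (-1)) ?(gt_eqF s0) ?implybT // powRN powRr1 // ltW.
set P := s `^ (x - 1); have P0 : 0 <= P by exact: powR_ge0.
apply: (@le_trans _ _ (P * (1 - (y * ln s) ^+ 2 / 2))); last first.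
  by rewrite ler_wpM2l // cos_ge_quadratic.
have -> : P + - (y ^+ 2 / 2) * (P * s + - (2%:R) * P + P * s^-1) =
    P * (1 - y ^+ 2 * (s - 2 + s^-1) / 2).
  by field; rewrite gt_eqF.
rewrite ler_wpM2l // lerD2l lerN2 ler_pM2r ?invr_gt0 // exprMn.
by rewrite ler_wpM2l ?sqr_ge0 // ln_sq_le.
Qed.

(** The functional equation carries the bound of [kGamma_ge_large] back to
    every abscissa; each step costs a factor [|1 + i * y / x|], and the sum of
    the resulting exponents telescopes. *)
Lemma kGamma_ge x y : 0 < x ->
  rgamma x / 2 * expR (- (y ^+ 2 / 2 * (x^-1 ^+ 2 + x^-1))) <= cabs (kGamma 1 (x +i* y)).
Proof.
have [N] : exists N : nat, 2 + y ^+ 2 <= x + N%:R.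
  exists (Num.truncn (2 + y ^+ 2 - x)).+1; rewrite -lerBlDl; exact/ltW/truncnS_gt.
have y2 : 0 <= y ^+ 2 by exact: sqr_ge0.
elim: N x => [|N ih] x hx x0; have g0 := rgamma_gt0 x0.
  rewrite addr0 in hx; have x1 : 1 < x by lra.
  apply: le_trans (kGamma_ge_large y x1).
  rewrite -mulrA ler_wpM2l ?(ltW g0) // (@le_trans _ _ 2^-1) //.
    rewrite ler_piMr ?invr_ge0 // -expR0 ler_expR oppr_le0.
    by rewrite mulr_ge0 ?divr_ge0 // addr_ge0 ?sqr_ge0 ?invr_ge0 // ltW.
  rewrite lerBrDl -lerBrDr.
  have -> : 1 - 2^-1 = 2^-1 :> R by field.
  by rewrite ler_pdivrMr ?mulrA ?mulVf ?pnatr_eq0 ?mul1r ?mulr_gt0 ?subr_gt0 //; lra.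
pose c : R[i] := x +i* y; have c0 : 0 < Re c by [].
have := ih (x + 1); rewrite -(addrA x) nat1r => /(_ hx).
have -> : (x + 1) +i* y = c + 1 by apply: cplxP; rewrite ?ReD ?ImD /= ?addr0.
rewrite kGamma1S // cabsM rgammaS // => /(_ (addr_gt0 x0 ltr01)) {}ih.
have cc : 0 < cabs c by rewrite cabs_gt0 Re_gt0_neq0.
have cle : cabs c <= x * expR (y ^+ 2 / 2 * x^-1 ^+ 2).
  rewrite -(@ler_pXn2r _ 2) ?nnegrE ?cabs_ge0 ?mulr_ge0 ?expR_ge0 ?(ltW x0) //.
  rewrite cabs_sq /= exprMn [expR _ ^+ 2]expr2 -expRD -mulrDl -splitr.
  have -> : x ^+ 2 + y ^+ 2 = x ^+ 2 * (1 + y ^+ 2 * x^-1 ^+ 2) by field; rewrite gt_eqF.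
  by rewrite ler_wpM2l ?sqr_ge0 // expR_ge1Dx.
rewrite -(ler_pM2l cc) -/c; apply: le_trans ih.
apply: (@le_trans _ _ (x * expR (y ^+ 2 / 2 * x^-1 ^+ 2) *
    (rgamma x / 2 * expR (- (y ^+ 2 / 2 * (x^-1 ^+ 2 + x^-1)))))).
  by rewrite ler_wpM2r // !mulr_ge0 ?expR_ge0 ?invr_ge0 // ltW.
rewrite (_ : _ * _ = x * rgamma x / 2 * (expR (y ^+ 2 / 2 * x^-1 ^+ 2) *
    expR (- (y ^+ 2 / 2 * (x^-1 ^+ 2 + x^-1))))); last by field.
rewrite -expRD ler_wpM2l ?mulr_ge0 ?invr_ge0 ?(ltW x0) ?(ltW g0) // ler_expR.
have -> : y ^+ 2 / 2 * x^-1 ^+ 2 - y ^+ 2 / 2 * (x^-1 ^+ 2 + x^-1) = - (y ^+ 2 / 2 * x^-1).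
  by field; rewrite gt_eqF.
rewrite lerN2 ler_wpM2l ?divr_ge0 //.
have -> : x^-1 = (x + 1)^-1 * (x^-1 + 1) by field; rewrite !gt_eqF // addr_gt0.
have u0 : 0 <= (x + 1)^-1 by rewrite invr_ge0 addr_ge0 // ltW.
rewrite expr2 mulrDr mulr1 lerD2r ler_wpM2l //.
by rewrite lef_pV2 ?posrE ?addr_gt0 // lerDl.
Qed.

Lemma kGamma1_neq0 z : 0 < Re z -> kGamma 1 z != 0.
Proof.
case: z => x y /= x0; rewrite -cabs_gt0; apply: lt_le_trans (kGamma_ge y x0).
by rewrite !mulr_gt0 ?rgamma_gt0 ?expR_gt0 // invr_gt0.
Qed.

(** In a sector [|Im z| <= Y * Re z] the reciprocal Gamma function decays like
    [L ^ (- Re z)] for every [L]. *)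
Lemma inv_kGamma_le z (Y L : R) : 0 < Re z -> `|Im z| <= Y * Re z -> 0 < L ->
  cabs (kGamma 1 z)^-1 <= 2 * expR (L + 1 + Y ^+ 2 / 2) *
    (expR (Y ^+ 2 / 2 * Re z) * Re z * L `^ (- Re z)).
Proof.
case: z => x y /= x0 hy L0; have g0 := rgamma_gt0 x0.
have xn : x != 0 by rewrite gt_eqF.
have Y0 : 0 <= Y by rewrite -(pmulr_lge0 _ x0) (le_trans _ hy).
have y2 : y ^+ 2 <= Y ^+ 2 * x ^+ 2.
  by rewrite -(real_normK (num_real y)) -exprMn ler_pXn2r ?nnegrE // mulr_ge0 // ltW.
have ee : y ^+ 2 / 2 * (x^-1 ^+ 2 + x^-1) <= Y ^+ 2 / 2 + Y ^+ 2 / 2 * x.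
  have -> : Y ^+ 2 / 2 + Y ^+ 2 / 2 * x = (Y ^+ 2 * x ^+ 2) / 2 * (x^-1 ^+ 2 + x^-1).
    by field.
  rewrite ler_wpM2r ?addr_ge0 ?sqr_ge0 ?invr_ge0 ?(ltW x0) //.
  by rewrite ler_pM2r ?invr_gt0.
have low : rgamma x / 2 * expR (- (Y ^+ 2 / 2 + Y ^+ 2 / 2 * x)) <= cabs (kGamma 1 (x +i* y)).
  apply: le_trans (kGamma_ge y x0); rewrite ler_wpM2l ?divr_ge0 ?(ltW g0) //.
  by rewrite ler_expR lerN2.
have P0 : 0 < rgamma x / 2 * expR (- (Y ^+ 2 / 2 + Y ^+ 2 / 2 * x)).
  by rewrite mulr_gt0 ?expR_gt0 ?divr_gt0.
rewrite cabsV; apply: (@le_trans _ _ (rgamma x / 2 * expR (- (Y ^+ 2 / 2 + Y ^+ 2 / 2 * x)))^-1).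
  by rewrite lef_pV2 ?posrE // (lt_le_trans P0).
rewrite !invfM invrK -expRN opprK.
have := ler_wpM2r (expR_ge0 (Y ^+ 2 / 2 + Y ^+ 2 / 2 * x)) (inv_rgamma_le x0 L0).
rewrite -(ler_pM2l (ltr0n R 2)) => h.
rewrite -mulrA mulrCA; apply: (le_trans h).
by rewrite !expRD le_eqVlt; apply/predU1P; left; ring.
Qed.

End GammaBound.

(** * The Mittag-Leffler kernel and its transform *)

Section Kernel.
Context {R : realType}.
Local Notation mu := (@lebesgue_measure R).
Local Notation RT := (measurableTypeR R).
Local Notation mP := (@measurable_pos R).

Section MittagLeffler.
Variables (a b c q : R[i]).
Hypotheses (a0 : 0 < Re a) (b0 : 0 < Re b).

Let Re_an n : Re (a * n%:R + b) = n%:R * Re a + Re b.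
Proof. by rewrite ReD mulrC (@natC R) ReMC. Qed.

Let Re_an_gt0 n : 0 < Re (a * n%:R + b).
Proof. by rewrite Re_an ltr_wpDl // mulr_ge0 // ltW. Qed.

(** The kernel is, up to a power of [k], the sum of the
    [ml_coef n * s ^ (a n + b - 1)]. *)
Definition ml_coef n : R[i] := bin_coef c n * q ^+ n / kGamma 1 (a * n%:R + b).

(** Taking [L = rho * s] in [inv_kGamma_le] turns [s ^ x] over the Gamma function
    at abscissa [x] into [exp (rho * s)] times a power of [rho ^ (-1)], and a large
    [rho] makes the latter beat [q ^ n]. *)
Lemma ml_coef_sum_le : exists K rho : R, [/\ 0 <= K, 0 < rho & forall (s : R) N, 0 < s ->
  \sum_(n < N) cabs (ml_coef n) * s `^ (n%:R * Re a + Re b) <= K * expR (rho * s)].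
Proof.
pose Y : R := `|Im a| / Re a + `|Im b| / Re b.
have Y0 : 0 <= Y by rewrite addr_ge0 // divr_ge0 // ltW.
have hY n : `|Im (a * n%:R + b)| <= Y * Re (a * n%:R + b).
  rewrite Re_an ImD mulrC (@natC R) ImMC; apply: le_trans (ler_normD _ _) _.
  rewrite mulrDr; apply: lerD.
    rewrite normrM normr_nat mulrCA ler_wpM2l // mulrDl divfK ?gt_eqF //.
    by rewrite lerDl mulr_ge0 ?divr_ge0 // ltW.
  rewrite mulrDl divfK ?gt_eqF // lerDr.
  by rewrite mulr_ge0 ?divr_ge0 // ltW.
pose d : R := 1 + Y ^+ 2 / 2.
have dE : d = 1 + Y ^+ 2 / 2 by [].
(* [p] is the value needed for [theta ^ Re a] to get [cabs q * p <= 1 / 2]. *)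
pose p : R := (2 * (cabs q + 1))^-1.
have q1 : 0 < cabs q + 1 by rewrite ltr_wpDl ?cabs_ge0.
have p0 : 0 < p by rewrite invr_gt0 mulr_gt0.
have qp1 : cabs q * p <= 2^-1.
  by rewrite /p invfM mulrCA ler_piMr ?invr_ge0 // ler_pdivrMr // mul1r lerDl.
pose theta : R := p `^ (Re a)^-1.
have th0 : 0 < theta by exact: powR_gt0.
have thE : theta `^ Re a = p by rewrite -powRrM mulVf ?gt_eqF // powRr1 // ltW.
clearbody theta p d.
pose rho := expR d / theta.
have rho0 : 0 < rho by rewrite divr_gt0 ?expR_gt0.
exists (2 * expR d * theta `^ Re b * (1 - 2^-1) `^ (- cabs c)), rho.
have K0 : 0 <= 2 * expR d * theta `^ Re b * (1 - 2^-1) `^ (- cabs c).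
  by rewrite !mulr_ge0 ?powR_ge0 ?expR_ge0.
split => // s N s0.
have L0 : 0 < rho * s by rewrite mulr_gt0.
have term n : cabs (ml_coef n) * s `^ (n%:R * Re a + Re b) <=
    2 * expR d * theta `^ Re b * expR (rho * s) * (cabs (bin_coef c n) * 2^-1 ^+ n).
  have x0 := Re_an_gt0 n; rewrite -Re_an; set x := Re _ in x0 *.
  have := inv_kGamma_le x0 (hY n) L0; rewrite -/x => h.
  rewrite /ml_coef (cabsM (_ * _)) (cabsM (bin_coef c n)) cabsX.
  have e1 : expR (Y ^+ 2 / 2 * x) * x * ((rho * s) `^ (- x) * s `^ x) <= theta `^ x.
    have -> : (rho * s) `^ (- x) * s `^ x = rho `^ (- x).
      rewrite powRM ?(ltW rho0) ?(ltW s0) // -mulrA -powRD; last first.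
        by rewrite (gt_eqF s0) implybT.
      by rewrite addNr powRr0 mulr1.
    rewrite /rho powRM ?expR_ge0 ?invr_ge0 ?(ltW th0) //.
    have -> : (theta^-1) `^ (- x) = theta `^ x.
      by rewrite -(powR_inv1 (ltW th0)) -powRrM mulN1r opprK.
    have -> : expR d `^ (- x) = expR (- (d * x)).
      by rewrite /powR gt_eqF ?expR_gt0 // expRK mulNr mulrC.
    rewrite mulrA ler_piMl ?powR_ge0 // expRN ler_pdivrMr ?expR_gt0 // mul1r.
    rewrite dE mulrDl mul1r addrC expRD ler_wpM2l ?expR_ge0 //.
    by apply: le_trans (expR_ge1Dx x); rewrite lerDr.
  have e2 : theta `^ x = theta `^ Re b * p ^+ n.
    rewrite /x Re_an powRD ?(gt_eqF th0) ?implybT // mulrC mulrC [n%:R * _]mulrC.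
    by rewrite powRrM thE powR_mulrn ?(ltW p0) // mulrC.
  have qp : cabs q ^+ n * p ^+ n <= 2^-1 ^+ n.
    by rewrite -exprMn lerXn2r ?nnegrE ?mulr_ge0 ?cabs_ge0 ?(ltW p0) ?invr_ge0.
  apply: (@le_trans _ _ (cabs (bin_coef c n) * cabs q ^+ n *
      (2 * expR (rho * s + d)) * (theta `^ Re b * p ^+ n))).
    rewrite -(mulrA (_ * _)) -(mulrA (_ * _) (2 * _)) ler_wpM2l ?mulr_ge0 ?exprn_ge0 ?cabs_ge0 // -e2.
    apply: le_trans (ler_wpM2r (powR_ge0 _ _) h) _.
    rewrite dE (addrA (rho * s)) -[leLHS]mulrA ler_wpM2l ?mulr_ge0 ?expR_ge0 //.
    by rewrite -[leLHS]mulrA.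
  rewrite expRD (_ : _ * _ = 2 * expR d * theta `^ Re b * expR (rho * s) *
    (cabs (bin_coef c n) * (cabs q ^+ n * p ^+ n))); last by ring.
  by rewrite ler_wpM2l ?mulr_ge0 ?expR_ge0 ?powR_ge0 // ler_wpM2l ?cabs_ge0.
apply: (@le_trans _ _ (\sum_(n < N) 2 * expR d * theta `^ Re b * expR (rho * s) *
    (cabs (bin_coef c n) * 2^-1 ^+ n))); first by apply: ler_sum => n _; exact: term.
rewrite -mulr_sumr mulrAC ler_wpM2r ?expR_ge0 // ler_wpM2l ?mulr_ge0 ?expR_ge0 ?powR_ge0 //.
by apply: bin_coef_sum_le; lra.
Qed.

(** The factor [exp (rho * s)] absorbs the growth at infinity; near the origin
    the first term dominates. *)
Lemma ml_terms_le : exists K rho : R, 0 < rho /\ forall (s : R) N, 0 < s ->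
  \sum_(n < N) cabs (ml_coef n * cpow s%:C (a * n%:R + b - 1)) <=
  K * (s `^ (Re b - 1) * expR (rho * s)).
Proof.
have [K [rho [K0 rho0 h]]] := ml_coef_sum_le.
exists (K * expR rho), rho; split => // s N s0.
have sD (x y : R) : s `^ (x + y) = s `^ x * s `^ y.
  by rewrite powRD // (gt_eqF s0) implybT.
have e1 : 1 <= expR rho by rewrite -expR0 ler_expR ltW.
have -> : \sum_(n < N) cabs (ml_coef n * cpow s%:C (a * n%:R + b - 1)) =
    s `^ (- 1) * \sum_(n < N) cabs (ml_coef n) * s `^ (n%:R * Re a + Re b).
  rewrite mulr_sumr; apply: eq_bigr => n _.
  by rewrite cabsM cabs_cpow // ReB (ReC 1) Re_an (sD _ (-1)); ring.
rewrite sD; case: (leP 1 s) => s1.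
  apply: le_trans (ler_wpM2l (powR_ge0 _ _) (h s N s0)) _.
  have p1 : 1 <= s `^ Re b 
    by rewrite /powR gt_eqF // -expR0 ler_expR mulr_ge0 ?ln_ge0 // ltW.
  rewrite [leLHS](_ : _ = 1 * 1 * (K * s `^ (-1) * expR (rho * s))); last by ring.
  rewrite [leRHS](_ : _ = expR rho * s `^ Re b * (K * s `^ (-1) * expR (rho * s))); last by ring.
  by rewrite ler_wpM2r ?mulr_ge0 ?powR_ge0 ?expR_ge0 // ler_pM.
apply: (@le_trans _ _ (s `^ (-1) * (s `^ Re b * (K * expR rho)))).
  rewrite ler_wpM2l ?powR_ge0 //.
  apply: (@le_trans _ _ (s `^ Re b * \sum_(n < N) cabs (ml_coef n) * 1 `^ (n%:R * Re a + Re b))).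
    rewrite mulr_sumr; apply: ler_sum => n _; rewrite powR1 mulr1 sD.
    rewrite [leRHS]mulrC ler_wpM2l ?cabs_ge0 // ler_piMl ?powR_ge0 //.
    rewrite /powR gt_eqF // -[leRHS]expR0 ler_expR mulr_ge0_le0 ?mulr_ge0 ?(ltW a0) //.
    by rewrite ln_le0 // ltW.
  by rewrite ler_wpM2l ?powR_ge0 //; have := h (1 : R) N ltr01; rewrite mulr1.
rewrite [leRHS](_ : _ = s `^ (-1) * (s `^ Re b * (K * expR rho)) * expR (rho * s)); last by ring.
rewrite ler_peMr ?mulr_ge0 ?powR_ge0 ?expR_ge0 //.
by rewrite -expR0 ler_expR mulr_ge0 // ltW.
Qed.

Lemma ml_csum (s : R) : 0 < s ->
  exists l, csum (fun n => ml_coef n * cpow s%:C (a * n%:R + b - 1)) l.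
Proof.
by move=> s0; have [K [rho [_ h]]] := ml_terms_le; apply: abs_csum => n; exact: h.
Qed.

(** Each power contributes a Gamma factor that cancels the one in [ml_coef]; what
    remains is a binomial series. *)
Lemma laplace_ml (phi : R -> R[i]) :
  (forall s : R, 0 < s -> csum (fun n => ml_coef n * cpow s%:C (a * n%:R + b - 1)) (phi s)) ->
  exists2 rho : R, 0 < rho & forall w, rho < Re w -> laplace_exists phi w /\
    csum (fun n => bin_coef c n * q ^+ n * cpow w (- (a * n%:R + b))) (laplace phi w).
Proof.
move=> hphi; have [K [rho [rho0 h]]] := ml_terms_le.
exists rho => // w rw; have w0 : 0 < Re w by exact: lt_trans rw.
pose g_ n (s : R) := ml_coef n * (cexp (- (w * s%:C)) * cpow s%:C (a * n%:R + b - 1)).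
have [ig sg] : cintegrable pos (fun s => cexp (- (w * s%:C)) * phi s) /\
    csum (fun n => cintegral pos (g_ n))
      (cintegral pos (fun s => cexp (- (w * s%:C)) * phi s)).
  apply: (csum_integral mP (h := fun s =>
      K * (s `^ (Re b - 1) * expR (- ((Re w - rho) * s))))).
  - move=> n; apply: cmeasZ; apply: cmeasM; first exact: cmeas_kernel.
    exact: cmeas_mono.
  - move=> s /posP s0; have := csumZ (cexp (- (w * s%:C))) (hphi s s0).
    by apply: eq_csum => n; rewrite /g_ mulrCA.
  - apply: (rintegrableZ mP K (f := fun s => s `^ (Re b - 1) * expR (- ((Re w - rho) * s)))).
    by apply: integrable_gamma => //; rewrite subr_gt0.
  - move=> n s /posP s0.
    have -> : \sum_(i < n) cabs (g_ i s) = expR (- (Re w * s)) *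
       \sum_(i < n) cabs (ml_coef i * cpow s%:C (a * i%:R + b - 1)).
      rewrite mulr_sumr; apply: eq_bigr => i _.
      by rewrite /g_ (mulrCA (ml_coef i)) (cabsM (cexp _)) cabs_kernel.
    apply: le_trans (ler_wpM2l (expR_ge0 _) (h s n s0)) _.
    have -> : - ((Re w - rho) * s) = - (Re w * s) + rho * s by ring.
    by rewrite expRD le_eqVlt; apply/predU1P; left; ring.
split => //; apply: eq_csum sg => n.
have ex := laplace_mono_exists (Re_an_gt0 n) w0.
rewrite /g_ (cintegralZ mP) // -/(laplace (fun s => cpow s%:C (a * n%:R + b - 1)) w).
by rewrite laplace_mono // /ml_coef mulrCA mulrC divfK // kGamma1_neq0.
Qed.

End MittagLeffler.

Lemma kpochE (k : R) (gam : R[i]) n : 0 < k ->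
  kpoch k gam n = k%:C ^+ n * rising (gam / k%:C) n.
Proof.
move=> k0; elim: n => [|n ih]; first by rewrite /kpoch /rising !big_ord0 mulr1.
rewrite risingS exprS /kpoch big_ord_recr /= -/(kpoch k gam n) ih.
by field; rewrite real_neq0.
Qed.

(** The powers of [k] in the symbols [kpoch] and [kGamma] recombine, up to the
    common factor [k ^ (- b)], into powers of [omega * k * k ^ (- a)]. *)
Lemma kernel_csum (k : R) (alpha nu omega gam : R[i]) (s : R) :
  0 < k -> 0 < Re alpha -> 0 < Re nu -> 0 < s ->
  csum (fun n => ml_coef (alpha / k%:C) (nu / k%:C) (gam / k%:C)
      (omega * k%:C * cpow k%:C (- (alpha / k%:C))) n *
      cpow s%:C (alpha / k%:C * n%:R + nu / k%:C - 1))
    (cpow k%:C (nu / k%:C) * (cpow s%:C (nu / k%:C - 1) / k%:C *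
      kML k alpha nu gam (omega * cpow s%:C (alpha / k%:C)))).
Proof.
move=> k0 al0 nu0 s0.
have kV z : Re (z / k%:C) = Re z / k by rewrite mulrC -fmorphV ReMC mulrC.
have a0 : 0 < Re (alpha / k%:C) by rewrite kV divr_gt0.
have b0 : 0 < Re (nu / k%:C) by rewrite kV divr_gt0.
have kn : k%:C != 0 :> R[i] by exact: real_neq0.
have sn : s%:C != 0 :> R[i] by exact: real_neq0.
set a := alpha / k%:C in a0 *; set b := nu / k%:C in b0 *; set c := gam / k%:C.
set q := omega * k%:C * _.
have [l hl] := ml_csum c q a0 b0 s0.
pose v := cpow k%:C b * (cpow s%:C (b - 1) / k%:C).
have v0 : v != 0 by rewrite !mulf_neq0 ?invr_neq0 ?cpow_neq0.
have termE n : kpoch k gam n / kGamma k (alpha * n%:R + nu) *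
    ((omega * cpow s%:C a) ^+ n / n`!%:R) =
    v^-1 * (ml_coef a b c q n * cpow s%:C (a * n%:R + b - 1)).
  have xn0 : 0 < Re (alpha * n%:R + nu).
    by rewrite ReD mulrC (@natC R) ReMC ltr_wpDl // mulr_ge0 // ltW.
  have e : (alpha * n%:R + nu) / k%:C = a * n%:R + b by rewrite mulrDl mulrAC.
  have g0 : kGamma 1 (a * n%:R + b) != 0.
    by apply: kGamma1_neq0; rewrite -e kV divr_gt0.
  rewrite kGammaE // e kpochE // /ml_coef /v /bin_coef /q !exprMn.
  rewrite -addrA !cpowD // !cpowN // cpow1 // exprVn -/c.
  have pa z : z != 0 -> cpow z (a * n%:R) = cpow z a ^+ n.
    by move=> z0; rewrite mulrC -cpowX.
  rewrite !pa // fmorphV.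
  field.
  by rewrite g0 kn sn !expf_neq0 ?cpow_neq0 // pnatr_eq0 -lt0n fact_gt0.
have := csumZ v^-1 hl => /(eq_csum (fun n => esym (termE n))) hs.
have -> : kML k alpha nu gam (omega * cpow s%:C a) = v^-1 * l.
  apply: ccvg_lim; apply: ccvg_eq hs => n; by rewrite /series /= big_mkord.
have -> : cpow k%:C b * (cpow s%:C (b - 1) / k%:C * (v^-1 * l)) = l.
  by rewrite mulrA -/v mulVKf.
exact: hl.
Qed.

End Kernel.

Section Ray.
Context {R : realType}.
Local Notation mu := (@lebesgue_measure R).
Local Notation RT := (measurableTypeR R).
Local Notation mP := (@measurable_pos R).

Lemma expandsZ (z : R[i]) (G : R -> R[i]) (t r M : R) a : expands G t r M a ->
  expands (fun s => z * G s) t r (cabs z * M) (fun n => z * a n).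
Proof.
move=> ga n h hr; under eq_bigr do rewrite -mulrA.
rewrite -mulr_sumr -mulrBr cabsM -mulrA ler_wpM2l ?cabs_ge0 //; exact: ga.
Qed.

Lemma expands_le (G : R -> R[i]) (t r r' M M' : R) a : 0 < r' -> r' <= r -> M <= M' ->
  expands G t r M a -> expands G t r' M' a.
Proof.
move=> r'0 rr' MM' ga n h hr; have r0 := lt_le_trans r'0 rr'.
have M0 : 0 <= M by exact: expands_ge0 ga.
apply: le_trans (ga n h (le_trans hr rr')) _.
rewrite ler_pM ?exprn_ge0 ?divr_ge0 ?(ltW r0) // lerXn2r ?nnegrE ?divr_ge0 ?(ltW r0) ?(ltW r'0) //.
by rewrite ler_wpM2l // lef_pV2 ?posrE.
Qed.

Lemma expands_cvg (G : R -> R[i]) (t r M : R) a (t_ : nat -> R) : 0 < r ->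
  expands G t r M a -> t_ @ \oo --> t -> ccvg (fun n => G (t_ n)) (G t).
Proof.
move=> r0 ga tc; have M0 := expands_ge0 r0 ga.
have aE : a 0%N = G t.
  have := ga 1%N 0; rewrite normr0 mul0r expr0n mulr0 big_ord1 expr0 mulr1 addr0.
  move=> /(_ (ltW r0)) h0; apply/eqP.
  by rewrite eq_sym -subr_eq0 -cabs_eq0 eq_le h0 cabs_ge0.
apply: (ccvg_squeeze (e := fun n => cabs (G (t_ n) - G t))) => //.
apply/cvgrPdist_le => e e0; near=> n.
rewrite sub0r normrN ger0_norm ?cabs_ge0 //.
have d1 : `|t_ n - t| <= r.
  by rewrite distrC; near: n; move/cvgrPdist_le : tc => /(_ r r0).
have d2 : `|t_ n - t| <= e * r / (M + 1).
  rewrite distrC; near: n; move/cvgrPdist_le : tc; apply.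
  by rewrite divr_gt0 ?mulr_gt0 // ltr_wpDl.
have := ga 1%N _ d1; rewrite subrKC big_ord1 expr0 mulr1 aE expr1 => /le_trans; apply.
rewrite mulrA ler_pdivrMr //.
apply: (@le_trans _ _ ((M + 1) * `|t_ n - t|)); first by rewrite ler_wpM2r // lerDl.
by rewrite mulrC -ler_pdivlMr // ltr_wpDl.
Unshelve. all: by end_near. Qed.

(** * Transforms along a ray *)

Lemma cabs_kernel_ray (u : R[i]) (t s : R) : 0 < Re u -> 1 <= t -> 0 < s ->
  cabs (cexp (- (t%:C * u * s%:C))) <= cabs (cexp (- (u * s%:C))).
Proof.
move=> u0 t1 s0; rewrite !cabs_kernel ReMC ler_expR lerN2 ler_wpM2r ?(ltW s0) //.
by rewrite ler_peMl // ltW.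
Qed.

Lemma laplace_exists_cmeas (h : R -> R[i]) u : laplace_exists h u -> cmeas (pos : set RT) h.
Proof.
move=> /cintegrable_cmeas hm.
apply: (@eq_cmeas _ RT R pos (fun s : RT => cexp (- (- u * s%:C)) * (cexp (- (u * s%:C)) * h s))).
  by move=> s _; rewrite mulrA -cexpD mulNr opprK subrr cexp0 mul1r.
by apply: cmeasM => //; exact: cmeas_kernel.
Qed.

Lemma laplace_exists_ray (h : R -> R[i]) u (t : R) : 0 < Re u -> 1 <= t ->
  laplace_exists h u -> laplace_exists h (t%:C * u).
Proof.
move=> u0 t1 hu; have hm := laplace_exists_cmeas hu.
apply: (cintegrable_dom mP _ (cintegrable_abs mP hu)).
  by apply: cmeasM => //; exact: cmeas_kernel.
move=> s /posP s0; rewrite 2!(cabsM (cexp _)) ler_wpM2r ?cabs_ge0 //.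
exact: cabs_kernel_ray.
Qed.

(** Absolute convergence at [u] pays for the power series of the kernel at
    [t * u], whose radius is bounded below as long as [t] stays away from [1]. *)
Lemma expands_laplace (h : R -> R[i]) u (t r : R) : 0 < Re u -> 0 < r -> 1 <= t ->
  r * cabs u <= (t - 1) * Re u -> laplace_exists h u ->
  exists M a, expands (fun s => laplace h (s%:C * u)) t r M a.
Proof.
move=> u0 r0 t1 hr hu; have hm := laplace_exists_cmeas hu.
have ha := cintegrable_abs mP hu.
pose m (s : R) := cabs (cexp (- (u * s%:C)) * h s).
pose A (n : nat) (s : R) := cexp (- (t%:C * u * s%:C)) * ((- (u * s%:C)) ^+ n / n`!%:R) * h s.
have expa (s : R) : 0 < s ->
    expands (fun v => cexp (- (v%:C * u * s%:C)) * h s) t r (m s) (A^~ s).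
  move=> s0; have [a [ea aE]] := expands_cexp (u * s%:C) t r0.
  have := expandsZ (h s) ea.
  have le1 : cabs (h s) * expR (r * cabs (u * s%:C) - t * Re (u * s%:C)) <= m s.
    rewrite /m (cabsM (cexp _)) mulrC ler_wpM2r ?cabs_ge0 // cabs_kernel ler_expR.
    rewrite cabsM cabsC gtr0_norm // [u * _]mulrC ReMC.
    have := ler_wpM2r (ltW s0) hr; lra.
  move=> /(expands_le r0 (lexx r) le1) e n v hv; have := e n v hv.
  rewrite (eq_bigr (fun i : 'I_n => A i s * v%:C ^+ i)); last first.
    by move=> i _; rewrite aE /A (mulrA t%:C); move: (_ ^+ i / _) => z; ring.
  by rewrite [h s * _]mulrC !mulrA.
have iA n : cintegrable pos (A n).
  apply: (cintegrable_dom mP (h := fun s => 2 / r ^+ n * m s)).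
  - apply: cmeasM => //; apply: cmeasM; first exact: cmeas_kernel.
    under eq_fun do rewrite -mulNr exprMn mulrC mulrA -rmorphXn.
    apply: cmeasZ; apply: cmeas_real; apply: measurable_pos_cont => s s0.
    exact: exprn_continuous.
  - exact: (rintegrableZ mP _ ha).
  - move=> s /posP s0; have := expands_coef n r0 (expa s s0).
    by rewrite mulrAC ler_pdivlMr ?exprn_gt0.
exists (\int[mu]_(s in pos) m s), (fun n => cintegral pos (A n)) => n v hv.
have uc : 0 < cabs u by rewrite cabs_gt0 Re_gt0_neq0.
have rt : r <= t - 1.
  rewrite -(ler_pM2r uc); apply: (le_trans hr); rewrite ler_wpM2l ?subr_ge0 //.
  exact: le_trans (ler_norm _) (cabs_Re u).
have tv1 : 1 <= t + v.
  by have := ler_norm (- v); rewrite normrN => nv; have := le_trans nv hv; lra.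
have i1 := laplace_exists_ray u0 tv1 hu.
have i2 : cintegrable pos (fun s => \sum_(i < n) A i s * v%:C ^+ i).
  apply: (cintegrable_sum mP n (g := fun i s => A i s * v%:C ^+ i)) => i.
  exact: (eq_cintegrable mP (fun s _ => mulrC _ _) (cintegrableZ mP (v%:C ^+ i) (iA i))).
have -> : laplace h ((t + v)%:C * u) - \sum_(i < n) cintegral pos (A i) * v%:C ^+ i =
    cintegral pos (fun s => cexp (- ((t + v)%:C * u * s%:C)) * h s -
      \sum_(i < n) A i s * v%:C ^+ i).
  rewrite (cintegralB mP i1 i2); congr (_ - _).
  rewrite (cintegral_sum mP n (g := fun i s => A i s * v%:C ^+ i)); last first.
    by move=> i; exact: (eq_cintegrable mP (fun s _ => mulrC _ _) (cintegrableZ mP (v%:C ^+ i) (iA i))).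
  apply: eq_bigr => i _; rewrite mulrC -(cintegralZ mP) //.
  by apply: eq_cintegral => s _; rewrite mulrC.
have i3 := cintegrableB mP i1 i2.
apply: le_trans (cabs_cintegral mP i3) _.
rewrite -(RintegralZr _ mP ha); apply: le_Rintegral => //.
- exact: mP.
- exact: (cintegrable_abs mP i3).
- have := rintegrableZ mP ((`|v| / r) ^+ n) ha.
  by apply: (eq_integrable mP) => s _ /=; rewrite mulrC.
- move=> s /posP s0; exact: (expa s s0 n v hv).
Qed.

Lemma laplace_cvg_ray (h : R -> R[i]) u (t_ : nat -> R) : 0 < Re u ->
  (forall n, 1 <= t_ n) -> t_ @ \oo --> (1 : R) -> laplace_exists h u ->
  ccvg (fun n => laplace h ((t_ n)%:C * u)) (laplace h u).
Proof.
move=> u0 t1 tc hu; have hm := laplace_exists_cmeas hu.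
apply: (cdominated mP (g_ := fun n s => cexp (- ((t_ n)%:C * u * s%:C)) * h s)
  (h := fun s => cabs (cexp (- (u * s%:C)) * h s))).
- by move=> n; apply: cmeasM => //; exact: cmeas_kernel.
- move=> s /posP s0; apply: ccvgM; last exact: ccvg_cst.
  have [e [ee _]] := expands_cexp (u * s%:C) 1 (@ltr01 R).
  have := expands_cvg ltr01 ee tc; rewrite mul1r.
  by apply: ccvg_eq => n; rewrite mulrA.
- exact: (cintegrable_abs mP hu).
- move=> n s /posP s0; rewrite 2!(cabsM (cexp _)) ler_wpM2r ?cabs_ge0 //.
  exact: cabs_kernel_ray.
Qed.

(** * The symbol of the kernel *)

Section Symbol.
Variables (a b c q : R[i]).

(** The sum of the binomial series of [laplace_ml]: the transform of the kernel
    where the latter converges, and its continuation elsewhere. *)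
Definition symbol w : R[i] := cpow w (- b) * cpow (1 - q * cpow w (- a)) (- c).

Lemma csum_symbol w : w != 0 -> cabs (q * cpow w (- a)) < 1 ->
  csum (fun n => bin_coef c n * q ^+ n * cpow w (- (a * n%:R + b))) (symbol w).
Proof.
move=> w0 qw; have := csumZ (cpow w (- b)) (csum_binomial c qw).
apply: eq_csum => n; rewrite exprMn cpowX // opprD cpowD // -mulrN mulrC.
by rewrite [_ * - a]mulrN mulrN [_ * a]mulrC -!mulrA.
Qed.

(** As [cabs (q * cpow u (- a)) < 1] is strict, the binomial series still
    converges after a shift of [t >= 1] by at most some fixed [y], even with each
    power replaced by the majorant of its own expansion. *)
Lemma expands_symbol u : 0 < Re a -> u != 0 -> cabs (q * cpow u (- a)) < 1 ->
  exists2 y : R, 0 < y & forall t : R, 1 <= t ->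
    exists M d, expands (fun s => symbol (s%:C * u)) t y M d.
Proof.
move=> a0 u0; set Q := cabs _ => Q1; have Q0 : 0 <= Q by exact: cabs_ge0.
have ca : 0 < cabs a by rewrite cabs_gt0 Re_gt0_neq0.
pose P := (Q + 1) / 2; have P0 : 0 < P by rewrite /P; lra.
have P1 : P < 1 by rewrite /P; lra.
have QP : Q < P by rewrite /P; lra.
pose x := P `^ (cabs a)^-1; have x0 : 0 < x by exact: powR_gt0.
have xP : x `^ cabs a = P by rewrite -powRrM mulVf ?gt_eqF // powRr1 // ltW.
have x1 : x < 1.
  by rewrite /x /powR gt_eqF // -expR0 ltr_expR pmulr_rlt0 ?invr_gt0 // ln_lt0 // P0.
have xle (m m' : R) : (x `^ m <= x `^ m') = (m' <= m).
  by rewrite /powR gt_eqF // ler_expR ler_nM2r // ln_lt0 // x0.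
clearbody x P.
have y0 : 0 < 1 - x by rewrite subr_gt0.
have y1 : 1 - x < 1 by lra.
exists (1 - x) => // t t1; have t0 : 0 < t by exact: lt_le_trans t1.
have yt : 1 - x <= (1 - x) * t by rewrite ler_peMr // ltW.
have low (h : R) : `|h| <= 1 - x -> x <= t + h.
  by move=> hx; have := ler_norm (- h); rewrite normrN; lra.
have QPs n : \sum_(i < n) cabs (bin_coef c i) * (Q / P) ^+ i <= (1 - Q / P) `^ (- cabs c).
  by apply: bin_coef_sum_le; [rewrite divr_ge0 // ltW|rewrite ltr_pdivrMr // mul1r].
pose z n := - (a * n%:R + b).
pose K := cabs (cpow u (- b)) * t `^ `|Re b| * x `^ (- cabs b).
have K0 : 0 <= K by rewrite !mulr_ge0 ?cabs_ge0 ?powR_ge0.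
have term n : exists d, expands (fun s => bin_coef c n * q ^+ n * cpow (s%:C * u) (z n)) t (1 - x)
    (K * (cabs (bin_coef c n) * (Q / P) ^+ n)) d.
  have [d ed] := expands_cpow (z n) t0 y0 y1.
  have := expandsZ (bin_coef c n * q ^+ n * cpow u (z n)) ed.
  have -> : 1 - (1 - x) = x by ring.
  move=> ed'.
  have kE : cabs (bin_coef c n * q ^+ n * cpow u (z n)) =
      cabs (cpow u (- b)) * (cabs (bin_coef c n) * Q ^+ n).
    have -> : cpow u (z n) = cpow u (- b) * cpow u (- a) ^+ n.
      by rewrite cpowX // -cpowD //; congr cpow; rewrite /z; ring.
    rewrite mulrCA cabsM -mulrA -exprMn (cabsM (bin_coef c n)).
    by rewrite (cabsX (q * _)).
  exists (fun m => bin_coef c n * q ^+ n * cpow u (z n) * d m).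
  have le : cabs (bin_coef c n * q ^+ n * cpow u (z n)) *
      (t `^ Re (z n) * x `^ (- cabs (z n))) <= K * (cabs (bin_coef c n) * (Q / P) ^+ n).
    have e1 : t `^ Re (z n) <= t `^ `|Re b|.
      apply: ler_powR => //; rewrite ReN ReD mulrC (@natC R) ReMC opprD.
      have : 0 <= n%:R * Re a by rewrite mulr_ge0 // ltW.
      by have := ler_norm (- Re b); rewrite normrN; lra.
    have e2 : x `^ (- cabs (z n)) <= x `^ (- cabs b) * P^-1 ^+ n.
      have -> : x `^ (- cabs b) * P^-1 ^+ n = x `^ (- (n%:R * cabs a + cabs b)).
        rewrite opprD powRD ?(gt_eqF x0) ?implybT // mulrC; congr (_ * _).
        by rewrite powRN mulrC powRrM xP powR_mulrn ?(ltW P0) // exprVn.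
      rewrite xle // lerN2 /z cabsN; apply: le_trans (cabsD _ _) _.
      by rewrite cabsM cabs_nat [cabs a * _]mulrC.
    rewrite kE /K exprMn.
    rewrite [leRHS](_ : _ = cabs (cpow u (- b)) * (cabs (bin_coef c n) * Q ^+ n) *
      (t `^ `|Re b| * (x `^ (- cabs b) * P^-1 ^+ n))); last by ring.
    rewrite ler_wpM2l ?mulr_ge0 ?exprn_ge0 ?cabs_ge0 //.
    by rewrite ler_pM ?powR_ge0.
  have ed2 := expands_le y0 yt le ed'.
  move=> m h hh; have th : 0 < t + h by exact: lt_le_trans (low h hh).
  by rewrite cpowM // [cpow (t + h)%:C _ * _]mulrC (mulrA _ (cpow u _)); exact: ed2 m h hh.
have [d_ dE] := choice term.
have hs n : \sum_(i < n) K * (cabs (bin_coef c i) * (Q / P) ^+ i) <=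
    K * (1 - Q / P) `^ (- cabs c).
  by rewrite -mulr_sumr ler_wpM2l.
have hc (h : R) : `|h| <= 1 - x ->
    csum (fun n => bin_coef c n * q ^+ n * cpow ((t + h)%:C * u) (z n)) (symbol ((t + h)%:C * u)).
  move=> hh; have th : 0 < t + h by exact: lt_le_trans (low h hh).
  have w0 : (t + h)%:C * u != 0 by rewrite mulf_neq0 ?real_neq0.
  apply: csum_symbol => //; rewrite cpowM // mulrCA cabsM cabs_cpow // ReN -/Q.
  apply: (@le_lt_trans _ _ (P^-1 * Q)); last by rewrite mulrC ltr_pdivrMr // mul1r.
  rewrite ler_wpM2r // -xP -powRN /powR !gt_eqF // ler_expR.
  have lx : ln x <= 0 by rewrite ln_le0 // ltW.
  have lt : ln x <= ln (t + h) by rewrite ler_ln ?posrE // low.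
  have h1 := ler_wpM2l (ltW a0) lt.
  have h2 := ler_wnM2r lx (le_trans (ler_norm _) (cabs_Re a)).
  by rewrite !mulNr lerN2 (le_trans h2).
have [d hd] := expands_sum (G := fun s => symbol (s%:C * u))
  (G_ := fun n s => bin_coef c n * q ^+ n * cpow (s%:C * u) (z n)) y0 dE hs hc.
by exists (K * (1 - Q / P) `^ (- cabs c)), d.
Qed.

End Symbol.

(** Along the ray [t * u] both sides expand in powers of [t] with radii that do
    not shrink as [t] grows, so that equality for large [t] descends to all
    [t > 1]; dominated convergence then gives [t = 1]. *)
Lemma laplace_symbol (a b c q u : R[i]) (g f : R -> R[i]) (rho : R) :
  0 < Re a -> 0 < Re u -> cabs (q * cpow u (- a)) < 1 ->
  laplace_exists g u -> laplace_exists f u ->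
  (forall w, rho < Re w -> cabs (q * cpow w (- a)) < 1 -> laplace_exists f w ->
    laplace g w = symbol a b c q w * laplace f w) ->
  laplace g u = symbol a b c q u * laplace f u.
Proof.
move=> a0 u0 qu ig jf hlarge; have un : u != 0 by exact: Re_gt0_neq0.
have uc : 0 < cabs u by rewrite cabs_gt0.
have [y y0 expS] := expands_symbol b c a0 un qu.
pose H (t : R) := laplace g (t%:C * u) - symbol a b c q (t%:C * u) * laplace f (t%:C * u).
have H0 (t1 : R) : 1 < t1 -> H t1 = 0.
  move=> t11; pose r : R := (t1 - 1) * Re u / cabs u.
  have t10 : 0 < t1 - 1 by rewrite subr_gt0.
  have r0 : 0 < r by rewrite divr_gt0 // mulr_gt0.
  pose r1 := Num.min r y; have r10 : 0 < r1 by rewrite lt_min r0.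
  have r1r : r1 <= r by rewrite ge_min lexx.
  have r1y : r1 <= y by rewrite ge_min lexx orbT.
  have r20 : 0 < r1 / 2 by rewrite divr_gt0.
  have r21 : r1 / 2 <= r1 by lra.
  have hr (t : R) : t1 <= t -> r1 * cabs u <= (t - 1) * Re u.
    move=> t1t; apply: (@le_trans _ _ (r * cabs u)); first by rewrite ler_wpM2r ?cabs_ge0.
    by rewrite /r divfK ?gt_eqF // ler_wpM2r ?(ltW u0) // lerD2r.
  apply: (expands_ray_eq0 (G := H) (T := Num.max 1 ((rho + 1) / Re u)) r20 _ _ (lexx t1)).
    move=> t t1t; have t1' : 1 <= t by rewrite (le_trans (ltW t11)).
    have [Mg [ag eg]] := expands_laplace u0 r10 t1' (hr t t1t) ig.
    have [Mf [af ef]] := expands_laplace u0 r10 t1' (hr t t1t) jf.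
    have [Ms [as_ es]] := expS t t1'.
    have es1 := expands_le r10 r1y (lexx Ms) es.
    have eSf := expandsM r10 es1 ef.
    have eg1 := expands_le r20 r21 (lexx Mg) eg.
    by eexists; eexists; exact: expandsB eg1 eSf.
  move=> t; rewrite ge_max => /andP[t1' tr]; apply/eqP; rewrite subr_eq0; apply/eqP.
  have t0 : 0 < t by exact: lt_le_trans t1'.
  apply: hlarge; last exact: laplace_exists_ray.
    by move: tr; rewrite ler_pdivrMr // ReMC; lra.
  rewrite cpowM // mulrCA cabsM cabs_cpow // ReN.
  apply: le_lt_trans qu; rewrite ler_piMl ?cabs_ge0 // /powR gt_eqF // -expR0 ler_expR.
  by rewrite mulNr oppr_le0 mulr_ge0 ?(ltW a0) // ln_ge0.
pose t_ (n : nat) : R := 1 + n.+1%:R^-1.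
have tc : t_ @ \oo --> (1 : R).
  by rewrite -[X in _ --> X]addr0; apply: cvgD; [exact: cvg_cst|exact: cvg_harmonic].
have t1 n : 1 < t_ n by rewrite ltrDl invr_gt0.
have cg := laplace_cvg_ray u0 (fun n => ltW (t1 n)) tc ig.
have cf := laplace_cvg_ray u0 (fun n => ltW (t1 n)) tc jf.
have [M [d ed]] := expS 1 (lexx 1).
have := expands_cvg y0 ed tc; rewrite mul1r => /ccvgM => /(_ _ _ cf) cS.
apply: (ccvg_unique cg); apply: ccvg_eq cS => n.
by apply/eqP; rewrite eq_sym -subr_eq0; apply/eqP; exact: H0.
Qed.

End Ray.

(** * Transforms of derivatives *)

Section Derivatives.
Context {R : realType}.
Implicit Types (g h : R -> R[i]).

Lemma cderivable_cder h (t : R) : cderivable h t -> cder h t (cderive h t).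
Proof.
by move=> [h1 h2]; split; rewrite ?ReI ?ImI derive1E; exact: derivableP.
Qed.

Lemma has_lim0p_cvg h : has_lim0p h ->
  Re (h t) @[t --> (0 : R)^'+] --> Re (lim0p h) /\
  Im (h t) @[t --> (0 : R)^'+] --> Im (lim0p h).
Proof.
rewrite /has_lim0p /lim0p; set l := lim _ => /cvgrPdist_lt hl.
have aux (p : R[i] -> R) : (forall z w, p (z - w) = p z - p w) ->
    (forall z, `|p z| <= cabs z) -> p (h t) @[t --> (0 : R)^'+] --> p l.
  move=> pB ple; apply/cvgrPdist_lt => e e0.
  have ec : 0 < e%:C :> R[i] by rewrite ltcR.
  near=> t; rewrite -pB; apply: le_lt_trans (ple _) _.
  rewrite -ltcR -normE; near: t; exact: hl.
by split; apply: aux => *; rewrite ?ReB ?ImB ?cabs_Re ?cabs_Im.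
Unshelve. all: by end_near. Qed.

Lemma laplace_cderiven g (w : R[i]) m (L : nat -> R[i]) : 0 < Re w ->
  (forall j, (j < m)%N -> forall t : R, 0 < t -> cderivable (cderiven j g) t) ->
  (forall j, (j < m)%N -> Re (cderiven j g t) @[t --> (0 : R)^'+] --> Re (L j) /\
     Im (cderiven j g t) @[t --> (0 : R)^'+] --> Im (L j)) ->
  laplace_exists (cderiven m g) w ->
  laplace_exists g w /\
  laplace (cderiven m g) w = w ^+ m * laplace g w - \sum_(n < m) w ^+ n * L (m - n - 1)%N.
Proof.
move=> w0; elim: m => [|m ih] hd hL hm; first by rewrite big_ord0 expr0 mul1r subr0.
have [l1 l2] := hL m (ltnSn m).
have [em ->] := laplace_derivative w0 (fun t t0 => cderivable_cder (hd m (ltnSn m) t t0)) l1 l2 hm.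
have [eg ->] := ih (fun j jm => hd j (ltnW jm)) (fun j jm => hL j (ltnW jm)) em.
split => //; rewrite big_ord_recl expr0 mul1r subn0 subn1 /= mulrBr exprS mulrA.
rewrite opprD addrA addrAC; congr (_ - _ - _).
by rewrite mulr_sumr; apply: eq_bigr => n _; rewrite /bump /= exprS mulrA subSS.
Qed.

End Derivatives.

Theorem lemma3p1 (R : realType) (k : R) (alpha mu omega gamma : R[i])
    (f : R -> R[i]) (u : R[i])
    (k_gt0 : 0 < k) (alpha_gt0 : 0 < Re alpha) (mu_gt0 : 0 < Re mu)
    (f_locint : forall b : R, 0 < b -> cintegrable `]0, b] f)
    (Df_exists : kD_exists k alpha mu omega gamma f)
    (u_gt0 : 0 < Re u)
    (u_dom : `|omega * k%:C * cpow (k%:C * u) (- (alpha / k%:C))| < 1)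
    (Lf_exists : laplace_exists f u)
    (LDf_exists : laplace_exists (kD k alpha mu omega gamma f) u)
    (lim_exists : forall n : nat, (n < korder k mu)%N ->
       has_lim0p (kDn k (korder k mu - n - 1) alpha
                    (mu - n.+1%:R * k%:C) omega gamma f)) :
  laplace (kD k alpha mu omega gamma f) u =
    cpow (k%:C * u) (mu / k%:C) *
    cpow (1 - omega * k%:C * cpow (k%:C * u) (- (alpha / k%:C)))
         (gamma / k%:C) *
    laplace f u -
    \sum_(n < korder k mu)
      k%:C * (k%:C * u) ^+ n *
      lim0p (kDn k (korder k mu - n - 1) alpha
               (mu - n.+1%:R * k%:C) omega gamma f)
  /\
  (korder k mu = 1%N ->
   laplace (kD k alpha mu omega gamma f) u =
     cpow (k%:C * u) (mu / k%:C) *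
     cpow (1 - omega * k%:C * cpow (k%:C * u) (- (alpha / k%:C)))
          (gamma / k%:C) *
     laplace f u -
     k%:C * lim0p (kP k alpha (k%:C - mu) omega (- gamma) f)).
Proof.
set m := korder k mu in lim_exists *.
suff main : laplace (kD k alpha mu omega gamma f) u =
    cpow (k%:C * u) (mu / k%:C) *
    cpow (1 - omega * k%:C * cpow (k%:C * u) (- (alpha / k%:C)))
         (gamma / k%:C) *
    laplace f u -
    \sum_(n < m)
      k%:C * (k%:C * u) ^+ n *
      lim0p (kDn k (m - n - 1) alpha (mu - n.+1%:R * k%:C) omega gamma f).
  split=> // m1; rewrite main m1 big_ord1 expr0 mulr1; congr (_ - _ * lim0p _).
  by apply/funext => t; rewrite /kDn /= expr0 mul1r !mul0r !mul1r sub0r opprB.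
have kn : k%:C != 0 :> R[i] by exact: real_neq0.
have un : u != 0 by exact: Re_gt0_neq0.
pose nu := m%:R * k%:C - mu; pose g := kP k alpha nu omega (- gamma) f.
have kV z : Re (z / k%:C) = Re z / k by rewrite mulrC -fmorphV ReMC mulrC.
have nu0 : 0 < Re nu.
  rewrite /nu ReB (@natC R) ReMC ReC subr_gt0 -ltr_pdivrMr //.
  exact: truncnS_gt.
pose a := alpha / k%:C; pose b := nu / k%:C; pose c := - gamma / k%:C.
pose q := omega * k%:C * cpow k%:C (- a).
have a0 : 0 < Re a by rewrite kV divr_gt0.
have b0 : 0 < Re b by rewrite kV divr_gt0.
have qE : omega * k%:C * cpow (k%:C * u) (- a) = q * cpow u (- a).
  by rewrite cpowM // mulrA.
have qu : cabs (q * cpow u (- a)) < 1 by rewrite -qE -ltcR -normE.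
have [gP gd] := Df_exists; rewrite -/m -/nu in gP gd.
have kX j : (k ^+ j)%:C = k%:C ^+ j by exact: rmorphXn.
(* All the derivatives in the formula are derivatives of the same [g], because
   [(m - n - 1) k - (mu - (n + 1) k) = m k - mu]. *)
pose D n := kDn k (m - n - 1) alpha (mu - n.+1%:R * k%:C) omega gamma f.
have DE n (t : R) : (n < m)%N -> D n t = k%:C ^+ (m - n - 1) * cderiven (m - n - 1) g t.
  move=> nm; have e : (m - n - 1)%:R * k%:C - (mu - n.+1%:R * k%:C) = nu.
    have -> : nu = ((m - n - 1)%:R + n.+1%:R) * k%:C - mu.
      by rewrite -natrD addnS subn1 -addSn prednK ?subn_gt0 // subnK // ltnW.
    by ring.
  by rewrite /D /kDn e kX.
have rev j : (j < m)%N -> (m - (m - j - 1) - 1)%N = j.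
  move=> jm; have -> : (m - j - 1 = m - j.+1)%N by rewrite -subnDA addn1.
  by rewrite subKn // subn1.
pose L j := k%:C ^- j * lim0p (D (m - j - 1)%N).
have DL j : (j < m)%N -> Re (cderiven j g t) @[t --> (0 : R)^'+] --> Re (L j) /\
     Im (cderiven j g t) @[t --> (0 : R)^'+] --> Im (L j).
  move=> jm; have jm' : (m - j - 1 < m)%N.
    by rewrite -subnDA addn1 ltn_subrL (leq_trans _ jm).
  have [h1 h2] := has_lim0p_cvg (lim_exists _ jm').
  have gE (t : R) : cderiven j g t = k%:C ^- j * D (m - j - 1)%N t.
    by rewrite DE // rev // mulKf // expf_neq0.
  have kE : k%:C ^- j = ((k ^+ j)^-1)%:C by rewrite -kX fmorphV.
  split; under eq_fun do rewrite gE kE.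
    under eq_fun do rewrite ReMC.
    by rewrite /L kE ReMC; apply: cvgM => //; exact: cvg_cst.
  under eq_fun do rewrite ImMC.
  by rewrite /L kE ImMC; apply: cvgM => //; exact: cvg_cst.
have DfE : kD k alpha mu omega gamma f = fun t => k%:C ^+ m * cderiven m g t.
  by apply/funext => t; rewrite /kD /kDn -/m -/nu -/g kX.
have km0 : k%:C ^+ m != 0 by rewrite expf_neq0.
have iDm : laplace_exists (cderiven m g) u.
  have := (laplaceZ (k%:C ^- m) LDf_exists).1; apply: eq_laplace_exists => s _.
  by rewrite DfE mulKf.
have [ig eD] := laplace_cderiven u_gt0 gd DL iDm.
(* The factor [k ^ b] makes the coefficients of the series those of [ml_coef]. *)
pose phi (s : R) := cpow k%:C b * (cpow s%:C (b - 1) / k%:C *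
  kML k alpha nu (- gamma) (omega * cpow s%:C a)).
have [rho rho0 hphi] := laplace_ml a0 b0 (fun s s0 =>
  kernel_csum omega (- gamma) k_gt0 alpha_gt0 nu0 s0 : csum _ (phi s)).
have [igk egk] := laplaceZ (cpow k%:C b) ig.
have key : laplace (fun s => cpow k%:C b * g s) u = symbol a b c q u * laplace f u.
  apply: (laplace_symbol (rho := rho)) => // w rw qw jf.
  have wn : w != 0 by apply: Re_gt0_neq0; exact: lt_trans rw.
  have [ip sp] := hphi w rw.
  have phiE (x t : R) : phi (x - t) * f t =
      cpow k%:C b * kP_integrand k alpha nu omega (- gamma) f x t.
    by rewrite /phi -[LHS]mulrA.
  have [|x x0|_ ->] := laplace_convolution (g := fun s => cpow k%:C b * g s) ip jf.
  - move=> x x0; apply: (eq_cintegrable (measurable_itv _) (fun t _ => esym (phiE x t))).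
    exact: (cintegrableZ (measurable_itv _) _ (gP x x0)).
  - rewrite /g /kP -(cintegralZ (measurable_itv _) _ (gP x x0)).
    by apply: eq_cintegral => t _; rewrite phiE.
  by congr (_ * _); apply: (csum_unique sp); exact: csum_symbol.
have cE : - c = gamma / k%:C by rewrite /c mulNr opprK.
have Lg : laplace g u = cpow (k%:C * u) (- b) *
    cpow (1 - omega * k%:C * cpow (k%:C * u) (- a)) (gamma / k%:C) * laplace f u.
  rewrite qE cpowM // (cpowN b kn) -!mulrA; apply: (mulfI (cpow_neq0 b kn)).
  rewrite -egk key mulVKf ?cpow_neq0 // /symbol cE.
  by rewrite /q !mulrA.
rewrite DfE (laplaceZ (k%:C ^+ m) iDm).2 eD mulrBr; congr (_ - _).
  rewrite [LHS]mulrA -exprMn [X in _ * X = _]Lg [LHS]mulrA; congr (_ * _).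
  rewrite [LHS]mulrA; congr (_ * _).
  rewrite -cpow_nat ?mulf_neq0 // -cpowD ?mulf_neq0 //; congr cpow.
  by rewrite /b /nu; field.
rewrite mulr_sumr; apply: eq_bigr => n _; have nm := ltn_ord n.
rewrite /L (rev n nm) !mulrA; congr (_ * _).
have -> : k%:C ^+ m = k%:C ^+ n.+1 * k%:C ^+ (m - n - 1).
  by rewrite -exprD -subnDA addn1 subnKC.
by rewrite exprMn exprS; field; rewrite expf_neq0.
Qed.
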